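(* Let $n\ge 2$ and let $d_1,\dots,d_n$ be positive integers with $\xi:=\sum_{i=1}^n 1/d_i<1$. Put $K=\max_i d_i$. (a) Case $p=1$. There exists $s^*>0$ (depending on $n,d_1,\dots,d_n$) such that the following holds for every $s_1\in(0,s^* )$. Let $a_1,\dots,a_{n-1}\in\mathbb{C}$ have moduli $|a_{n-1}|=(s_1K^{-2})^{1/d_n}$ and $|a_i|=(s_1K^{-5})^{1/d_{i+1}}|a_{i+1}|$ for $1\le i\le n-2$, with arbitrary arguments. Then the Julia set of $f_{1,d_1,\dots,d_n}$ is a Cantor set of circles. (b) Case $p=0$. There exists $s^*>0$ (depending on $n,d_1,\dots,d_n$) such that the following holds for every $s_0\in(0,s^* )$. Let $a_1,\dots,a_{n-1}\in\mathbb{C}$ have moduli $|a_{n-1}|=\big(s_0^{1/d_n+(1-\xi)/3}\big)^{1/d_n}$ and $|a_i|=\big(s_0^{1+1/d_n+2(1-\xi)/3}\big)^{1/d_{i+1}}|a_{i+1}|$ for $1\le i\le n-2$, with arbitrary arguments. Then the Julia set of $f_{0,d_1,\dots,d_n}$ is a Cantor set of circles. In particular, for every $p\in\{0,1\}$, every $n\ge2$ and every $d_1,\dots,d_n$ with $\sum 1/d_i<1$, there exist parameters $a_1,\dots,a_{n-1}$ such that the Julia set of $f_{p,d_1,\dots,d_n}$ is a Cantor set of circles.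
   Context: A subset of the Riemann sphere $\overline{\mathbb{C}}$ is a Cantor set of circles if it is homeomorphic to $\mathcal{C}\times\mathbb{S}^1$, where $\mathcal{C}$ is the middle-third Cantor set and $\mathbb{S}^1$ the unit circle. For $p\in\{0,1\}$, an integer $n\ge2$, positive integers $d_1,\dots,d_n$ with $\sum_{i=1}^n 1/d_i<1$, and complex numbers $a_1,\dots,a_{n-1}$ with $0<|a_1|<\dots<|a_{n-1}|<1$, define the rational map $$f_{p,d_1,\dots,d_n}(z)=z^{(-1)^{n-p}d_1}\prod_{i=1}^{n-1}\big(z^{d_i+d_{i+1}}-a_i^{d_i+d_{i+1}}\big)^{(-1)^{n-i-p}}.$$ (The parameter moduli in the claim automatically satisfy $0<|a_1|<\dots<|a_{n-1}|<1$ for small $s_1$, $s_0$.) *)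

(* Defs.v *)
From Stdlib Require Import Reals Lra List Arith.
Open Scope R_scope.

Definition Cpx : Type := (R * R)%type.
Definition C0 : Cpx := (0, 0).
Definition C1 : Cpx := (1, 0).
Definition Cadd (z w : Cpx) : Cpx := (fst z + fst w, snd z + snd w).
Definition Csub (z w : Cpx) : Cpx := (fst z - fst w, snd z - snd w).
Definition Cmul (z w : Cpx) : Cpx :=
  (fst z * fst w - snd z * snd w, fst z * snd w + snd z * fst w).
Definition Cinv (z : Cpx) : Cpx :=
  let r := fst z * fst z + snd z * snd z in (fst z / r, - snd z / r).
Fixpoint Cpow (z : Cpx) (k : nat) : Cpx :=
  match k with O => C1 | S k' => Cmul z (Cpow z k') end.
Definition Cnorm (z : Cpx) : R := sqrt (fst z * fst z + snd z * snd z).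

(** Riemann sphere: [None] is the point at infinity. *)
Definition Sphere : Type := option Cpx.

Definition chordal (u v : Sphere) : R :=
  match u, v with
  | Some z, Some w =>
      2 * Cnorm (Csub z w) /
        sqrt ((1 + Cnorm z * Cnorm z) * (1 + Cnorm w * Cnorm w))
  | Some z, None | None, Some z => 2 / sqrt (1 + Cnorm z * Cnorm z)
  | None, None => 0
  end.

Definition sphere_continuous (F : Sphere -> Sphere) : Prop :=
  forall u eps, 0 < eps -> exists delta, 0 < delta /\
    forall v, chordal u v < delta -> chordal (F u) (F v) < eps.

Definition equicontinuous_at (F : Sphere -> Sphere) (u : Sphere) : Prop :=
  forall eps, 0 < eps -> exists delta, 0 < delta /\
    forall (k : nat) v, chordal u v < delta ->
      chordal (Nat.iter k F u) (Nat.iter k F v) < eps.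
Definition julia_set (F : Sphere -> Sphere) (u : Sphere) : Prop :=
  ~ equicontinuous_at F u.

Definition cantor_set (x : R) : Prop :=
  exists b : nat -> bool,
    infinite_sum (fun k => (if b k then 2 else 0) / 3 ^ (S k)) x.
Definition circle (q : R * R) : Prop := fst q * fst q + snd q * snd q = 1.

Definition CS1 (q : R * (R * R)) : Prop := cantor_set (fst q) /\ circle (snd q).
Definition dist_RR2 (q q' : R * (R * R)) : R :=
  Rabs (fst q - fst q') +
  sqrt ((fst (snd q) - fst (snd q')) ^ 2 + (snd (snd q) - snd (snd q')) ^ 2).

Definition cantor_set_of_circles (J : Sphere -> Prop) : Prop :=
  exists (h : Sphere -> R * (R * R)) (g : R * (R * R) -> Sphere),
    (forall u, J u -> CS1 (h u)) /\
    (forall q, CS1 q -> J (g q)) /\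
    (forall u, J u -> g (h u) = u) /\
    (forall q, CS1 q -> h (g q) = q) /\
    (forall u eps, J u -> 0 < eps -> exists delta, 0 < delta /\
       forall v, J v -> chordal u v < delta -> dist_RR2 (h u) (h v) < eps) /\
    (forall q eps, CS1 q -> 0 < eps -> exists delta, 0 < delta /\
       forall q', CS1 q' -> dist_RR2 q q' < delta -> chordal (g q) (g q') < eps).

(** The rational map f_{p,d_1..d_n} at a finite point z (d, a indexed from 1).
    Exponent (-1)^k is realised as identity for even k, inversion for odd k. *)
Definition sgnpow (k : nat) (w : Cpx) : Cpx := if Nat.even k then w else Cinv w.

Definition f_formula (p n : nat) (d : nat -> nat) (a : nat -> Cpx) (z : Cpx) : Cpx :=
  Cmul (sgnpow (n - p) (Cpow z (d 1%nat)))
    (fold_right Cmul C1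
       (map (fun i => sgnpow (n - i - p)
               (Csub (Cpow z (d i + d (S i))%nat) (Cpow (a i) (d i + d (S i))%nat)))
            (seq 1 (n - 1)))).

Definition regular_point (n : nat) (d : nat -> nat) (a : nat -> Cpx) (z : Cpx) : Prop :=
  z <> C0 /\ forall i, (1 <= i <= n - 1)%nat ->
    Cpow z (d i + d (S i))%nat <> Cpow (a i) (d i + d (S i))%nat.

(** F : Sphere -> Sphere is the rational map f_{p,d,a} on the Riemann sphere:
    the continuous map agreeing with the formula wherever it is defined
    (such an extension is unique since regular points are dense). *)
Definition is_rational_map (p n : nat) (d : nat -> nat) (a : nat -> Cpx)
    (F : Sphere -> Sphere) : Prop :=
  sphere_continuous F /\
  forall z, regular_point n d a z -> F (Some z) = Some (f_formula p n d a z).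

Definition xi (n : nat) (d : nat -> nat) : R :=
  fold_right Rplus 0 (map (fun i => / INR (d i)) (seq 1 n)).
Definition Kmax (n : nat) (d : nat -> nat) : nat :=
  fold_right Nat.max 0%nat (map d (seq 1 n)).

(* Main.v *)
(** Work in the logarithmic coordinate [u = log z].  Between two consecutive
    critical circles [|z| = |a_i|], [|z| = |a_(i+1)|] the map is [z |-> c z^(+-d_(i+1))] times
    factors [(1 - w)^(+-1)] with [w] small, so it lifts to an affine map of slope [+-d_(i+1)] plus
    an error whose Lipschitz constant is at most 4/5; as all [d_i >= 2], the lift expands by 6/5.
    The parameters are chosen so that [log |f|] oscillates between two levels beyond the ends of
    an interval [alpha, beta]: outside the annulus [alpha <= log |z| <= beta] orbits converge
    uniformly to {0, infinity}, and the annulus is covered once by each of [n] subannuli.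
    A sequence of subannuli and an angle [t] determine a unique point, the limit of the
    corresponding inverse branches, on whose lifts the dynamics multiplies [t] by [+-d_i].
    These points are exactly the Julia set; expansion makes the coding bicontinuous, and a
    complete prefix code turns sequences over [n] symbols into points of the Cantor set. *)

From Coquelicot Require Import Coquelicot.
From Stdlib Require Import Reals Lra Lia List Arith ZArith.
From Stdlib Require Import FunctionalExtensionality ClassicalEpsilon.
Require Import Defs.
Open Scope R_scope.

(** * Plane geometry, exponential and logarithm *)

(** The condition on the sum of the 1/d_i is a count of widths. Let [G] be the oscillation of log
    |f| between its two levels. Consecutive critical circles are G / d_(i+1) apart and the innermost
    annulus needs width G / d_1, so [alpha] must lie at least G times the sum of 1/d_i over i < n
    below the last circle, while the level at the zeros must lie below [alpha]. Since [xi] is less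
    than 1 there is room for both, a fixed multiple of (1 - xi) * (- ln s), which for small s
    absorbs the bounded errors. For p = 0 both levels grow as s tends to 0. For p = 1 the level at
    the poles stays bounded; this is the source of the powers of K and of the tight numerical
    estimates in that case.

    The Julia set is defined by failure of equicontinuity, so each inclusion is an estimate in the
    chordal metric. A point that leaves the annulus takes a whole neighbourhood into one sequence of
    shrinking caps. A point that stays is moved by a half-turn at a deep level, which changes it
    very little but changes a late iterate by a fixed amount. *)

Lemma Cnorm_sq (z : Cpx) : Cnorm z * Cnorm z = fst z * fst z + snd z * snd z.
Proof. unfold Cnorm. apply sqrt_sqrt. nra. Qed.

Lemma Cnorm_ge0 (z : Cpx) : 0 <= Cnorm z.
Proof. apply sqrt_pos. Qed.

Lemma Cnorm_le_sq (z : Cpx) (M : R) :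
  0 <= M -> fst z * fst z + snd z * snd z <= M * M -> Cnorm z <= M.
Proof. intros HM H. pose proof (Cnorm_sq z). pose proof (Cnorm_ge0 z). nra. Qed.

Lemma Cnorm_Cmod (z : Cpx) : Cnorm z = Cmod z.
Proof. unfold Cnorm, Cmod. f_equal. ring. Qed.

Lemma Cnorm_add (z w : Cpx) : Cnorm (Cadd z w) <= Cnorm z + Cnorm w.
Proof. rewrite !Cnorm_Cmod. apply (Cmod_triangle z w). Qed.

Lemma Cnorm_sub_sym (z w : Cpx) : Cnorm (Csub z w) = Cnorm (Csub w z).
Proof. unfold Cnorm, Csub; simpl. f_equal. ring. Qed.

Lemma Cdist_triangle (u v w : Cpx) :
  Cnorm (Csub u w) <= Cnorm (Csub u v) + Cnorm (Csub v w).
Proof.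
  replace (Csub u w) with (Cadd (Csub u v) (Csub v w)).
  - apply Cnorm_add.
  - unfold Cadd, Csub; simpl. f_equal; ring.
Qed.

Lemma Csub_diag (u : Cpx) : Cnorm (Csub u u) = 0.
Proof.
  unfold Cnorm, Csub; simpl.
  replace ((fst u - fst u) * (fst u - fst u) + (snd u - snd u) * (snd u - snd u)) with 0 by ring.
  apply sqrt_0.
Qed.

Lemma Cnorm_fst (z : Cpx) : Rabs (fst z) <= Cnorm z.
Proof.
  pose proof (Cnorm_sq z). pose proof (Cnorm_ge0 z). apply Rabs_le. nra.
Qed.

Lemma Cnorm_snd (z : Cpx) : Rabs (snd z) <= Cnorm z.
Proof.
  pose proof (Cnorm_sq z). pose proof (Cnorm_ge0 z). apply Rabs_le. nra.
Qed.

Lemma Cnorm_le_abs (z : Cpx) : Cnorm z <= Rabs (fst z) + Rabs (snd z).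
Proof.
  apply Cnorm_le_sq.
  - pose proof (Rabs_pos (fst z)). pose proof (Rabs_pos (snd z)). lra.
  - pose proof (Rabs_pos (fst z)). pose proof (Rabs_pos (snd z)).
    assert (Hs : forall x, x * x = Rabs x * Rabs x).
    { intro x. rewrite <- Rabs_mult. symmetry. apply Rabs_pos_eq. nra. }
    rewrite (Hs (fst z)), (Hs (snd z)). nra.
Qed.

Lemma Cnorm_eq0 (z : Cpx) : Cnorm z = 0 -> z = C0.
Proof.
  intro H. pose proof (Cnorm_sq z) as Hs. rewrite H in Hs.
  destruct z as [x y]; simpl in *. unfold C0. f_equal; nra.
Qed.

Lemma Csub_eq0 (u v : Cpx) : Cnorm (Csub u v) = 0 -> u = v.
Proof.
  intro H. apply Cnorm_eq0 in H. destruct u, v. unfold Csub, C0 in H; simpl in H.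
  injection H as H1 H2. f_equal; lra.
Qed.

Lemma Cnorm_mul (z w : Cpx) : Cnorm (Cmul z w) = Cnorm z * Cnorm w.
Proof. rewrite !Cnorm_Cmod. apply (Cmod_mult z w). Qed.

Lemma Cnorm_C1 : Cnorm C1 = 1.
Proof.
  unfold Cnorm, C1; simpl. replace (1 * 1 + 0 * 0) with 1 by ring. apply sqrt_1.
Qed.

Lemma exp_le (x y : R) : x <= y -> exp x <= exp y.
Proof. intros [H|H]; [left; now apply exp_increasing | subst; apply Rle_refl]. Qed.

Definition cexp (u : Cpx) : Cpx := (exp (fst u) * cos (snd u), exp (fst u) * sin (snd u)).

Lemma Cnorm_cexp (u : Cpx) : Cnorm (cexp u) = exp (fst u).
Proof.
  unfold Cnorm, cexp; simpl. pose proof (exp_pos (fst u)).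
  pose proof (sin2_cos2 (snd u)) as Hsc. unfold Rsqr in Hsc.
  replace (exp (fst u) * cos (snd u) * (exp (fst u) * cos (snd u)) +
           exp (fst u) * sin (snd u) * (exp (fst u) * sin (snd u)))
    with (exp (fst u) * exp (fst u) * (sin (snd u) * sin (snd u) + cos (snd u) * cos (snd u)))
    by ring.
  rewrite Hsc, Rmult_1_r. apply sqrt_square. lra.
Qed.

Lemma cexp_add (u v : Cpx) : cexp (Cadd u v) = Cmul (cexp u) (cexp v).
Proof.
  unfold cexp, Cadd, Cmul; simpl. rewrite exp_plus, cos_plus, sin_plus. f_equal; ring.
Qed.

Lemma cexp_0 : cexp C0 = C1.
Proof. unfold cexp, C0, C1; simpl. rewrite exp_0, cos_0, sin_0. f_equal; ring. Qed.

Lemma cexp_neq0 (u : Cpx) : cexp u <> C0.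
Proof.
  intro H. pose proof (Cnorm_cexp u) as E. rewrite H in E. pose proof (exp_pos (fst u)).
  unfold Cnorm, C0 in E; simpl in E. rewrite Rmult_0_l, Rplus_0_r, sqrt_0 in E. lra.
Qed.

Definition Cscal (r : R) (u : Cpx) : Cpx := (r * fst u, r * snd u).

Lemma Cnorm_scal (r : R) (u : Cpx) : Cnorm (Cscal r u) = Rabs r * Cnorm u.
Proof.
  replace (Cscal r u) with (Cmul (r, 0) u).
  - rewrite Cnorm_mul. f_equal. unfold Cnorm; simpl.
    replace (r * r + 0 * 0) with (Rsqr r) by (unfold Rsqr; ring). apply sqrt_Rsqr_abs.
  - unfold Cmul, Cscal; simpl. f_equal; ring.
Qed.

Lemma cexp_pow (u : Cpx) (k : nat) : Cpow (cexp u) k = cexp (Cscal (INR k) u).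
Proof.
  induction k as [|k IH].
  - simpl. rewrite <- cexp_0. f_equal. unfold Cscal, C0; simpl. f_equal; ring.
  - simpl Cpow. rewrite IH, <- cexp_add. f_equal.
    rewrite S_INR. unfold Cadd, Cscal; simpl. f_equal; ring.
Qed.

Lemma cexp_opp (u : Cpx) : Cinv (cexp u) = cexp (Cscal (-1) u).
Proof.
  unfold Cinv. rewrite <- Cnorm_sq, Cnorm_cexp. unfold cexp, Cscal; simpl.
  replace (-1 * snd u) with (- snd u) by ring.
  replace (-1 * fst u) with (- fst u) by ring.
  rewrite cos_neg, sin_neg, exp_Ropp. pose proof (exp_pos (fst u)). f_equal; field; lra.
Qed.

Lemma polar_angle (x y : R) : x * x + y * y = 1 -> exists t, cos t = x /\ sin t = y.
Proof.
  intro H. assert (Hx : -1 <= x <= 1) by nra.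
  assert (Hs : sin (acos x) = sqrt (y * y)).
  { rewrite sin_acos by auto. f_equal. unfold Rsqr. lra. }
  destruct (Rle_dec 0 y) as [Hy | Hy].
  - exists (acos x). split; [now apply cos_acos|]. rewrite Hs. now apply sqrt_square.
  - exists (- acos x). rewrite cos_neg, sin_neg. split; [now apply cos_acos|].
    rewrite Hs. replace (y * y) with (- y * - y) by ring. rewrite sqrt_square; lra.
Qed.

Lemma cexp_surj (z : Cpx) : z <> C0 -> exists u, cexp u = z /\ fst u = ln (Cnorm z).
Proof.
  intro Hz. assert (Hn : 0 < Cnorm z).
  { destruct (Cnorm_ge0 z) as [H|H]; auto. symmetry in H. now apply Cnorm_eq0 in H. }
  pose proof (Cnorm_sq z) as Hs. set (r := Cnorm z) in *.
  destruct (polar_angle (fst z / r) (snd z / r)) as [t [Hc Ht]].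
  { replace (fst z / r * (fst z / r) + snd z / r * (snd z / r))
      with ((fst z * fst z + snd z * snd z) / (r * r)) by (field; lra).
    rewrite <- Hs. field. lra. }
  exists (ln r, t). split; auto. unfold cexp; simpl. rewrite exp_ln, Hc, Ht by auto.
  destruct z; simpl. f_equal; field; lra.
Qed.

Lemma cos_sin_eq (s t : R) : cos s = cos t -> sin s = sin t -> exists m : Z, s = t + 2 * PI * IZR m.
Proof.
  intros Hc Hs.
  assert (H : sin ((s - t) / 2) = 0).
  { assert (E : cos (s - t) = 1).
    { rewrite cos_minus, Hc, Hs. pose proof (sin2_cos2 t). unfold Rsqr in *. lra. }
    replace (s - t) with (2 * ((s - t) / 2)) in E by field.
    rewrite cos_2a_sin in E. nra. }
  apply sin_eq_0_0 in H. destruct H as [m Hm]. exists m. lra.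
Qed.

Lemma cos_sin_period (t : R) (m : Z) :
  cos (t + 2 * PI * IZR m) = cos t /\ sin (t + 2 * PI * IZR m) = sin t.
Proof.
  assert (Hs : sin (PI * IZR m) = 0) by (apply sin_eq_0_1; exists m; ring).
  assert (Hc : cos (2 * PI * IZR m) = 1).
  { replace (2 * PI * IZR m) with (2 * (PI * IZR m)) by ring. rewrite cos_2a_sin, Hs. ring. }
  assert (Hs2 : sin (2 * PI * IZR m) = 0).
  { replace (2 * PI * IZR m) with (2 * (PI * IZR m)) by ring. rewrite sin_2a, Hs. ring. }
  rewrite cos_plus, sin_plus, Hc, Hs2. split; ring.
Qed.

Definition shift (u : Cpx) (m : Z) : Cpx := (fst u, snd u + 2 * PI * IZR m).

Lemma cexp_shift (u : Cpx) (m : Z) : cexp (shift u m) = cexp u.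
Proof.
  unfold cexp, shift; simpl. destruct (cos_sin_period (snd u) m) as [-> ->]. reflexivity.
Qed.

Lemma cexp_inj (u v : Cpx) : cexp u = cexp v -> exists m, u = shift v m.
Proof.
  intro H. assert (Hf : fst u = fst v).
  { apply exp_inv. now rewrite <- !Cnorm_cexp, H. }
  unfold cexp in H. rewrite Hf in H. injection H as H1 H2. pose proof (exp_pos (fst v)).
  destruct (cos_sin_eq (snd u) (snd v)) as [m Hm].
  - apply (Rmult_eq_reg_l (exp (fst v))); lra.
  - apply (Rmult_eq_reg_l (exp (fst v))); lra.
  - exists m. unfold shift. destruct u; simpl in *. now subst.
Qed.

Lemma mean_value_plane (f g f' g' : R -> R) (M : R) :
  0 <= M ->
  (forall t, 0 <= t <= 1 -> is_derive f t (f' t)) ->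
  (forall t, 0 <= t <= 1 -> is_derive g t (g' t)) ->
  (forall t, 0 <= t <= 1 -> f' t * f' t + g' t * g' t <= M * M) ->
  Cnorm (Csub (f 1, g 1) (f 0, g 0)) <= M.
Proof.
  intros HM Hf Hg Hb. set (N := Cnorm _).
  (* Project onto the direction [e] of the increment to reduce to the real mean value theorem. *)
  set (A := f 1 - f 0). set (B := g 1 - g 0).
  assert (HN : N * N = A * A + B * B) by (unfold N; rewrite Cnorm_sq; reflexivity).
  assert (HN0 : 0 <= N) by apply Cnorm_ge0.
  set (phi := fun t => A * f t + B * g t).
  assert (Hd : forall t, 0 <= t <= 1 -> is_derive phi t (A * f' t + B * g' t)).
  { intros t Ht. unfold phi.
    apply (is_derive_plus (fun t => A * f t) (fun t => B * g t)).
    - apply (is_derive_scal f). auto.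
    - apply (is_derive_scal g). auto. }
  destruct (MVT_gen phi 0 1 (fun t => A * f' t + B * g' t)) as [c [Hc He]].
  - intros t Ht. rewrite Rmin_left, Rmax_right in Ht by lra. apply Hd. lra.
  - intros t Ht. rewrite Rmin_left, Rmax_right in Ht by lra.
    apply continuity_pt_filterlim. apply (ex_derive_continuous phi).
    eexists. apply Hd. lra.
  - rewrite Rmin_left, Rmax_right in Hc by lra.
    assert (HE : N * N = A * f' c + B * g' c).
    { rewrite HN. unfold phi in He. unfold A, B in *. nra. }
    assert (HS : (A * f' c + B * g' c) * (A * f' c + B * g' c)
                 <= (A * A + B * B) * (f' c * f' c + g' c * g' c)).
    { pose proof (Rle_0_sqr (A * g' c - B * f' c)) as Hsq. unfold Rsqr in Hsq. lra. }
    specialize (Hb c Hc). rewrite <- HE, <- HN in HS.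
    assert (HX : (N * N) * (N * N) <= (N * N) * (M * M)).
    { eapply Rle_trans; [exact HS|]. apply Rmult_le_compat_l; nra. }
    destruct (Req_dec N 0) as [Z|Z]; [lra|].
    assert (0 < N * N) by nra. assert (N * N <= M * M) by (eapply Rmult_le_reg_l; eauto). nra.
Qed.

(** The derivative of exp has modulus [exp (fst _)], at most [exp m] on a half-plane, which is
    convex and so contains the segment from [v] to [u]. *)
Lemma cexp_lip (u v : Cpx) (m : R) : fst u <= m -> fst v <= m ->
  Cnorm (Csub (cexp u) (cexp v)) <= exp m * Cnorm (Csub u v).
Proof.
  intros Hu Hv. set (h1 := fst u - fst v). set (h2 := snd u - snd v).
  assert (HN : Cnorm (Csub u v) * Cnorm (Csub u v) = h1 * h1 + h2 * h2) by apply Cnorm_sq.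
  pose proof (Cnorm_ge0 (Csub u v)) as HN0. set (N := Cnorm (Csub u v)) in *.
  pose proof (exp_pos m) as Hm.
  pose proof (mean_value_plane
    (fun t => exp (fst v + t * h1) * cos (snd v + t * h2))
    (fun t => exp (fst v + t * h1) * sin (snd v + t * h2))
    (fun t => h1 * (exp (fst v + t * h1) * cos (snd v + t * h2))
              - h2 * (exp (fst v + t * h1) * sin (snd v + t * h2)))
    (fun t => h1 * (exp (fst v + t * h1) * sin (snd v + t * h2))
              + h2 * (exp (fst v + t * h1) * cos (snd v + t * h2)))
    (exp m * N)) as K.
  simpl in K. unfold cexp, Csub at 1; simpl. unfold Csub at 1 in K; simpl in K.
  replace (fst v + 1 * h1) with (fst u) in K by (unfold h1; ring).
  replace (snd v + 1 * h2) with (snd u) in K by (unfold h2; ring).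
  rewrite !Rmult_0_l, !Rplus_0_r in K. apply K; clear K.
  - nra.
  - intros t _. auto_derive; auto. ring.
  - intros t _. auto_derive; auto. ring.
  - intros t Ht. set (E := exp (fst v + t * h1)).
    assert (HE : E <= exp m).
    { apply exp_le. unfold h1.
      assert (t * fst u <= t * m) by (apply Rmult_le_compat_l; lra).
      assert ((1 - t) * fst v <= (1 - t) * m) by (apply Rmult_le_compat_l; lra). lra. }
    assert (HE0 : 0 < E) by apply exp_pos.
    pose proof (sin2_cos2 (snd v + t * h2)) as Hsc. unfold Rsqr in Hsc.
    set (c := cos (snd v + t * h2)) in *. set (s := sin (snd v + t * h2)) in *.
    replace ((h1 * (E * c) - h2 * (E * s)) * (h1 * (E * c) - h2 * (E * s)) +
             (h1 * (E * s) + h2 * (E * c)) * (h1 * (E * s) + h2 * (E * c)))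
      with ((E * E) * (h1 * h1 + h2 * h2) * (s * s + c * c)) by ring.
    rewrite Hsc, <- HN, Rmult_1_r.
    replace (exp m * N * (exp m * N)) with (exp m * exp m * (N * N)) by ring.
    apply Rmult_le_compat_r; nra.
Qed.

(** * Principal logarithm near 1 *)

Definition clog (w : Cpx) : Cpx := (ln (Cnorm w), atan (snd w / fst w)).

Lemma cexp_clog (w : Cpx) : 0 < fst w -> cexp (clog w) = w.
Proof.
  intro Hw. destruct w as [x y]; simpl in *.
  assert (Hn : 0 < Cnorm (x, y)).
  { pose proof (Cnorm_fst (x, y)) as H; simpl in H. rewrite Rabs_pos_eq in H by lra. lra. }
  pose proof (Cnorm_sq (x, y)) as Hs; simpl in Hs.
  unfold cexp, clog; simpl. rewrite exp_ln by auto. set (r := Cnorm (x, y)) in *.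
  assert (Hq : sqrt (1 + (y / x)²) = r / x).
  { replace (1 + (y / x)²) with ((r / x) * (r / x)).
    - apply sqrt_square. apply Rlt_le, Rdiv_lt_0_compat; auto.
    - unfold Rsqr. replace (r / x * (r / x)) with (r * r / (x * x)) by (field; lra).
      rewrite Hs. field. lra. }
  rewrite cos_atan, sin_atan, Hq. f_equal; field; lra.
Qed.

Lemma fst_near_1 (w : Cpx) (q : R) : Cnorm (Csub w C1) <= q -> 1 - q <= fst w.
Proof.
  intro H. pose proof (Cnorm_fst (Csub w C1)) as K. unfold Csub, C1 in *; simpl in *.
  assert (Rabs (fst w - 1) <= q) by lra. apply Rabs_le_between in H0. lra.
Qed.

(** The derivative 1/w has modulus at most 1 / (1 - q) on the half-plane [1 - q <= fst w], which is
    convex and contains the disc. *)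
Lemma clog_lip (u v : Cpx) (q : R) : q < 1 ->
  Cnorm (Csub u C1) <= q -> Cnorm (Csub v C1) <= q ->
  Cnorm (Csub (clog u) (clog v)) <= Cnorm (Csub u v) / (1 - q).
Proof.
  intros Hq Hu Hv. set (h1 := fst u - fst v). set (h2 := snd u - snd v).
  assert (HN : Cnorm (Csub u v) * Cnorm (Csub u v) = h1 * h1 + h2 * h2) by apply Cnorm_sq.
  pose proof (Cnorm_ge0 (Csub u v)) as HN0. set (N := Cnorm (Csub u v)) in *.
  apply fst_near_1 in Hu. apply fst_near_1 in Hv.
  (* Half the logarithm of the squared norm, so that no square root has to be differentiated. *)
  assert (Hln : forall w : Cpx, 0 < fst w -> clog w =
    (/ 2 * ln (fst w * fst w + snd w * snd w), atan (snd w / fst w))).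
  { intros w Hw. unfold clog. f_equal. unfold Cnorm. 
    rewrite <- Rpower_sqrt by nra. unfold Rpower. now rewrite ln_exp. }
  rewrite !Hln by lra.
  set (x := fun t => fst v + t * h1). set (y := fun t => snd v + t * h2).
  assert (Hxt : forall t, 0 <= t <= 1 -> 1 - q <= x t).
  { intros t Ht. unfold x, h1.
    assert (t * (1 - q) <= t * fst u) by (apply Rmult_le_compat_l; lra).
    assert ((1 - t) * (1 - q) <= (1 - t) * fst v) by (apply Rmult_le_compat_l; lra). lra. }
  pose proof (mean_value_plane
    (fun t => / 2 * ln (x t * x t + y t * y t)) (fun t => atan (y t / x t))
    (fun t => (x t * h1 + y t * h2) / (x t * x t + y t * y t))
    (fun t => (x t * h2 - y t * h1) / (x t * x t + y t * y t))
    (N / (1 - q))) as K.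
  assert (Hx1 : x 1 = fst u) by (unfold x, h1; ring).
  assert (Hy1 : y 1 = snd u) by (unfold y, h2; ring).
  assert (Hx0 : x 0 = fst v) by (unfold x; ring).
  assert (Hy0 : y 0 = snd v) by (unfold y; ring).
  cbv beta in K. rewrite Hx1, Hy1, Hx0, Hy0 in K. apply K; clear K.
  - apply Rmult_le_pos; [auto|]. apply Rlt_le, Rinv_0_lt_compat. lra.
  - intros t Ht. assert (1 - q <= x t) by (apply Hxt; auto).
    assert (0 < x t * x t + y t * y t) by nra.
    unfold x, y in *. auto_derive; [auto|]. field. lra.
  - intros t Ht. assert (1 - q <= x t) by (apply Hxt; auto).
    assert (0 < x t * x t + y t * y t) by nra. assert (x t <> 0) by lra.
    unfold x, y in *. auto_derive; [auto|]. field. split; [lra|auto].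
  - intros t Ht. assert (Hx : 1 - q <= x t) by (apply Hxt; auto).
    set (X := x t) in *. set (Y := y t).
    replace ((X * h1 + Y * h2) / (X * X + Y * Y) * ((X * h1 + Y * h2) / (X * X + Y * Y)) +
      (X * h2 - Y * h1) / (X * X + Y * Y) * ((X * h2 - Y * h1) / (X * X + Y * Y)))
      with ((h1 * h1 + h2 * h2) / (X * X + Y * Y)) by (field; nra).
    rewrite <- HN. replace (N / (1 - q) * (N / (1 - q))) with (N * N / ((1 - q) * (1 - q)))
      by (field; lra).
    apply Rmult_le_compat_l; [nra|]. apply Rinv_le_contravar; nra.
Qed.

Lemma clog_C1 : clog C1 = C0.
Proof.
  unfold clog, C0. rewrite Cnorm_C1, ln_1. simpl. f_equal.
  replace (0 / 1) with 0 by field. apply atan_0.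
Qed.

(** [clog1m v] is the principal logarithm of [1 - e^v] for [Re v < 0]. *)
Definition clog1m (v : Cpx) : Cpx := clog (Csub C1 (cexp v)).

Lemma sub1_cexp_near (v : Cpx) : Cnorm (Csub (Csub C1 (cexp v)) C1) = exp (fst v).
Proof.
  rewrite <- Cnorm_cexp. rewrite Cnorm_sub_sym. f_equal. unfold Csub, C1; simpl.
  unfold cexp. f_equal; ring.
Qed.

Lemma cexp_clog1m (v : Cpx) : fst v < 0 -> cexp (clog1m v) = Csub C1 (cexp v).
Proof.
  intro Hv. apply cexp_clog. pose proof (fst_near_1 (Csub C1 (cexp v)) (exp (fst v))) as H.
  rewrite sub1_cexp_near in H. specialize (H (Rle_refl _)).
  assert (exp (fst v) < 1) by (rewrite <- exp_0; now apply exp_increasing). lra.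
Qed.

(** Composition of exp, with constant [q], and the logarithm, with constant [/ (1 - q)]. *)
Lemma clog1m_lip (u v : Cpx) (q : R) : q < 1 -> exp (fst u) <= q -> exp (fst v) <= q ->
  Cnorm (Csub (clog1m u) (clog1m v)) <= q / (1 - q) * Cnorm (Csub u v).
Proof.
  intros Hq Hu Hv. assert (0 < q) by (pose proof (exp_pos (fst u)); lra).
  eapply Rle_trans; [apply (clog_lip _ _ q); auto; rewrite sub1_cexp_near; auto|].
  replace (Csub (Csub C1 (cexp u)) (Csub C1 (cexp v))) with (Csub (cexp v) (cexp u))
    by (unfold Csub, C1; simpl; f_equal; ring).
  assert (Hl : forall w : Cpx, exp (fst w) <= q -> fst w <= ln q).
  { intros w Hw. rewrite <- (ln_exp (fst w)). apply ln_le; auto. apply exp_pos. }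
  rewrite Cnorm_sub_sym. pose proof (cexp_lip u v (ln q) (Hl u Hu) (Hl v Hv)) as K.
  rewrite exp_ln in K by auto.
  replace (q / (1 - q) * Cnorm (Csub u v)) with (q * Cnorm (Csub u v) / (1 - q)) by (field; lra).
  apply Rmult_le_compat_r; auto. apply Rlt_le, Rinv_0_lt_compat. lra.
Qed.

Lemma clog1m_bound (v : Cpx) (q : R) : q < 1 -> exp (fst v) <= q ->
  Cnorm (clog1m v) <= q / (1 - q).
Proof.
  intros Hq Hv. assert (0 < q) by (pose proof (exp_pos (fst v)); lra).
  replace (clog1m v) with (Csub (clog1m v) (clog C1)).
  - assert (H1 : Cnorm (Csub C1 C1) <= q) by (rewrite Csub_diag; lra).
    eapply Rle_trans.
    + apply (clog_lip _ _ q); auto. rewrite sub1_cexp_near. auto.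
    + rewrite sub1_cexp_near. apply Rmult_le_compat_r; auto.
      apply Rlt_le, Rinv_0_lt_compat. lra.
  - rewrite clog_C1. unfold Csub, C0; simpl. apply injective_projections; simpl; ring.
Qed.

Lemma clog1m_shift (v : Cpx) (m : Z) : clog1m (shift v m) = clog1m v.
Proof. unfold clog1m. now rewrite cexp_shift. Qed.

(** * Limits with a geometric rate *)

Lemma pow_small (C r eps : R) : 0 <= r < 1 -> 0 < eps -> exists N, forall k, (N <= k)%nat -> C * r ^ k < eps.
Proof.
  intros Hr He. destruct (pow_lt_1_zero r) with (y := eps / (Rabs C + 1)) as [N HN].
  - rewrite Rabs_pos_eq; lra.
  - apply Rdiv_lt_0_compat; auto. pose proof (Rabs_pos C). lra.
  - exists N. intros k Hk. specialize (HN k Hk). pose proof (Rabs_pos C). pose proof (Rle_abs C).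
    assert (Hk0 : 0 <= r ^ k) by (apply pow_le; lra). rewrite Rabs_pos_eq in HN by auto.
    apply (Rmult_lt_compat_l (Rabs C + 1)) in HN; [|lra].
    replace ((Rabs C + 1) * (eps / (Rabs C + 1))) with eps in HN by (field; lra). nra.
Qed.

(** Equality of two limits is proved below by bounding their distance by [C * r ^ k] for every
    [k]. *)
Lemma le_geom_0 (x C r : R) : 0 <= r < 1 -> (forall k : nat, x <= C * r ^ k) -> x <= 0.
Proof.
  intros Hr H. destruct (Rle_dec x 0); auto. destruct (pow_small C r x Hr) as [N HN]; [lra|].
  specialize (H N). specialize (HN N (Nat.le_refl _)). lra.
Qed.

Lemma cauchy_geom (x : nat -> R) (C r : R) : 0 <= r < 1 ->
  (forall k j, Rabs (x (k + j)%nat - x k) <= C * r ^ k) ->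
  exists l, forall k, Rabs (l - x k) <= C * r ^ k.
Proof.
  intros Hr H. destruct (R_complete x) as [l Hl].
  - intros eps He. destruct (pow_small C r (eps / 2) Hr) as [N HN]; [lra|]. exists N.
    specialize (HN N (Nat.le_refl _)).
    intros i j Hi Hj. unfold R_dist.
    pose proof (H N (i - N)%nat) as H1. pose proof (H N (j - N)%nat) as H2.
    replace (N + (i - N))%nat with i in H1 by lia. replace (N + (j - N))%nat with j in H2 by lia.
    apply Rabs_le_between in H1. apply Rabs_le_between in H2. apply Rabs_def1; lra.
  - exists l. intro k. 
    apply Rnot_lt_le. intro Hc. destruct (Hl (Rabs (l - x k) - C * r ^ k)) as [N HN]; [lra|].
    specialize (HN (k + N)%nat). unfold R_dist in HN.
    assert (HN' := HN ltac:(lia)). pose proof (H k N) as H1.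
    pose proof (Rabs_triang (l - x (k + N)%nat) (x (k + N)%nat - x k)) as HT.
    replace (l - x (k + N)%nat + (x (k + N)%nat - x k)) with (l - x k) in HT by ring.
    rewrite (Rabs_minus_sym l (x (k + N)%nat)) in HT. lra.
Qed.

Definition tl (om : nat -> nat) : nat -> nat := fun k => om (S k).

(** * Binary codes and the Cantor set *)

Definition bits : Type := nat -> bool.
Definition drop (k : nat) (b : bits) : bits := fun j => b (k + j)%nat.

Fixpoint lead (m : nat) (b : bits) : nat :=
  match m with
  | O => O
  | S m' => if b O then S (lead m' (drop 1 b)) else O
  end.

(** Symbols [0 .. m] are written in the complete prefix code [0, 10, 110, ..., 1^m]. *)
Definition codelen (m i : nat) : nat := Nat.min (S i) m.

Fixpoint decode (m : nat) (b : bits) (k : nat) : nat :=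
  match k with
  | O => lead m b
  | S k' => decode m (drop (codelen m (lead m b)) b) k'
  end.

Lemma lead_le (m : nat) (b : bits) : (lead m b <= m)%nat.
Proof. revert b. induction m as [|m IH]; intro b; simpl; [lia|]. destruct (b O); [|lia].
  specialize (IH (drop 1 b)). lia.
Qed.

Lemma decode_le (m : nat) (b : bits) (k : nat) : (decode m b k <= m)%nat.
Proof. revert b. induction k as [|k IH]; intro b; simpl; auto using lead_le. Qed.

Lemma lead_agree (m : nat) (b b' : bits) :
  (forall j, (j < m)%nat -> b j = b' j) -> lead m b = lead m b'.
Proof.
  revert b b'. induction m as [|m IH]; intros b b' H; simpl; auto.
  rewrite (H O) by lia. destruct (b' O); auto. f_equal. apply IH.
  intros j Hj. apply H. lia.
Qed.

(** A codeword has at most [m] bits, so [m * N] bits contain the first [N] codewords. *)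
Lemma decode_agree (m N : nat) (b b' : bits) :
  (forall j, (j < m * N)%nat -> b j = b' j) ->
  forall k, (k < N)%nat -> decode m b k = decode m b' k.
Proof.
  revert b b'. induction N as [|N IH]; intros b b' H k Hk; [lia|].
  assert (HL : lead m b = lead m b') by (apply lead_agree; intros; apply H; lia).
  destruct k as [|k]; simpl; auto. rewrite HL. apply IH; [|lia].
  intros j Hj. apply H. unfold codelen. lia.
Qed.

Lemma lead_inv (m : nat) (b b' : bits) : lead m b = lead m b' ->
  forall j, (j < codelen m (lead m b))%nat -> b j = b' j.
Proof.
  unfold codelen. revert b b'. induction m as [|m IH]; intros b b' H j Hj; [lia|].
  simpl in H, Hj. destruct (b O) eqn:E, (b' O) eqn:E'; try discriminate.
  - injection H as H. destruct j as [|j]; [congruence|]. apply (IH _ _ H). lia.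
  - assert (j = O) by lia. subst. congruence.
Qed.

(** For [m > 0] no codeword is empty, so the first [N] codewords cover the first [N] bits. *)
Lemma decode_inv (m N : nat) (b b' : bits) : (0 < m)%nat ->
  (forall k, (k < N)%nat -> decode m b k = decode m b' k) ->
  forall j, (j < N)%nat -> b j = b' j.
Proof.
  intro Hm. revert b b'. induction N as [|N IH]; intros b b' H j Hj; [lia|].
  pose proof (H O ltac:(lia)) as H0. simpl in H0.
  destruct (lt_dec j (codelen m (lead m b))) as [Hc|Hc].
  - now apply (lead_inv m).
  - set (c := codelen m (lead m b)) in *.
    assert (Hc1 : (1 <= c)%nat) by (unfold c, codelen; lia).
    assert (K : drop c b (j - c)%nat = drop c b' (j - c)%nat).
    { apply IH; [|lia]. intros k Hk. pose proof (H (S k) ltac:(lia)) as HS. simpl in HS.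
      now rewrite <- H0 in HS. }
    unfold drop in K. now replace (c + (j - c))%nat with j in K by lia.
Qed.

(** For [i = m] the codeword has no closing 0: then [codelen m i = i] and the second test never
    succeeds. *)
Definition prepend (m i : nat) (b : bits) : bits := fun k =>
  if (k <? i)%nat then true
  else if (k <? codelen m i)%nat then false else b (k - codelen m i)%nat.

Lemma lead_prepend (m i : nat) (b : bits) : (i <= m)%nat -> lead m (prepend m i b) = i.
Proof.
  intro Hi.
  (* The bound [q] is separated from [m] because each induction step strips one leading bit and
     lowers it. *)
  assert (K : forall q c, (forall k, (k < i)%nat -> c k = true) ->
    ((i < q)%nat -> c i = false) -> (i <= q)%nat -> lead q c = i).
  { clear. induction i as [|i IH]; intros q c H1 H2 Hq; destruct q as [|q]; simpl; try lia.
    - now rewrite H2 by lia.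
    - rewrite H1 by lia. f_equal. apply IH; [| |lia].
      + intros k Hk. apply H1. lia.
      + intro Hk. apply H2. lia. }
  apply K; auto.
  - intros k Hk. unfold prepend. now apply Nat.ltb_lt in Hk as ->.
  - intro Hk. unfold prepend. rewrite Nat.ltb_irrefl.
    assert (E : (i <? codelen m i)%nat = true) by (apply Nat.ltb_lt; unfold codelen; lia).
    now rewrite E.
Qed.

Lemma drop_prepend (m i : nat) (b : bits) : (i <= m)%nat ->
  drop (codelen m i) (prepend m i b) = b.
Proof.
  intro Hi. apply functional_extensionality. intro k. unfold drop, prepend.
  assert (E1 : (codelen m i + k <? i)%nat = false) by (apply Nat.ltb_ge; unfold codelen; lia).
  assert (E2 : (codelen m i + k <? codelen m i)%nat = false) by (apply Nat.ltb_ge; lia).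
  rewrite E1, E2. f_equal. lia.
Qed.

Fixpoint encode_approx (m N : nat) (om : nat -> nat) : bits :=
  match N with
  | O => fun _ => false
  | S N' => prepend m (om O) (encode_approx m N' (tl om))
  end.

(** Codewords are nonempty for [m > 0], so bit [k] lies in the first [k + 1] of them and the padding
    of [encode_approx] is never read. *)
Definition encode (m : nat) (om : nat -> nat) : bits := fun k => encode_approx m (S k) om k.

Lemma encode_approx_stable (m N k : nat) (om : nat -> nat) : (0 < m)%nat -> (k < N)%nat ->
  encode_approx m N om k = encode m om k.
Proof.
  intro Hm. unfold encode. revert om k.
  assert (K : forall N N' om k, (k < N)%nat -> (k < N')%nat ->
    encode_approx m N om k = encode_approx m N' om k).
  { clear N. induction N as [|N IH]; intros [|N'] om k H H'; try lia. simpl. unfold prepend.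
    destruct (k <? om O)%nat; auto. destruct (k <? codelen m (om O))%nat eqn:E; auto.
    apply Nat.ltb_ge in E. assert (1 <= codelen m (om O))%nat by (unfold codelen; lia).
    apply IH; lia. }
  intros om k Hk. apply K; lia.
Qed.

Lemma encode_eq (m : nat) (om : nat -> nat) : (0 < m)%nat ->
  encode m om = prepend m (om O) (encode m (tl om)).
Proof.
  intro Hm. apply functional_extensionality. intro k. unfold encode at 1. simpl. unfold prepend.
  destruct (k <? om O)%nat; auto. destruct (k <? codelen m (om O))%nat eqn:E; auto.
  apply Nat.ltb_ge in E. assert (1 <= codelen m (om O))%nat by (unfold codelen; lia).
  destruct k as [|k]; [lia|]. apply encode_approx_stable; lia.
Qed.

Lemma decode_encode (m : nat) (om : nat -> nat) : (0 < m)%nat -> (forall k, (om k <= m)%nat) ->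
  forall k, decode m (encode m om) k = om k.
Proof.
  intros Hm Hom k. revert om Hom. induction k as [|k IH]; intros om Hom; rewrite encode_eq by auto; simpl.
  - now apply lead_prepend.
  - rewrite lead_prepend, drop_prepend by auto. apply (IH (tl om)). intro j. apply Hom.
Qed.

(** * Points of the Cantor set as ternary series *)

Definition cdigit (b : bits) (k : nat) : R := (if b k then 2 else 0) / 3 ^ (S k).

Lemma cdigit_bound (b : bits) (k : nat) : 0 <= cdigit b k <= 2 / 3 * (/ 3) ^ k.
Proof.
  unfold cdigit. rewrite pow_inv. simpl. assert (0 < 3 ^ k) by (apply pow_lt; lra).
  assert (0 < / 3 ^ k) by now apply Rinv_0_lt_compat.
  destruct (b k).
  - replace (2 / (3 * 3 ^ k)) with (2 / 3 * / 3 ^ k) by (field; lra). lra.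
  - unfold Rdiv. rewrite Rmult_0_l. lra.
Qed.

Lemma geom_third : is_series (fun k => 2 / 3 * (/ 3) ^ k) 1.
Proof.
  replace 1 with (2 / 3 * (/ (1 - / 3))) by field.
  apply (is_series_scal (2 / 3) (fun k => (/ 3) ^ k)). apply is_series_geom.
  rewrite Rabs_pos_eq; lra.
Qed.

Lemma ex_series_cdigit (b : bits) : ex_series (cdigit b).
Proof.
  apply (ex_series_le (cdigit b) (fun k => 2 / 3 * (/ 3) ^ k)).
  - intro k. change (norm (cdigit b k)) with (Rabs (cdigit b k)).
    rewrite Rabs_pos_eq; apply cdigit_bound.
  - eexists. apply geom_third.
Qed.

Definition cantor_point (b : bits) : R := Series (cdigit b).

Lemma cantor_point_iff (b : bits) (x : R) :
  infinite_sum (fun k => (if b k then 2 else 0) / 3 ^ (S k)) x <-> x = cantor_point b.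
Proof.
  split.
  - intro H. symmetry. apply is_series_unique. now apply is_series_Reals.
  - intros ->. apply is_series_Reals. apply Series_correct. apply ex_series_cdigit.
Qed.

Lemma cantor_point_bounds (b : bits) : 0 <= cantor_point b <= 1.
Proof.
  split.
  - apply Rle_trans with (0 * Series (cdigit b)); [lra|]. rewrite <- Series_scal_l.
    apply Series_le; [|apply ex_series_cdigit]. intro k. pose proof (cdigit_bound b k). lra.
  - replace 1 with (Series (fun k => 2 / 3 * (/ 3) ^ k)) by apply is_series_unique, geom_third.
    apply Series_le; [apply cdigit_bound|]. eexists. apply geom_third.
Qed.

Lemma cantor_point_step (b : bits) :
  cantor_point b = ((if b O then 2 else 0) + cantor_point (drop 1 b)) / 3.
Proof.
  unfold cantor_point. rewrite Series_incr_1 by apply ex_series_cdigit.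
  rewrite (Series_ext (fun k => cdigit b (S k)) (fun k => / 3 * cdigit (drop 1 b) k)).
  - rewrite Series_scal_l. unfold cdigit at 1. simpl. field.
  - intro k. unfold cdigit, drop. simpl. assert (3 ^ k <> 0) by (apply pow_nonzero; lra).
    field. auto.
Qed.

Lemma cantor_point_close (N : nat) (b b' : bits) : (forall k, (k < N)%nat -> b k = b' k) ->
  Rabs (cantor_point b - cantor_point b') <= (/ 3) ^ N.
Proof.
  revert b b'. induction N as [|N IH]; intros b b' H.
  - simpl. pose proof (cantor_point_bounds b). pose proof (cantor_point_bounds b').
    apply Rabs_le. lra.
  - rewrite (cantor_point_step b), (cantor_point_step b'), (H O) by lia. simpl.
    assert (K : Rabs (cantor_point (drop 1 b) - cantor_point (drop 1 b')) <= (/ 3) ^ N).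
    { apply IH. intros k Hk. apply H. lia. }
    apply Rabs_le_between in K. apply Rabs_le. lra.
Qed.

(** A first digit 0 puts the point in [0, 1/3], a first digit 2 in [2/3, 1], so points with
    different first digits are at least 1/3 apart; the rest is self-similarity. *)
Lemma cantor_point_agree (N : nat) (b b' : bits) :
  Rabs (cantor_point b - cantor_point b') < (/ 3) ^ N -> forall k, (k < N)%nat -> b k = b' k.
Proof.
  revert b b'. induction N as [|N IH]; intros b b' H k Hk; [lia|].
  rewrite (cantor_point_step b), (cantor_point_step b') in H. simpl in H.
  pose proof (cantor_point_bounds (drop 1 b)). pose proof (cantor_point_bounds (drop 1 b')).
  assert (HN : (/ 3) ^ N <= 1) by (rewrite <- (pow1 N); apply pow_incr; lra).
  apply Rabs_def2 in H. destruct k as [|k].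
  - destruct (b O), (b' O); auto; lra.
  - apply (IH (drop 1 b) (drop 1 b')); [|lia]. apply Rabs_def1.
    + destruct (b O), (b' O); lra.
    + destruct (b O), (b' O); lra.
Qed.

(** * The chordal metric *)

Definition norm3 (p : R * R * R) : R :=
  sqrt (fst (fst p) * fst (fst p) + snd (fst p) * snd (fst p) + snd p * snd p).
Definition sub3 (p q : R * R * R) : R * R * R :=
  (fst (fst p) - fst (fst q), snd (fst p) - snd (fst q), snd p - snd q).

Lemma norm3_triangle (p q s : R * R * R) :
  norm3 (sub3 p s) <= norm3 (sub3 p q) + norm3 (sub3 q s).
Proof.
  destruct p as [[p1 p2] p3], q as [[q1 q2] q3], s as [[s1 s2] s3]. unfold norm3, sub3; simpl.
  set (a1 := p1 - q1). set (a2 := p2 - q2). set (a3 := p3 - q3).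
  set (b1 := q1 - s1). set (b2 := q2 - s2). set (b3 := q3 - s3).
  replace (p1 - s1) with (a1 + b1) by (unfold a1, b1; ring).
  replace (p2 - s2) with (a2 + b2) by (unfold a2, b2; ring).
  replace (p3 - s3) with (a3 + b3) by (unfold a3, b3; ring).
  assert (HA : 0 <= a1 * a1 + a2 * a2 + a3 * a3) by nra.
  assert (HB : 0 <= b1 * b1 + b2 * b2 + b3 * b3) by nra.
  pose proof (sqrt_sqrt _ HA) as SA. pose proof (sqrt_sqrt _ HB) as SB.
  pose proof (sqrt_pos (a1 * a1 + a2 * a2 + a3 * a3)) as PA.
  pose proof (sqrt_pos (b1 * b1 + b2 * b2 + b3 * b3)) as PB.
  set (A := sqrt _) in *. set (B := sqrt (b1 * b1 + b2 * b2 + b3 * b3)) in *.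
  (* Cauchy-Schwarz, from Lagrange's identity. *)
  assert (HCS : a1 * b1 + a2 * b2 + a3 * b3 <= A * B).
  { assert (E : (a1 * b1 + a2 * b2 + a3 * b3) * (a1 * b1 + a2 * b2 + a3 * b3) <= (A * B) * (A * B)).
    { replace ((A * B) * (A * B)) with ((A * A) * (B * B)) by ring. rewrite SA, SB.
      pose proof (Rle_0_sqr (a1 * b2 - a2 * b1)). pose proof (Rle_0_sqr (a1 * b3 - a3 * b1)).
      pose proof (Rle_0_sqr (a2 * b3 - a3 * b2)). unfold Rsqr in *. lra. }
    assert (0 <= A * B) by now apply Rmult_le_pos. nra. }
  rewrite <- (sqrt_square (A + B)) by lra. apply sqrt_le_1_alt.
  replace ((A + B) * (A + B)) with (A * A + B * B + 2 * (A * B)) by ring.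
  rewrite SA, SB. lra.
Qed.

(** Stereographic projection onto the unit sphere. It turns the chordal distance into a Euclidean
    one, whence the triangle inequality. *)
Definition stereo (u : Sphere) : R * R * R :=
  match u with
  | Some z => let s := 1 + Cnorm z * Cnorm z in (2 * fst z / s, 2 * snd z / s, 1 - 2 / s)
  | None => (0, 0, 1)
  end.

Lemma chordal_stereo (u v : Sphere) : chordal u v = norm3 (sub3 (stereo u) (stereo v)).
Proof.
  assert (Hfin : forall z : Cpx, chordal (Some z) None = norm3 (sub3 (stereo (Some z)) (stereo None))).
  { intro z. unfold chordal, norm3, sub3, stereo; simpl. pose proof (Cnorm_sq z) as Hz.
    set (s := 1 + Cnorm z * Cnorm z) in *. assert (Hs : 1 <= s) by (unfold s; nra).
    assert (E : 2 / sqrt s = sqrt (4 / s)).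
    { rewrite sqrt_div_alt by lra. f_equal. replace 4 with (2 * 2) by ring.
      rewrite sqrt_square; lra. }
    rewrite E. f_equal.
    replace ((2 * fst z / s - 0) * (2 * fst z / s - 0) + (2 * snd z / s - 0) * (2 * snd z / s - 0)
      + (1 - 2 / s - 1) * (1 - 2 / s - 1))
      with (4 * (fst z * fst z + snd z * snd z + 1) / (s * s)) by (field; lra).
    rewrite <- Hz. replace (Cnorm z * Cnorm z + 1) with s by (unfold s; ring). field. lra. }
  assert (Hsym : forall p q, norm3 (sub3 p q) = norm3 (sub3 q p)).
  { intros p q. unfold norm3, sub3; simpl. f_equal. ring. }
  destruct u as [z|], v as [w|].
  - unfold chordal, norm3, sub3, stereo; simpl.
    pose proof (Cnorm_sq z) as Hz. pose proof (Cnorm_sq w) as Hw.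
    assert (Hs : 1 <= 1 + Cnorm z * Cnorm z) by nra.
    assert (Ht : 1 <= 1 + Cnorm w * Cnorm w) by nra.
    assert (E : 2 * Cnorm (Csub z w) / sqrt ((1 + Cnorm z * Cnorm z) * (1 + Cnorm w * Cnorm w)) =
      sqrt (4 * (Cnorm (Csub z w) * Cnorm (Csub z w)) /
            ((1 + Cnorm z * Cnorm z) * (1 + Cnorm w * Cnorm w)))).
    { rewrite sqrt_div_alt by nra. f_equal.
      replace (4 * (Cnorm (Csub z w) * Cnorm (Csub z w)))
        with ((2 * Cnorm (Csub z w)) * (2 * Cnorm (Csub z w))) by ring.
      rewrite sqrt_square; auto. pose proof (Cnorm_ge0 (Csub z w)). lra. }
    rewrite E. f_equal. rewrite Cnorm_sq. rewrite Hz, Hw in *. unfold Csub; simpl.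
    destruct z as [x y], w as [x' y']; simpl in *. field. split; lra.
  - apply Hfin.
  - rewrite Hsym, <- Hfin. reflexivity.
  - unfold chordal, norm3, sub3, stereo; simpl. symmetry.
    replace ((0 - 0) * (0 - 0) + (0 - 0) * (0 - 0) + (1 - 1) * (1 - 1)) with 0 by ring.
    apply sqrt_0.
Qed.

Lemma chordal_triangle (u v w : Sphere) : chordal u w <= chordal u v + chordal v w.
Proof. rewrite !chordal_stereo. apply norm3_triangle. Qed.

Lemma chordal_sym (u v : Sphere) : chordal u v = chordal v u.
Proof. rewrite !chordal_stereo. unfold norm3, sub3; simpl. f_equal. ring. Qed.

Lemma chordal_diag (u : Sphere) : chordal u u = 0.
Proof.
  rewrite chordal_stereo. unfold norm3, sub3; simpl. rewrite !Rminus_diag.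
  rewrite Rmult_0_l, !Rplus_0_r. apply sqrt_0.
Qed.

Lemma chordal_le_dist (z w : Cpx) : chordal (Some z) (Some w) <= 2 * Cnorm (Csub z w).
Proof.
  simpl. pose proof (Cnorm_ge0 (Csub z w)).
  assert (Hs : 1 <= sqrt ((1 + Cnorm z * Cnorm z) * (1 + Cnorm w * Cnorm w))).
  { rewrite <- sqrt_1 at 1. apply sqrt_le_1_alt.
    assert (0 <= Cnorm z * Cnorm z) by nra. assert (0 <= Cnorm w * Cnorm w) by nra. nra. }
  apply (Rmult_le_reg_r (sqrt ((1 + Cnorm z * Cnorm z) * (1 + Cnorm w * Cnorm w)))); [lra|].
  unfold Rdiv. rewrite Rmult_assoc, Rinv_l by lra. nra.
Qed.

Lemma dist_le_chordal (z w : Cpx) (M : R) : Cnorm z <= M -> Cnorm w <= M ->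
  Cnorm (Csub z w) <= (1 + M * M) / 2 * chordal (Some z) (Some w).
Proof.
  intros Hz Hw. pose proof (Cnorm_ge0 z). pose proof (Cnorm_ge0 w). simpl.
  pose proof (Cnorm_ge0 (Csub z w)).
  set (S := sqrt _).
  assert (HS : S <= 1 + M * M).
  { unfold S. rewrite <- (sqrt_square (1 + M * M)) by nra. apply sqrt_le_1_alt.
    apply Rmult_le_compat; nra. }
  assert (HS0 : 0 < S) by (apply sqrt_lt_R0; nra).
  replace ((1 + M * M) / 2 * (2 * Cnorm (Csub z w) / S))
    with (Cnorm (Csub z w) * ((1 + M * M) / S)) by (field; lra).
  rewrite <- (Rmult_1_r (Cnorm (Csub z w))) at 1. apply Rmult_le_compat_l; auto.
  apply (Rmult_le_reg_r S); auto. unfold Rdiv. rewrite Rmult_assoc, Rinv_l by lra. lra.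
Qed.

Definition pole (s : bool) : Sphere := if s then None else Some C0.
(** Chordal distance from infinity to the circle of radius [exp x]; by the isometry z -> 1/z also
    that from 0 to the circle of radius [exp (- x)]. *)
Definition cap_radius (x : R) : R := 2 / sqrt (1 + exp x * exp x).

(** Spherical cap around infinity ([|z| >= e^x]) or around zero ([|z| <= e^(-x)]). *)
Definition cap (s : bool) (x : R) (u : Sphere) : Prop := chordal u (pole s) <= cap_radius x.

Lemma cap_radius_lt (x y : R) : x < y -> cap_radius y < cap_radius x.
Proof.
  intro H. unfold cap_radius. apply exp_increasing in H. pose proof (exp_pos x).
  apply Rmult_lt_compat_l; [lra|]. apply Rinv_lt_contravar.
  - apply Rmult_lt_0_compat; apply sqrt_lt_R0; nra.
  - apply sqrt_lt_1_alt. nra.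
Qed.

Lemma cap_radius_le (x y : R) : x <= y -> cap_radius y <= cap_radius x.
Proof. intros [H|H]; [left; now apply cap_radius_lt|subst; lra]. Qed.

Lemma cap_radius_small (x : R) : 0 < x -> cap_radius x < 2 / x.
Proof.
  intro Hx. unfold cap_radius. apply Rmult_lt_compat_l; [lra|].
  pose proof (exp_ineq1 x ltac:(lra)) as H. pose proof (exp_pos x).
  assert (exp x <= sqrt (1 + exp x * exp x)).
  { rewrite <- (sqrt_square (exp x)) at 1 by lra. apply sqrt_le_1_alt. lra. }
  apply Rinv_lt_contravar; [|lra]. apply Rmult_lt_0_compat; lra.
Qed.

Lemma chordal_pole (s : bool) (w : Cpx) (x : R) : Cnorm w = exp (if s then x else - x) ->
  chordal (Some w) (pole s) = cap_radius x.
Proof.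
  intro E. destruct s; simpl.
  - rewrite E. reflexivity.
  - assert (EC : Cnorm C0 = 0) by (unfold Cnorm, C0; simpl; rewrite Rmult_0_l, Rplus_0_r; apply sqrt_0).
    assert (E2 : Cnorm (Csub w C0) = Cnorm w).
    { f_equal. unfold Csub, C0; simpl. destruct w; simpl. f_equal; ring. }
    rewrite E2, EC, E, exp_Ropp. unfold cap_radius. pose proof (exp_pos x) as Hx.
    replace ((1 + / exp x * / exp x) * (1 + 0 * 0)) with ((1 + exp x * exp x) / (exp x * exp x))
      by (field; lra).
    rewrite sqrt_div_alt by nra. rewrite sqrt_square by lra. field. split; [|lra].
    apply Rgt_not_eq, sqrt_lt_R0. nra.
Qed.

(** Caps are defined as metric balls so that they contain their pole; in the logarithmic coordinate
    they become half-planes. *)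
Lemma cap_log (s : bool) (w : Cpx) (x y : R) : Cnorm w = exp y ->
  (cap s x (Some w) <-> x <= if s then y else - y).
Proof.
  intro E. unfold cap. rewrite (chordal_pole s w (if s then y else - y)).
  - split; intro H.
    + apply Rnot_lt_le. intro K. apply cap_radius_lt in K. lra.
    + now apply cap_radius_le.
  - rewrite E. f_equal. destruct s; ring.
Qed.

(** The quotient of the two points is within [q] of 1, so its principal logarithm is small; the
    factor 2 bounds [/ (1 - q)]. *)
Lemma lift_close (u v : Cpx) (q : R) : q <= / 2 ->
  Cnorm (Csub (cexp u) (cexp v)) <= q * exp (fst v) ->
  exists m, Cnorm (Csub u (shift v m)) <= 2 * q.
Proof.
  intros Hq H. pose proof (exp_pos (fst v)) as He.
  set (w := cexp (Csub u v)).
  assert (Hw : Cnorm (Csub w C1) <= q).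
  { apply (Rmult_le_reg_r (exp (fst v))); auto. eapply Rle_trans; [|exact H].
    rewrite <- Cnorm_cexp, <- Cnorm_mul. right. f_equal.
    assert (E : cexp u = Cmul w (cexp v)).
    { unfold w. rewrite <- cexp_add. f_equal. destruct u, v; unfold Cadd, Csub; simpl. f_equal; ring. }
    rewrite E. destruct w as [a b], (cexp v) as [c d]. unfold Cmul, Csub, C1; simpl. f_equal; ring. }
  assert (H1 : cexp (clog w) = w) by (apply cexp_clog; apply fst_near_1 in Hw; lra).
  symmetry in H1. unfold w at 1 in H1. apply cexp_inj in H1. destruct H1 as [m Hm]. exists m.
  assert (E : Csub u (shift v m) = Csub (clog w) (clog C1)).
  { rewrite clog_C1. destruct u as [a b], v as [c d], (clog w) as [x y].
    unfold Csub, shift, C0 in *; simpl in *. injection Hm as E1 E2. f_equal; lra. }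
  rewrite E. pose proof (Cnorm_ge0 (Csub w C1)).
  assert (H11 : Cnorm (Csub C1 C1) <= q) by (rewrite Csub_diag; lra).
  eapply Rle_trans; [apply (clog_lip w C1 q); auto; lra|].
  apply (Rmult_le_reg_r (1 - q)); [lra|]. unfold Rdiv. rewrite Rmult_assoc, Rinv_l by lra. nra.
Qed.

(** * Coding of an expanding system of annuli *)

Section Coding.
Context (n : nat) (e : nat -> Z) (lo hi : nat -> R) (Fl : nat -> Cpx -> Cpx)
  (alpha beta lam Lam B g : R).
Definition strip (u : Cpx) : Prop := alpha <= fst u <= beta.
Definition substrip (i : nat) (u : Cpx) : Prop := lo i <= fst u <= hi i.
Definition symbols (om : nat -> nat) : Prop := forall k, (om k < n)%nat.

(** By [Hsnd] each lift stays at bounded distance from multiplication of angles by [e i]. Together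
    with the expansion [Hexp] this gives an exact conjugacy on the invariant set, as for expanding
    maps of the circle. *)
Context (Hab : alpha <= beta) (HB : 0 <= B) (Hlam : 1 < lam) (Hg : 0 < g)
  (He : forall i, (i < n)%nat -> 2 <= Rabs (IZR (e i)) <= Lam)
  (Hsub : forall i u, (i < n)%nat -> substrip i u -> strip u)
  (Hexp : forall i u v, (i < n)%nat -> substrip i u -> substrip i v ->
     lam * Cnorm (Csub u v) <= Cnorm (Csub (Fl i u) (Fl i v)))
  (Hlip : forall i u v, (i < n)%nat -> substrip i u -> substrip i v ->
     Cnorm (Csub (Fl i u) (Fl i v)) <= Lam * Cnorm (Csub u v))
  (Hper : forall i u m, (i < n)%nat -> substrip i u ->
     Fl i (shift u m) = shift (Fl i u) (e i * m))
  (Hsnd : forall i u, (i < n)%nat -> substrip i u ->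
     Rabs (snd (Fl i u) - IZR (e i) * snd u) <= B)
  (Hsurj : forall i w, (i < n)%nat -> strip w -> exists u, substrip i u /\ Fl i u = w)
  (Hgap : forall i j u v, (i < n)%nat -> (j < n)%nat -> i <> j ->
     substrip i u -> substrip j v -> g <= Rabs (fst u - fst v)).

(** Bounds the distance of two points of the strip whose angles are both within [B] of the same
    [t]. *)
Let M := (beta - alpha) + 2 * B.
Let r := / lam.

Lemma r_bounds : 0 < r < 1.
Proof.
  unfold r. split; [apply Rinv_0_lt_compat; lra|].
  rewrite <- Rinv_1. apply Rinv_lt_contravar; lra.
Qed.

Lemma symbols_tl (om : nat -> nat) : symbols om -> symbols (tl om).
Proof. intros H k. apply H. Qed.

Definition inv_branch (i : nat) (w : Cpx) : Cpx :=
  epsilon (inhabits C0) (fun u => substrip i u /\ Fl i u = w).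

Lemma inv_branch_spec (i : nat) (w : Cpx) : (i < n)%nat -> strip w ->
  substrip i (inv_branch i w) /\ Fl i (inv_branch i w) = w.
Proof.
  intros Hi Hw.
  apply (epsilon_spec (inhabits C0) (fun u => substrip i u /\ Fl i u = w)). auto.
Qed.

(** Any point of the strip with angle close to [t] could replace [(alpha, t)] at the start, since
    the inverse branches contract. *)
Fixpoint approx (N : nat) (om : nat -> nat) (t : R) : Cpx :=
  match N with
  | O => (alpha, t)
  | S N' => inv_branch (om O) (approx N' (tl om) (IZR (e (om O)) * t))
  end.

Lemma approx_strip (N : nat) (om : nat -> nat) (t : R) : symbols om -> strip (approx N om t).
Proof.
  revert om t. induction N as [|N IH]; intros om t Hom; simpl.
  - unfold strip; simpl. lra.
  - apply (Hsub (om O)); [apply Hom|]. apply inv_branch_spec; [apply Hom|].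
    apply IH. now apply symbols_tl.
Qed.

(** Degrees are at least 2, so a step backwards halves the angular error. A bound [B] therefore
    reproduces itself: [(B + B) / 2 = B]. *)
Lemma expand_snd (i : nat) (u : Cpx) (t C : R) : (i < n)%nat -> substrip i u ->
  Rabs (snd (Fl i u) - IZR (e i) * t) <= C -> Rabs (snd u - t) <= (B + C) / 2.
Proof.
  intros Hi Hu H. specialize (Hsnd i u Hi Hu). destruct (He i Hi) as [H2 _].
  assert (K : Rabs (IZR (e i)) * Rabs (snd u - t) <= B + C).
  { rewrite <- Rabs_mult.
    replace (IZR (e i) * (snd u - t))
      with (- (snd (Fl i u) - IZR (e i) * snd u) + (snd (Fl i u) - IZR (e i) * t)) by ring.
    eapply Rle_trans; [apply Rabs_triang|]. rewrite Rabs_Ropp. lra. }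
  pose proof (Rabs_pos (snd u - t)). nra.
Qed.

Lemma approx_snd (N : nat) (om : nat -> nat) (t : R) : symbols om ->
  Rabs (snd (approx N om t) - t) <= B.
Proof.
  revert om t. induction N as [|N IH]; intros om t Hom; simpl.
  - rewrite Rminus_diag, Rabs_R0. auto.
  - pose proof (symbols_tl _ Hom) as Htl.
    destruct (inv_branch_spec (om O) (approx N (tl om) (IZR (e (om O)) * t))) as [Hs HF].
    + apply Hom.
    + now apply approx_strip.
    + replace B with ((B + B) / 2) by field. apply (expand_snd (om O)); auto.
      rewrite HF. auto.
Qed.

Lemma strip_close (u v : Cpx) (t s : R) : strip u -> strip v ->
  Rabs (snd u - t) <= B -> Rabs (snd v - s) <= B ->
  Cnorm (Csub u v) <= Rabs (t - s) + M.
Proof.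
  intros Hu Hv Ht Hs. eapply Rle_trans; [apply Cnorm_le_abs|]. unfold Csub, M, strip in *; simpl.
  assert (Rabs (fst u - fst v) <= beta - alpha) by (apply Rabs_le; lra).
  assert (Rabs (snd u - snd v) <= Rabs (t - s) + 2 * B).
  { replace (snd u - snd v) with ((t - s) + ((snd u - t) - (snd v - s))) by ring.
    eapply Rle_trans; [apply Rabs_triang|]. apply Rplus_le_compat_l.
    apply Rabs_le_between in Ht. apply Rabs_le_between in Hs. apply Rabs_le. lra. }
  lra.
Qed.

Lemma contract (i : nat) (u v : Cpx) (X : R) : (i < n)%nat -> substrip i u -> substrip i v ->
  Cnorm (Csub (Fl i u) (Fl i v)) <= X -> Cnorm (Csub u v) <= r * X.
Proof.
  intros Hi Hu Hv HX. specialize (Hexp i u v Hi Hu Hv). unfold r.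
  apply (Rmult_le_reg_l lam); [lra|]. rewrite <- Rmult_assoc, Rinv_r by lra. lra.
Qed.

(** At level 0 the two points are within [M], and each of the [N] common inverse branches contracts
    by [r]. *)
Lemma approx_cauchy (N j : nat) (om : nat -> nat) (t : R) : symbols om ->
  Cnorm (Csub (approx (N + j) om t) (approx N om t)) <= M * r ^ N.
Proof.
  revert om t. induction N as [|N IH]; intros om t Hom.
  - simpl plus. rewrite pow_O, Rmult_1_r.
    eapply Rle_trans; [apply (strip_close _ _ t t)|]; auto using approx_strip, approx_snd.
    rewrite Rminus_diag, Rabs_R0. lra.
  - pose proof (symbols_tl _ Hom) as Htl. simpl.
    replace (M * (r * r ^ N)) with (r * (M * r ^ N)) by ring.
    destruct (inv_branch_spec (om O) (approx N (tl om) (IZR (e (om O)) * t))) as [Hs HF];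
      [apply Hom|now apply approx_strip|].
    destruct (inv_branch_spec (om O) (approx (N + j) (tl om) (IZR (e (om O)) * t))) as [Hs' HF'];
      [apply Hom|now apply approx_strip|].
    apply (contract (om O)); auto. rewrite HF, HF'. auto.
Qed.

(** The point at angle [t] of the invariant curve with itinerary [om]. *)
Definition curve (om : nat -> nat) (t : R) : Cpx :=
  epsilon (inhabits C0) (fun l => forall N, Cnorm (Csub l (approx N om t)) <= 2 * M * r ^ N).

(** The constant doubles because the limit is taken in each coordinate separately. *)
Lemma curve_approx (om : nat -> nat) (t : R) (N : nat) : symbols om ->
  Cnorm (Csub (curve om t) (approx N om t)) <= 2 * M * r ^ N.
Proof.
  intro Hom. revert N.
  apply (epsilon_spec (inhabits C0)
    (fun l => forall N, Cnorm (Csub l (approx N om t)) <= 2 * M * r ^ N)).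
  pose proof r_bounds.
  destruct (cauchy_geom (fun N => fst (approx N om t)) M r) as [l1 H1]; [lra| |].
  { intros k j. eapply Rle_trans; [|apply (approx_cauchy k j om t Hom)].
    apply (Cnorm_fst (Csub _ _)). }
  destruct (cauchy_geom (fun N => snd (approx N om t)) M r) as [l2 H2]; [lra| |].
  { intros k j. eapply Rle_trans; [|apply (approx_cauchy k j om t Hom)].
    apply (Cnorm_snd (Csub _ _)). }
  exists (l1, l2). intro N. eapply Rle_trans; [apply Cnorm_le_abs|]. unfold Csub; simpl.
  specialize (H1 N). specialize (H2 N). lra.
Qed.

Lemma curve_substrip (om : nat -> nat) (t : R) : symbols om -> substrip (om O) (curve om t).
Proof.
  intro Hom. pose proof r_bounds as Hr. pose proof (symbols_tl _ Hom) as Htl.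
  assert (K : forall N, substrip (om O) (approx (S N) om t) /\
     Rabs (fst (curve om t) - fst (approx (S N) om t)) <= (2 * M * r) * r ^ N).
  { intro N. split.
    - simpl. apply inv_branch_spec; [apply Hom|now apply approx_strip].
    - eapply Rle_trans; [apply (Cnorm_fst (Csub _ _))|].
      eapply Rle_trans; [apply curve_approx; auto|]. simpl. lra. }
  split.
  - apply Rminus_le. apply (le_geom_0 _ (2 * M * r) r); [lra|]. intro N.
    destruct (K N) as [[K1 _] K2]. apply Rabs_le_between in K2. lra.
  - apply Rminus_le. apply (le_geom_0 _ (2 * M * r) r); [lra|]. intro N.
    destruct (K N) as [[_ K1] K2]. apply Rabs_le_between in K2. lra.
Qed.

Lemma curve_strip (om : nat -> nat) (t : R) : symbols om -> strip (curve om t).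
Proof. intro H. apply (Hsub (om O)); [apply H|now apply curve_substrip]. Qed.

Lemma curve_snd (om : nat -> nat) (t : R) : symbols om -> Rabs (snd (curve om t) - t) <= B.
Proof.
  intro Hom. pose proof r_bounds as Hr. apply Rminus_le.
  apply (le_geom_0 _ (2 * M) r); [lra|]. intro N.
  pose proof (Cnorm_snd (Csub (curve om t) (approx N om t))) as H1.
  pose proof (curve_approx om t N Hom) as H2. pose proof (approx_snd N om t Hom) as H3.
  unfold Csub in H1 at 1; simpl in H1.
  pose proof (Rabs_triang (snd (curve om t) - snd (approx N om t)) (snd (approx N om t) - t)) as HT.
  replace (snd (curve om t) - snd (approx N om t) + (snd (approx N om t) - t))
    with (snd (curve om t) - t) in HT by ring. lra.
Qed.

(** [Fl] undoes the outermost inverse branch of [approx (S N)] and leaves [approx N] of the shifted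
    data; then [N] tends to infinity. *)
Lemma curve_step (om : nat -> nat) (t : R) : symbols om ->
  Fl (om O) (curve om t) = curve (tl om) (IZR (e (om O)) * t).
Proof.
  intro Hom. pose proof r_bounds as Hr. pose proof (symbols_tl _ Hom) as Htl.
  apply Csub_eq0. apply Rle_antisym; [|apply Cnorm_ge0].
  assert (HL : 0 <= Lam) by (destruct (He _ (Hom O)); lra).
  apply (le_geom_0 _ (Lam * (2 * M * r) + 2 * M) r); [lra|]. intro N.
  destruct (inv_branch_spec (om O) (approx N (tl om) (IZR (e (om O)) * t))) as [Hs HF];
    [apply Hom|now apply approx_strip|].
  eapply Rle_trans; [apply (Cdist_triangle _ (Fl (om O) (approx (S N) om t)))|].
  rewrite Rmult_plus_distr_r. apply Rplus_le_compat.
  - eapply Rle_trans; [apply Hlip; [apply Hom|now apply curve_substrip|exact Hs]|].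
    rewrite Rmult_assoc. apply Rmult_le_compat_l; auto.
    eapply Rle_trans; [exact (curve_approx om t (S N) Hom)|]. simpl. lra.
  - simpl. rewrite HF, Cnorm_sub_sym. now apply curve_approx.
Qed.

Lemma fst_shift_substrip (i : nat) (u : Cpx) (m : Z) : substrip i u -> substrip i (shift u m).
Proof. auto. Qed.

(** Under the lifts both sides run through the same itinerary and stay within [M] of each other, so
    expansion makes them equal. *)
Lemma curve_period (om : nat -> nat) (t : R) (m : Z) : symbols om ->
  curve om (t + 2 * PI * IZR m) = shift (curve om t) m.
Proof.
  intro Hom0. pose proof r_bounds as Hr. apply Csub_eq0. apply Rle_antisym; [|apply Cnorm_ge0].
  apply (le_geom_0 _ M r); [lra|]. intro N. revert om t m Hom0.
  induction N as [|N IH]; intros om t m Hom.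
  - rewrite pow_O, Rmult_1_r.
    eapply Rle_trans; [apply (strip_close _ _ (t + 2 * PI * IZR m) (t + 2 * PI * IZR m))|].
    + now apply curve_strip.
    + apply (curve_strip om t Hom).
    + now apply curve_snd.
    + unfold shift; simpl. replace (snd (curve om t) + 2 * PI * IZR m - (t + 2 * PI * IZR m))
        with (snd (curve om t) - t) by ring. now apply curve_snd.
    + rewrite Rminus_diag, Rabs_R0. lra.
  - simpl. replace (M * (r * r ^ N)) with (r * (M * r ^ N)) by ring.
    apply (contract (om O)); [apply Hom|now apply curve_substrip| |].
    + apply fst_shift_substrip. now apply curve_substrip.
    + rewrite Hper; [|apply Hom|now apply curve_substrip]. rewrite !curve_step by auto.
      replace (IZR (e (om O)) * (t + 2 * PI * IZR m))
        with (IZR (e (om O)) * t + 2 * PI * IZR (e (om O) * m)) by (rewrite mult_IZR; ring).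
      apply IH. now apply symbols_tl.
Qed.

(** After [N] common symbols the angles differ by at most [Lam ^ N * Rabs (t - t')]; the distance
    found there is brought back by [N] contractions. *)
Lemma curve_continuity (N : nat) (om om' : nat -> nat) (t t' : R) : symbols om -> symbols om' ->
  (forall k, (k < N)%nat -> om k = om' k) ->
  Cnorm (Csub (curve om t) (curve om' t')) <= r ^ N * (Lam ^ N * Rabs (t - t') + M).
Proof.
  revert om om' t t'. induction N as [|N IH]; intros om om' t t' Hom Hom' Hag.
  - simpl. rewrite !Rmult_1_l. apply strip_close; auto using curve_strip, curve_snd.
  - simpl. rewrite Rmult_assoc. assert (H0 : om O = om' O) by (apply Hag; lia).
    apply (contract (om O)); [apply Hom|now apply curve_substrip| |].
    + rewrite H0. now apply curve_substrip.
    + rewrite curve_step by auto. rewrite H0 at 2. rewrite curve_step by auto.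
      pose proof r_bounds as Hr. destruct (He _ (Hom O)) as [He2 HeL].
      eapply Rle_trans; [apply IH; auto using symbols_tl|].
      * intros k Hk. apply Hag. lia.
      * apply Rmult_le_compat_l; [apply pow_le; lra|]. apply Rplus_le_compat_r.
        rewrite <- H0, <- Rmult_minus_distr_l, Rabs_mult.
        rewrite (Rmult_comm Lam), Rmult_assoc. apply Rmult_le_compat_l; [apply pow_le; lra|].
        apply Rmult_le_compat_r; auto. apply Rabs_pos.
Qed.

(** Each step enlarges the distance at most [Lam] times. While it stays below the gap [g] the
    symbols must agree, and meanwhile the angles diverge by a factor of at least 2 per step. *)
Lemma curve_separation (N : nat) (om om' : nat -> nat) (t t' : R) : symbols om -> symbols om' ->
  Cnorm (Csub (curve om t) (curve om' t')) * Lam ^ N < g ->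
  (forall k, (k < N)%nat -> om k = om' k) /\ Rabs (t - t') * 2 ^ N <= 2 * B + g.
Proof.
  revert om om' t t'. induction N as [|N IH]; intros om om' t t' Hom Hom' Hcl.
  - split; [intros; lia|]. simpl in *. rewrite Rmult_1_r in *.
    pose proof (Cnorm_snd (Csub (curve om t) (curve om' t'))) as H1.
    unfold Csub in H1 at 1; simpl in H1.
    pose proof (curve_snd om t Hom) as H2. pose proof (curve_snd om' t' Hom') as H3.
    apply Rabs_le_between in H2. apply Rabs_le_between in H3.
    assert (H4 : Rabs (snd (curve om t) - snd (curve om' t')) <= g) by lra.
    apply Rabs_le_between in H4. apply Rabs_le. lra.
  - destruct (He _ (Hom O)) as [He2 HeL].
    set (X := Cnorm (Csub (curve om t) (curve om' t'))) in *.
    assert (HX0 : 0 <= X) by apply Cnorm_ge0.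
    assert (HLN : 1 <= Lam ^ N) by (apply pow_R1_Rle; lra).
    assert (H0 : om O = om' O).
    { destruct (Nat.eq_dec (om O) (om' O)) as [E|E]; auto. exfalso.
      pose proof (Hgap _ _ _ _ (Hom O) (Hom' O) E (curve_substrip om t Hom)
        (curve_substrip om' t' Hom')) as K.
      pose proof (Cnorm_fst (Csub (curve om t) (curve om' t'))) as K'.
      unfold Csub in K' at 1; simpl in K'. fold X in K'.
      change (Lam ^ S N) with (Lam * Lam ^ N) in Hcl. assert (1 <= Lam * Lam ^ N) by nra. nra. }
    assert (HS : Cnorm (Csub (curve (tl om) (IZR (e (om O)) * t))
                             (curve (tl om') (IZR (e (om O)) * t'))) <= Lam * X).
    { rewrite <- curve_step by auto. rewrite H0 at 2. rewrite <- curve_step by auto.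
      rewrite <- H0. apply Hlip; [apply Hom|now apply curve_substrip|].
      rewrite H0. now apply curve_substrip. }
    destruct (IH (tl om) (tl om') (IZR (e (om O)) * t) (IZR (e (om O)) * t')) as [Ha Ht];
      auto using symbols_tl.
    + change (Lam ^ S N) with (Lam * Lam ^ N) in Hcl.
      apply Rle_lt_trans with (Lam * X * Lam ^ N); [|lra].
      apply Rmult_le_compat_r; lra.
    + split.
      * intros [|k] Hk; auto. apply Ha. lia.
      * rewrite <- Rmult_minus_distr_l, Rabs_mult in Ht. simpl.
        pose proof (Rabs_pos (t - t')). assert (0 < 2 ^ N) by (apply pow_lt; lra).
        eapply Rle_trans; [|exact Ht].
        replace (Rabs (t - t') * (2 * 2 ^ N)) with (2 * (Rabs (t - t') * 2 ^ N)) by ring.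
        rewrite Rmult_assoc. apply Rmult_le_compat_r; nra.
Qed.

(** * The angle of a trapped orbit *)

Fixpoint degree (om : nat -> nat) (k : nat) : R :=
  match k with O => 1 | S k' => IZR (e (om O)) * degree (tl om) k' end.

Lemma degree_ge (om : nat -> nat) (k : nat) : symbols om -> 2 ^ k <= Rabs (degree om k).
Proof.
  revert om. induction k as [|k IH]; intros om Hom; simpl.
  - rewrite Rabs_R1. lra.
  - rewrite Rabs_mult. specialize (IH (tl om) (symbols_tl _ Hom)).
    destruct (He _ (Hom O)). apply Rmult_le_compat; try lra. apply pow_le; lra.
Qed.

Lemma degree_S (om : nat -> nat) (k : nat) : degree om (S k) = degree om k * IZR (e (om k)).
Proof.
  revert om. induction k as [|k IH]; intro om; simpl in *; [ring|].
  rewrite (IH (tl om)). change (tl om k) with (om (S k)). ring.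
Qed.

Definition orbit_of (om : nat -> nat) (u : nat -> Cpx) : Prop :=
  forall k, substrip (om k) (u k) /\ u (S k) = Fl (om k) (u k).

Lemma orbit_of_tl (om : nat -> nat) (u : nat -> Cpx) :
  orbit_of om u -> orbit_of (tl om) (fun k => u (S k)).
Proof. intros H k. apply (H (S k)). Qed.

(** The angle at time [k + j], pulled back linearly to time [k], misses the true angle by at most
    [B] for every [j], since each backward step halves the error. *)
Lemma orbit_angle_approx (j k : nat) (om : nat -> nat) (u : nat -> Cpx) :
  symbols om -> orbit_of om u ->
  Rabs (snd (u k) - degree om k * (snd (u (k + j)%nat) / degree om (k + j))) <= B.
Proof.
  intros Hom Hu. revert k. induction j as [|j IH]; intro k.
  - rewrite Nat.add_0_r. pose proof (degree_ge om k Hom).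
    assert (0 < 2 ^ k) by (apply pow_lt; lra).
    assert (degree om k <> 0) by (intro E; rewrite E, Rabs_R0 in *; lra).
    replace (snd (u k) - degree om k * (snd (u k) / degree om k)) with 0 by (field; auto).
    now rewrite Rabs_R0.
  - specialize (IH (S k)). replace (S k + j)%nat with (k + S j)%nat in IH by lia.
    destruct (Hu k) as [Hs E]. rewrite E, degree_S in IH.
    replace B with ((B + B) / 2) by field. apply (expand_snd (om k)); [apply Hom|auto|].
    rewrite <- Rmult_assoc, (Rmult_comm (IZR (e (om k)))). auto.
Qed.

(** The angle is the limit of [snd (u k) / degree om k], which converges because the degrees grow at
    least like [2 ^ k]. *)
Lemma orbit_angle (om : nat -> nat) (u : nat -> Cpx) : symbols om -> orbit_of om u ->
  exists t, forall k, Rabs (snd (u k) - degree om k * t) <= B.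
Proof.
  intros Hom Hu.
  assert (HD : forall k, 0 < Rabs (degree om k) /\ degree om k <> 0 /\ / Rabs (degree om k) <= (/ 2) ^ k).
  { intro k. pose proof (degree_ge om k Hom). assert (0 < 2 ^ k) by (apply pow_lt; lra).
    split; [lra|]. split; [intro E; rewrite E, Rabs_R0 in *; lra|].
    rewrite pow_inv. now apply Rinv_le_contravar. }
  destruct (cauchy_geom (fun k => snd (u k) / degree om k) B (/ 2)) as [t Ht]; [lra| |].
  { intros k j. destruct (HD k) as [H1 [H2 H3]].
    pose proof (orbit_angle_approx j k om u Hom Hu) as K.
    replace (snd (u (k + j)%nat) / degree om (k + j) - snd (u k) / degree om k)
      with (- (snd (u k) - degree om k * (snd (u (k + j)%nat) / degree om (k + j))) * / degree om k)
      by (field; split; [auto|apply HD]).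
    rewrite Rabs_mult, Rabs_Ropp, Rabs_inv.
    apply Rmult_le_compat; auto; [apply Rabs_pos|]. left. now apply Rinv_0_lt_compat. }
  exists t. intro k. apply Rminus_le. apply (le_geom_0 _ (Rabs (degree om k) * B) (/ 2)); [lra|].
  intro j. pose proof (orbit_angle_approx j k om u Hom Hu) as K. specialize (Ht (k + j)%nat).
  set (X := snd (u (k + j)%nat) / degree om (k + j)) in *.
  assert (HX : Rabs (degree om k * (X - t)) <= Rabs (degree om k) * B * (/ 2) ^ j).
  { rewrite Rabs_mult, Rabs_minus_sym, Rmult_assoc. apply Rmult_le_compat_l; [apply Rabs_pos|].
    eapply Rle_trans; [exact Ht|]. apply Rmult_le_compat_l; auto.
    rewrite pow_add, <- (Rmult_1_l ((/ 2) ^ j)) at 1. rewrite Rmult_1_l.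
    rewrite <- (Rmult_1_l ((/ 2) ^ j)) at 2. apply Rmult_le_compat_r; [apply pow_le; lra|].
    rewrite <- (pow1 k). apply pow_incr. lra. }
  replace (snd (u k) - degree om k * t) with ((snd (u k) - degree om k * X) + degree om k * (X - t))
    by ring.
  pose proof (Rabs_triang (snd (u k) - degree om k * X) (degree om k * (X - t))). lra.
Qed.

(** An orbit with the same itinerary and angle as a curve point shadows it within [M] at all times;
    by expansion the two coincide. *)
Lemma curve_surj (om : nat -> nat) (u : nat -> Cpx) : symbols om -> orbit_of om u ->
  exists t, u O = curve om t.
Proof.
  intros Hom Hu. destruct (orbit_angle om u Hom Hu) as [t Ht]. exists t.
  pose proof r_bounds as Hr. apply Csub_eq0. apply Rle_antisym; [|apply Cnorm_ge0].
  apply (le_geom_0 _ M r); [lra|]. intro N. revert om u t Hom Hu Ht.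
  induction N as [|N IH]; intros om u t Hom Hu Ht.
  - rewrite pow_O, Rmult_1_r. eapply Rle_trans; [apply (strip_close _ _ t t)|].
    + apply (Hsub (om O)); [apply Hom|apply Hu].
    + now apply curve_strip.
    + specialize (Ht O). simpl in Ht. now rewrite Rmult_1_l in Ht.
    + now apply curve_snd.
    + rewrite Rminus_diag, Rabs_R0. lra.
  - simpl. replace (M * (r * r ^ N)) with (r * (M * r ^ N)) by ring. destruct (Hu O) as [H0 H1].
    apply (contract (om O)); [apply Hom|auto|now apply curve_substrip|].
    rewrite <- H1, curve_step by auto.
    apply (IH (tl om) (fun k => u (S k))); auto using symbols_tl, orbit_of_tl.
    intro k. specialize (Ht (S k)). simpl in Ht.
    replace (degree (tl om) k * (IZR (e (om O)) * t)) with (IZR (e (om O)) * degree (tl om) k * t)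
      by ring. auto.
Qed.

(** * Dynamics on the sphere and the Julia set *)

Context (F : Sphere -> Sphere) (c0 : R)
  (Hn : (2 <= n)%nat) (Hc0 : 0 < c0) (Hcont : sphere_continuous F)
  (Hconj : forall i u, (i < n)%nat -> substrip i u -> F (Some (cexp u)) = Some (cexp (Fl i u))).
(** The signs are such that [cap s (edge s)], for the two values of [s], are the closed discs that
    the open annulus leaves over. *)
Let edge (s : bool) : R := if s then beta else - alpha.
(** In [Hcap] the pole [s'] is chosen before the point: a whole cap follows one sequence of poles,
    as equicontinuity requires. *)
Context
  (Hann : forall w, strip w ->
     (exists i, (i < n)%nat /\ substrip i w) \/
     (exists s, cap s (edge s + c0) (F (Some (cexp w)))))
  (Hcap : forall s, exists s', forall x u, 0 <= x -> cap s (edge s + x) u ->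
     cap s' (edge s' + x + c0) (F u)).

Definition annulus (u : Sphere) : Prop := exists w, strip w /\ u = Some (cexp w).

Lemma annulus_or_cap (u : Sphere) : annulus u \/ exists s, chordal u (pole s) < cap_radius (edge s).
Proof.
  destruct u as [z|].
  - destruct (excluded_middle_informative (z = C0)) as [E|E].
    + right. exists false. subst. simpl pole. rewrite chordal_diag. unfold cap_radius.
      apply Rdiv_lt_0_compat; [lra|]. apply sqrt_lt_R0. pose proof (exp_pos (edge false)). nra.
    + destruct (cexp_surj z E) as [w [Hw _]]. subst z.
      destruct (Rlt_dec (fst w) alpha) as [Ha|Ha]; [|destruct (Rlt_dec beta (fst w)) as [Hb|Hb]].
      * right. exists false. rewrite (chordal_pole false _ (- fst w)).
        -- apply cap_radius_lt. simpl. lra.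
        -- rewrite Cnorm_cexp. f_equal. ring.
      * right. exists true. rewrite (chordal_pole true _ (fst w)).
        -- apply cap_radius_lt. simpl. lra.
        -- apply Cnorm_cexp.
      * left. exists w. split; auto. unfold strip. lra.
  - right. exists true. simpl pole. rewrite chordal_diag. unfold cap_radius.
    apply Rdiv_lt_0_compat; [lra|]. apply sqrt_lt_R0. pose proof (exp_pos (edge true)). nra.
Qed.

Lemma annulus_not_cap (u : Sphere) (s : bool) (x : R) : annulus u -> cap s (edge s + x) u -> x <= 0.
Proof.
  intros [w [Hw ->]] H. apply (cap_log s _ _ (fst w) (Cnorm_cexp w)) in H.
  unfold strip in Hw. destruct s; simpl in H; lra.
Qed.

Lemma iter_cap (k : nat) (s : bool) : exists s', forall u, cap s (edge s) u ->
  cap s' (edge s' + INR k * c0) (Nat.iter k F u).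
Proof.
  induction k as [|k [s' IH]].
  - exists s. intros u Hu. simpl. now rewrite Rmult_0_l, Rplus_0_r.
  - destruct (Hcap s') as [s'' H]. exists s''. intros u Hu. simpl Nat.iter. rewrite S_INR.
    replace (edge s'' + (INR k + 1) * c0) with (edge s'' + INR k * c0 + c0) by ring.
    apply H; auto. pose proof (pos_INR k). nra.
Qed.

Lemma iter_continuous (k : nat) (u : Sphere) (eps : R) : 0 < eps -> exists delta, 0 < delta /\
  forall v, chordal u v < delta -> chordal (Nat.iter k F u) (Nat.iter k F v) < eps.
Proof.
  revert eps. induction k as [|k IH]; intros eps Heps.
  - exists eps. auto.
  - destruct (Hcont (Nat.iter k F u) eps Heps) as [d1 [Hd1 H1]].
    destruct (IH d1 Hd1) as [d [Hd H]]. exists d. split; auto. intros v Hv. simpl. auto.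
Qed.

Lemma iters_continuous (K : nat) (u : Sphere) (eps : R) : 0 < eps -> exists delta, 0 < delta /\
  forall k v, (k < K)%nat -> chordal u v < delta -> chordal (Nat.iter k F u) (Nat.iter k F v) < eps.
Proof.
  intro Heps. induction K as [|K [d [Hd IH]]].
  - exists 1. split; [lra|]. intros; lia.
  - destruct (iter_continuous K u eps Heps) as [d' [Hd' H]].
    exists (Rmin d d'). split; [now apply Rmin_pos|]. intros k v Hk Hv.
    pose proof (Rmin_l d d'). pose proof (Rmin_r d d').
    destruct (Nat.eq_dec k K) as [->|]; [apply H; lra|apply IH; [lia|lra]].
Qed.

Lemma iter_cap_small (eps : R) : 0 < eps -> exists K, forall k, (K <= k)%nat -> forall s,
  cap_radius (edge s + INR k * c0) < eps / 2.
Proof.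
  intro Heps. set (X := Rabs alpha + Rabs beta + 4 / eps).
  assert (HX : 0 < 4 / eps) by (apply Rdiv_lt_0_compat; lra).
  pose proof (Rabs_pos alpha). pose proof (Rabs_pos beta).
  destruct (INR_unbounded (X / c0)) as [K HK]. exists K. intros k Hk s.
  apply le_INR in Hk.
  assert (HKc : X < INR k * c0).
  { apply (Rmult_lt_compat_r c0) in HK; auto. unfold Rdiv in HK.
    rewrite Rmult_assoc, Rinv_l, Rmult_1_r in HK by lra. nra. }
  pose proof (Rle_abs alpha). pose proof (Rle_abs (- beta)) as Hb. rewrite Rabs_Ropp in Hb.
  assert (HY : 4 / eps < edge s + INR k * c0) by (unfold X, edge in *; destruct s; lra).
  eapply Rlt_trans; [apply cap_radius_small; lra|].
  replace (eps / 2) with (2 / (4 / eps)) by (field; lra).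
  apply Rmult_lt_compat_l; [lra|]. apply Rinv_lt_contravar; auto. apply Rmult_lt_0_compat; lra.
Qed.

(** At time [m] the point lies strictly inside a cap, so nearby points share that cap and from then
    on all its images, whose radii tend to 0. The finitely many earlier iterates are handled by
    continuity. *)
Lemma escaping_equicontinuous (u : Sphere) (m : nat) :
  ~ annulus (Nat.iter m F u) -> equicontinuous_at F u.
Proof.
  intros Hm eps Heps. destruct (annulus_or_cap (Nat.iter m F u)) as [H|[s Hs]]; [contradiction|].
  destruct (iter_continuous m u (cap_radius (edge s) - chordal (Nat.iter m F u) (pole s)))
    as [d1 [Hd1 H1]]; [lra|].
  destruct (iter_cap_small eps Heps) as [K HK].
  destruct (iters_continuous (K + m) u eps Heps) as [d2 [Hd2 H2]].
  exists (Rmin d1 d2). split; [now apply Rmin_pos|]. intros k v Hv.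
  pose proof (Rmin_l d1 d2). pose proof (Rmin_r d1 d2).
  destruct (lt_dec k (K + m)) as [Hk|Hk]; [apply H2; auto; lra|].
  replace k with ((k - m) + m)%nat by lia. rewrite !Nat.iter_add.
  destruct (iter_cap (k - m) s) as [s' Hs'].
  assert (Hu : cap s (edge s) (Nat.iter m F u)) by (unfold cap; lra).
  assert (Hv' : cap s (edge s) (Nat.iter m F v)).
  { unfold cap. specialize (H1 v ltac:(lra)). rewrite chordal_sym in H1.
    pose proof (chordal_triangle (Nat.iter m F v) (Nat.iter m F u) (pole s)). lra. }
  apply Hs' in Hu. apply Hs' in Hv'. unfold cap in Hu, Hv'.
  specialize (HK (k - m)%nat ltac:(lia) s').
  eapply Rle_lt_trans; [apply (chordal_triangle _ (pole s'))|].
  rewrite (chordal_sym (pole s')). lra.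
Qed.

Definition curve_point (om : nat -> nat) (t : R) : Sphere := Some (cexp (curve om t)).

Lemma iter_curve_point (k : nat) (om : nat -> nat) (t : R) : symbols om ->
  Nat.iter k F (curve_point om t) = curve_point (fun j => om (k + j)%nat) (degree om k * t).
Proof.
  revert om t. induction k as [|k IH]; intros om t Hom.
  - simpl. now rewrite Rmult_1_l.
  - rewrite Nat.iter_succ_r. unfold curve_point at 1.
    rewrite (Hconj (om O)); [|apply Hom|now apply curve_substrip].
    rewrite curve_step by auto. fold (curve_point (tl om) (IZR (e (om O)) * t)).
    rewrite IH by now apply symbols_tl. f_equal. simpl. ring.
Qed.

Lemma symbols_shift (om : nat -> nat) (k : nat) : symbols om -> symbols (fun j => om (k + j)%nat).
Proof. intros H j. apply H. Qed.

Lemma trapped_curve (u : Sphere) : (forall k, annulus (Nat.iter k F u)) ->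
  exists om t, symbols om /\ u = curve_point om t.
Proof.
  intro Hu.
  assert (K : forall k, exists p : nat * Cpx, (fst p < n)%nat /\ substrip (fst p) (snd p) /\
    Nat.iter k F u = Some (cexp (snd p))).
  { intro k. destruct (Hu k) as [w [Hw E]]. destruct (Hann w Hw) as [[i [Hi Hs]]|[s Hs]].
    - exists (i, w). auto.
    - rewrite <- E in Hs. change (F (Nat.iter k F u)) with (Nat.iter (S k) F u) in Hs.
      apply annulus_not_cap in Hs; [lra|apply Hu]. }
  set (p := fun k => epsilon (inhabits (O, C0)) (fun p : nat * Cpx => (fst p < n)%nat /\
    substrip (fst p) (snd p) /\ Nat.iter k F u = Some (cexp (snd p)))).
  assert (Hp : forall k, (fst (p k) < n)%nat /\ substrip (fst (p k)) (snd (p k)) /\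
    Nat.iter k F u = Some (cexp (snd (p k)))).
  { intro k. apply (epsilon_spec (inhabits (O, C0)) (fun p : nat * Cpx => (fst p < n)%nat /\
    substrip (fst p) (snd p) /\ Nat.iter k F u = Some (cexp (snd p)))). apply K. }
  set (om := fun k => fst (p k)).
  (* The logarithms chosen in [p] need not form an orbit of the lifts, so only the first is kept and
     then iterated. The symbols survive because a substrip constrains only the real part. *)
  set (w := fix w k := match k with O => snd (p O) | S k' => Fl (om k') (w k') end).
  assert (Hsub' : forall k x, Nat.iter k F u = Some (cexp x) -> substrip (om k) x).
  { intros k x E. destruct (Hp k) as [_ [H1 H2]]. rewrite E in H2. injection H2 as H2.
    assert (Hc : cexp x = cexp (snd (p k))) by (unfold cexp; congruence).
    apply cexp_inj in Hc. destruct Hc as [m ->]. auto. }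
  assert (Hw : forall k, Nat.iter k F u = Some (cexp (w k))).
  { induction k as [|k IH].
    - apply (Hp O).
    - simpl Nat.iter. rewrite IH. apply (Hconj (om k)); [apply Hp|auto]. }
  assert (Hom : symbols om) by (intro k; apply Hp).
  destruct (curve_surj om w Hom) as [t Ht].
  { intro k. split; auto. }
  exists om, t. split; auto. unfold curve_point. rewrite <- Ht. apply (Hw O).
Qed.

Lemma curve_point_dist (om om' : nat -> nat) (t t' : R) : symbols om -> symbols om' ->
  chordal (curve_point om t) (curve_point om' t') <=
  2 * exp beta * Cnorm (Csub (curve om t) (curve om' t')).
Proof.
  intros Hom Hom'. eapply Rle_trans; [apply chordal_le_dist|]. rewrite Rmult_assoc.
  apply Rmult_le_compat_l; [lra|]. apply cexp_lip; now apply curve_strip.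
Qed.

Lemma curve_point_period (om : nat -> nat) (t : R) (m : Z) : symbols om ->
  curve_point om (t + 2 * PI * IZR m) = curve_point om t.
Proof. intro H. unfold curve_point. now rewrite curve_period, cexp_shift. Qed.

Lemma curve_point_separation (N : nat) : exists delta, 0 < delta /\
  forall om om' t t', symbols om -> symbols om' ->
  chordal (curve_point om t) (curve_point om' t') < delta ->
  (forall k, (k < N)%nat -> om k = om' k) /\
  exists m, Rabs (t - (t' + 2 * PI * IZR m)) * 2 ^ N <= 2 * B + g.
Proof.
  assert (HL : 1 <= Lam ^ N).
  { apply pow_R1_Rle. destruct (He O); lra || lia. }
  (* The lifts will be within [2 * q], and [2 * q * Lam ^ N <= g / 2], as [curve_separation]
     requires. *)
  set (q := Rmin (/ 2) (g / (4 * Lam ^ N))).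
  assert (Hq : 0 < q) by (apply Rmin_pos; [lra|apply Rdiv_lt_0_compat; lra]).
  assert (Hq1 : q <= / 2) by apply Rmin_l.
  assert (Hq2 : q <= g / (4 * Lam ^ N)) by apply Rmin_r.
  set (X := (1 + exp beta * exp beta) / 2).
  assert (HX : 0 < X) by (unfold X; pose proof (exp_pos beta); nra).
  pose proof (exp_pos alpha) as Hea.
  exists (q * exp alpha / X). split; [apply Rdiv_lt_0_compat; nra|].
  intros om om' t t' Hom Hom' Hd.
  pose proof (curve_strip om t Hom) as [S1 S2]. pose proof (curve_strip om' t' Hom') as [S1' S2'].
  assert (Hc : Cnorm (Csub (cexp (curve om t)) (cexp (curve om' t'))) <=
    q * exp (fst (curve om' t'))).
  { eapply Rle_trans; [apply (dist_le_chordal _ _ (exp beta)); rewrite Cnorm_cexp; now apply exp_le|].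
    fold X. change (chordal (Some _) (Some _))
      with (chordal (curve_point om t) (curve_point om' t')).
    apply Rle_trans with (X * (q * exp alpha / X)); [apply Rmult_le_compat_l; lra|].
    replace (X * (q * exp alpha / X)) with (q * exp alpha) by (field; lra).
    apply Rmult_le_compat_l; [lra|]. now apply exp_le. }
  destruct (lift_close _ _ q Hq1 Hc) as [m Hm]. rewrite <- curve_period in Hm by auto.
  destruct (curve_separation N om om' t (t' + 2 * PI * IZR m)) as [Ha Ht]; auto.
  - apply Rle_lt_trans with (2 * q * Lam ^ N); [apply Rmult_le_compat_r; lra|].
    apply (Rmult_le_compat_r (Lam ^ N)) in Hq2; [|lra].
    replace (g / (4 * Lam ^ N) * Lam ^ N) with (g / 4) in Hq2 by (field; lra). lra.
  - split; auto. now exists m.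
Qed.

Lemma curve_point_continuity (eps : R) : 0 < eps -> exists N delta, 0 < delta /\
  forall om om' t t', symbols om -> symbols om' -> (forall k, (k < N)%nat -> om k = om' k) ->
  Rabs (t - t') < delta -> chordal (curve_point om t) (curve_point om' t') < eps.
Proof.
  intro Heps. pose proof r_bounds as Hr.
  destruct (pow_small (2 * exp beta * (1 + M)) r eps) as [N HN]; [lra|auto|].
  specialize (HN N (Nat.le_refl _)).
  assert (HL : 1 <= Lam ^ N).
  { apply pow_R1_Rle. destruct (He O); lra || lia. }
  (* Angles this close stay within 1 of each other for [N] steps; hence the [1 + M] in the choice of
     [N]. *)
  exists N, (/ Lam ^ N). split; [apply Rinv_0_lt_compat; lra|].
  intros om om' t t' Hom Hom' Hag Ht.
  eapply Rle_lt_trans; [now apply curve_point_dist|]. eapply Rle_lt_trans; [|exact HN].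
  pose proof (exp_pos beta).
  replace (2 * exp beta * (1 + M) * r ^ N) with (2 * exp beta * (r ^ N * (1 + M))) by ring.
  apply Rmult_le_compat_l; [lra|].
  eapply Rle_trans; [apply (curve_continuity N); auto|].
  apply Rmult_le_compat_l; [apply pow_le; lra|]. apply Rplus_le_compat_r.
  apply (Rmult_lt_compat_l (Lam ^ N)) in Ht; [|lra]. rewrite Rinv_r in Ht by lra. lra.
Qed.

Lemma curve_point_julia (om : nat -> nat) (t : R) : symbols om -> julia_set F (curve_point om t).
Proof.
  intros Hom Heq.
  (* Rotating by half a turn at level [k] moves the [k]-th iterates apart by a fixed amount. *)
  destruct (pow_small (2 * B + g) (/ 2) PI) as [N HN]; [lra|apply PI_RGT_0|].
  specialize (HN N (Nat.le_refl _)).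
  destruct (curve_point_separation N) as [eps [Heps Hsep]].
  destruct (Heq eps Heps) as [d [Hd H]].
  destruct (curve_point_continuity d Hd) as [N' [d' [Hd' Hc]]].
  destruct (pow_small PI (/ 2) d') as [k Hk]; [lra|auto|]. specialize (Hk k (Nat.le_refl _)).
  pose proof (degree_ge om k Hom) as Hdeg.
  assert (H2k : 0 < 2 ^ k) by (apply pow_lt; lra).
  assert (Hnz : degree om k <> 0) by (intro E; rewrite E, Rabs_R0 in *; lra).
  specialize (H k (curve_point om (t + PI / degree om k))).
  rewrite !iter_curve_point in H by auto. pose proof PI_RGT_0 as HPI.
  assert (Hlt : chordal (curve_point om t) (curve_point om (t + PI / degree om k)) < d).
  { apply Hc; auto. replace (t - (t + PI / degree om k)) with (- (PI * / degree om k)) by (field; auto).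
    rewrite Rabs_Ropp, Rabs_mult, Rabs_inv, (Rabs_pos_eq PI) by lra.
    eapply Rle_lt_trans; [|exact Hk]. rewrite pow_inv. apply Rmult_le_compat_l; [lra|].
    now apply Rinv_le_contravar. }
  specialize (H Hlt). apply Hsep in H; auto using symbols_shift. destruct H as [_ [m Hm]].
  (* The angles differ by an odd multiple of [PI], hence by at least [PI] whatever the period [m],
     whereas [N] was chosen with [(2 * B + g) / 2 ^ N < PI]. *)
  replace (degree om k * t - (degree om k * (t + PI / degree om k) + 2 * PI * IZR m))
    with (PI * (IZR (- (1 + 2 * m)))) in Hm
    by (rewrite opp_IZR, plus_IZR, mult_IZR; field; auto).
  rewrite Rabs_mult, (Rabs_pos_eq PI) in Hm by lra.
  assert (H1 : 1 <= Rabs (IZR (- (1 + 2 * m)))).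
  { rewrite <- abs_IZR. apply IZR_le. lia. }
  assert (H2N : 0 < 2 ^ N) by (apply pow_lt; lra).
  apply (Rmult_lt_compat_r (2 ^ N)) in HN; auto.
  rewrite Rmult_assoc, pow_inv, Rinv_l, Rmult_1_r in HN by lra.
  assert (PI * 1 * 2 ^ N <= PI * Rabs (IZR (- (1 + 2 * m))) * 2 ^ N).
  { apply Rmult_le_compat_r; [lra|]. apply Rmult_le_compat_l; lra. }
  lra.
Qed.

Lemma julia_iff (u : Sphere) : julia_set F u <-> exists om t, symbols om /\ u = curve_point om t.
Proof.
  split.
  - intro HJ. apply trapped_curve. intro k.
    destruct (excluded_middle_informative (annulus (Nat.iter k F u))) as [H|H]; auto.
    exfalso. apply HJ. now apply (escaping_equicontinuous u k).
  - intros [om [t [Hom ->]]]. now apply curve_point_julia.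
Qed.

(** * Homeomorphism with the model *)

Let m := (n - 1)%nat.
(** The Julia set and the model are both images of [bits * R]. Comparing these two parametrisations
    replaces the construction of an inverse on either side. *)
Definition coded_point (p : bits * R) : Sphere := curve_point (decode m (fst p)) (snd p).
Definition model_point (p : bits * R) : R * (R * R) :=
  (cantor_point (fst p), (cos (snd p), sin (snd p))).

Lemma symbols_decode (b : bits) : symbols (decode m b).
Proof. intro k. pose proof (decode_le m b k). unfold m in *. lia. Qed.

Lemma julia_coded (u : Sphere) : julia_set F u <-> exists p, u = coded_point p.
Proof.
  rewrite julia_iff. split.
  - intros [om [t [Hom ->]]]. exists (encode m om, t). unfold coded_point; simpl. f_equal.
    apply functional_extensionality. intro k. symmetry.
    apply decode_encode; [unfold m; lia|]. intro j. specialize (Hom j). unfold m. lia.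
  - intros [p ->]. exists (decode m (fst p)), (snd p). split; auto. apply symbols_decode.
Qed.

Lemma CS1_model (q : R * (R * R)) : CS1 q <-> exists p, q = model_point p.
Proof.
  split.
  - destruct q as [x [c s]]. intros [[b Hb] Hc]. unfold circle in Hc. simpl in *.
    apply cantor_point_iff in Hb. destruct (polar_angle c s Hc) as [t [E1 E2]].
    exists (b, t). unfold model_point; simpl. congruence.
  - intros [p ->]. split; simpl.
    + exists (fst p). now apply cantor_point_iff.
    + unfold circle; simpl. pose proof (sin2_cos2 (snd p)). unfold Rsqr in *. lra.
Qed.

Lemma dist_model (p p' : bits * R) : dist_RR2 (model_point p) (model_point p') =
  Rabs (cantor_point (fst p) - cantor_point (fst p')) +
  Cnorm (Csub (cexp (0, snd p)) (cexp (0, snd p'))).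
Proof.
  unfold dist_RR2, model_point, cexp, Csub, Cnorm; simpl. rewrite exp_0. f_equal. f_equal. ring.
Qed.

Lemma model_of_coded (p : bits * R) (eps : R) : 0 < eps -> exists delta, 0 < delta /\
  forall p', chordal (coded_point p) (coded_point p') < delta ->
  dist_RR2 (model_point p) (model_point p') < eps.
Proof.
  intro Heps. destruct (pow_small 1 (/ 3) (eps / 2)) as [N1 H1]; [lra|lra|].
  destruct (pow_small (2 * B + g) (/ 2) (eps / 2)) as [N2 H2]; [lra|lra|].
  set (N := (N1 + N2)%nat). specialize (H1 N ltac:(unfold N; lia)).
  specialize (H2 N ltac:(unfold N; lia)).
  destruct (curve_point_separation N) as [d [Hd H]]. exists d. split; auto.
  intros p' Hp. apply H in Hp; auto using symbols_decode. destruct Hp as [Ha [k Hk]].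
  rewrite dist_model.
  assert (Hc : Rabs (cantor_point (fst p) - cantor_point (fst p')) <= (/ 3) ^ N).
  { apply cantor_point_close. apply (decode_inv m); auto. unfold m. lia. }
  assert (Hs : Cnorm (Csub (cexp (0, snd p)) (cexp (0, snd p'))) <= (2 * B + g) * (/ 2) ^ N).
  { rewrite <- (cexp_shift (0, snd p') k).
    eapply Rle_trans; [apply (cexp_lip _ _ 0); simpl; lra|]. rewrite exp_0, Rmult_1_l.
    eapply Rle_trans; [apply Cnorm_le_abs|]. unfold Csub, shift; simpl.
    rewrite Rminus_diag, Rabs_R0, Rplus_0_l, pow_inv.
    assert (0 < 2 ^ N) by (apply pow_lt; lra).
    apply (Rmult_le_reg_r (2 ^ N)); auto. rewrite (Rmult_assoc _ (/ 2 ^ N)), Rinv_l; lra. }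
  lra.
Qed.

Lemma coded_of_model (p : bits * R) (eps : R) : 0 < eps -> exists delta, 0 < delta /\
  forall p', dist_RR2 (model_point p) (model_point p') < delta ->
  chordal (coded_point p) (coded_point p') < eps.
Proof.
  intro Heps. destruct (curve_point_continuity eps Heps) as [N [d [Hd H]]].
  (* Points of the circle within [q] have angles within [2 * q <= d / 2] up to a period. *)
  set (q := Rmin (/ 2) (d / 4)).
  assert (Hq : 0 < q) by (apply Rmin_pos; lra). assert (Hq1 : q <= / 2) by apply Rmin_l.
  assert (Hq2 : q <= d / 4) by apply Rmin_r.
  assert (H3 : 0 < (/ 3) ^ (m * N)) by (apply pow_lt; lra).
  exists (Rmin q ((/ 3) ^ (m * N))). split; [now apply Rmin_pos|].
  intros p' Hp. rewrite dist_model in Hp.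
  pose proof (Rmin_l q ((/ 3) ^ (m * N))). pose proof (Rmin_r q ((/ 3) ^ (m * N))).
  set (X := Rabs _) in Hp. set (Y := Cnorm _) in Hp.
  assert (0 <= X) by apply Rabs_pos. assert (0 <= Y) by apply Cnorm_ge0.
  destruct (lift_close (0, snd p) (0, snd p') q Hq1) as [k Hk].
  { simpl. rewrite exp_0, Rmult_1_r. fold Y. lra. }
  unfold coded_point. rewrite <- (curve_point_period (decode m (fst p')) (snd p') k)
    by apply symbols_decode.
  apply H; auto using symbols_decode.
  - apply decode_agree. apply cantor_point_agree. fold X. lra.
  - pose proof (Cnorm_snd (Csub (0, snd p) (shift (0, snd p') k))) as K.
    unfold Csub at 1, shift at 1 in K; simpl in K. lra.
Qed.


Lemma dist_RR2_eq0 (q q' : R * (R * R)) : dist_RR2 q q' <= 0 -> q = q'.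
Proof.
  destruct q as [x [a b]], q' as [x' [a' b']]. unfold dist_RR2; simpl. intro H.
  set (Y := sqrt _) in H. assert (HY : 0 <= Y) by apply sqrt_pos.
  pose proof (Rabs_pos (x - x')).
  assert (Hx : Rabs (x - x') = 0) by lra. apply Rabs_eq_0 in Hx.
  assert (HY0 : Y = 0) by lra. unfold Y in HY0.
  pose proof (Rle_0_sqr (a - a')). pose proof (Rle_0_sqr (b - b')).
  apply sqrt_eq_0 in HY0; [|unfold Rsqr in *; lra].
  assert (Ha : a - a' = 0) by (apply Rsqr_0_uniq; unfold Rsqr in *; lra).
  assert (Hb : b - b' = 0) by (apply Rsqr_0_uniq; unfold Rsqr in *; lra).
  f_equal; [lra|f_equal; lra].
Qed.

(** Well-definedness from left to right is continuity at distance 0: equal points have model points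
    closer than every [eps]. *)
Lemma coded_iff_model (p p' : bits * R) :
  coded_point p = coded_point p' <-> model_point p = model_point p'.
Proof.
  split; intro E.
  - apply dist_RR2_eq0. apply Rnot_lt_le. intro Hlt. destruct (model_of_coded p _ Hlt) as [d [Hd H]].
    specialize (H p'). rewrite E, chordal_diag in H. specialize (H Hd). lra.
  - unfold coded_point. unfold model_point in E. injection E as E1 E2 E3.
    destruct (cos_sin_eq _ _ E2 E3) as [k ->].
    rewrite curve_point_period by apply symbols_decode. f_equal.
    apply functional_extensionality. intro j. apply (decode_agree m (S j)); [|lia].
    apply (cantor_point_agree (m * S j)). rewrite E1, Rminus_diag, Rabs_R0. apply pow_lt. lra.
Qed.

Lemma julia_cantor_circles : cantor_set_of_circles (julia_set F).
Proof.
  assert (I : inhabited (bits * R)) by exact (inhabits (fun _ => true, 0)).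
  set (cu := fun u => epsilon I (fun p => u = coded_point p)).
  set (cq := fun q => epsilon I (fun p => q = model_point p)).
  assert (Hcu : forall u, julia_set F u -> u = coded_point (cu u)).
  { intros u Hu. apply (epsilon_spec I (fun p => u = coded_point p)). now apply julia_coded. }
  assert (Hcq : forall q, CS1 q -> q = model_point (cq q)).
  { intros q Hq. apply (epsilon_spec I (fun p => q = model_point p)). now apply CS1_model. }
  assert (J : forall p, julia_set F (coded_point p)) by (intro p; apply julia_coded; eauto).
  assert (S : forall p, CS1 (model_point p)) by (intro p; apply CS1_model; eauto).
  exists (fun u => model_point (cu u)), (fun q => coded_point (cq q)).
  split; [auto|]. split; [auto|]. split; [|split; [|split]].
  - intros u Hu. rewrite (Hcu u Hu) at 2. apply coded_iff_model. symmetry. auto.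
  - intros q Hq. rewrite (Hcq q Hq) at 2. apply coded_iff_model. symmetry. auto.
  - intros u eps Hu Heps. destruct (model_of_coded (cu u) eps Heps) as [d [Hd H]].
    exists d. split; auto. intros v Hv Huv. apply H. now rewrite <- !Hcu.
  - intros q eps Hq Heps. destruct (coded_of_model (cq q) eps Heps) as [d [Hd H]].
    exists d. split; auto. intros q' Hq' Hqq. apply H. now rewrite <- !Hcq.
Qed.

End Coding.

(** * Finite sums, fixed points and caps *)

Definition bsum (f : nat -> R) (m : nat) : R := fold_right Rplus 0 (map f (seq 1 m)).

Lemma bsum_0 (f : nat -> R) : bsum f 0 = 0.
Proof. reflexivity. Qed.

Lemma bsum_S (f : nat -> R) (m : nat) : bsum f (S m) = bsum f m + f (S m).
Proof.
  unfold bsum. rewrite seq_S, map_app, fold_right_app. simpl.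
  generalize (map f (seq 1 m)). intro l. induction l as [|x l IH]; simpl; [ring|].
  rewrite IH. ring.
Qed.

Lemma bsum_le (f h : nat -> R) (m : nat) : (forall j, (1 <= j <= m)%nat -> f j <= h j) ->
  bsum f m <= bsum h m.
Proof.
  induction m as [|m IH]; intro H; [rewrite !bsum_0; lra|]. rewrite !bsum_S.
  apply Rplus_le_compat; [apply IH; intros; apply H; lia|apply H; lia].
Qed.

Lemma bsum_ext (f h : nat -> R) (m : nat) : (forall j, (1 <= j <= m)%nat -> f j = h j) ->
  bsum f m = bsum h m.
Proof. intro H. apply Rle_antisym; apply bsum_le; intros j Hj; rewrite H by auto; lra. Qed.

Lemma bsum_plus (f h : nat -> R) (m : nat) : bsum (fun j => f j + h j) m = bsum f m + bsum h m.
Proof. induction m as [|m IH]; [rewrite !bsum_0; ring|]. rewrite !bsum_S, IH. ring. Qed.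

Lemma bsum_scal (c : R) (f : nat -> R) (m : nat) : bsum (fun j => c * f j) m = c * bsum f m.
Proof. induction m as [|m IH]; [rewrite !bsum_0; ring|]. rewrite !bsum_S, IH. ring. Qed.

Lemma bsum_const (c : R) (m : nat) : bsum (fun _ => c) m = INR m * c.
Proof. induction m as [|m IH]; [rewrite bsum_0; simpl; ring|]. rewrite bsum_S, IH, S_INR. ring. Qed.

Lemma bsum_single (k m : nat) (c : R) : (1 <= k)%nat ->
  bsum (fun j => if (j =? k)%nat then c else 0) m = if (k <=? m)%nat then c else 0.
Proof.
  intro Hk. induction m as [|m IH].
  - rewrite bsum_0. destruct (Nat.leb_spec k 0); [lia|auto].
  - rewrite bsum_S, IH.
    destruct (Nat.eqb_spec (S m) k), (Nat.leb_spec k m), (Nat.leb_spec k (S m)); lia || ring.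
Qed.

Lemma bsum_indicator (k m : nat) (c : R) : 0 <= c ->
  bsum (fun j => if (j =? k)%nat then c else 0) m <= c.
Proof.
  intro Hc. destruct k as [|k].
  - rewrite (bsum_ext _ (fun _ => 0)).
    + rewrite bsum_const. lra.
    + intros j Hj. destruct (Nat.eqb_spec j 0); [lia|auto].
  - rewrite bsum_single by lia. destruct (S k <=? m)%nat; lra.
Qed.

Definition Csum (f : nat -> Cpx) (m : nat) : Cpx :=
  (bsum (fun j => fst (f j)) m, bsum (fun j => snd (f j)) m).

Lemma Csum_norm (f : nat -> Cpx) (m : nat) : Cnorm (Csum f m) <= bsum (fun j => Cnorm (f j)) m.
Proof.
  induction m as [|m IH].
  - rewrite bsum_0. apply Cnorm_le_sq; [lra|]. unfold Csum; simpl. rewrite !bsum_0. lra.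
  - rewrite bsum_S. replace (Csum f (S m)) with (Cadd (Csum f m) (f (S m))).
    + eapply Rle_trans; [apply Cnorm_add|]. lra.
    + unfold Csum, Cadd; simpl. now rewrite !bsum_S.
Qed.

Lemma Csum_sub (f h : nat -> Cpx) (m : nat) :
  Csub (Csum f m) (Csum h m) = Csum (fun j => Csub (f j) (h j)) m.
Proof.
  induction m as [|m IH].
  - unfold Csum, Csub; simpl. rewrite !bsum_0. f_equal; ring.
  - unfold Csum, Csub in *; simpl in *. injection IH as I1 I2. rewrite !bsum_S, <- I1, <- I2.
    f_equal; ring.
Qed.

Lemma prod_cexp (f ph : nat -> Cpx) (m : nat) :
  (forall j, (1 <= j <= m)%nat -> f j = cexp (ph j)) ->
  fold_right Cmul C1 (map f (seq 1 m)) = cexp (Csum ph m).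
Proof.
  unfold Csum, bsum. intro H.
  assert (K : forall l, (forall j, In j l -> f j = cexp (ph j)) ->
    fold_right Cmul C1 (map f l) =
    cexp (fold_right Rplus 0 (map (fun j => fst (ph j)) l),
          fold_right Rplus 0 (map (fun j => snd (ph j)) l))).
  { induction l as [|j l IH]; intro Hl; simpl.
    - symmetry. apply cexp_0.
    - rewrite IH by (intros; apply Hl; now right). rewrite (Hl j) by now left.
      rewrite <- cexp_add. reflexivity. }
  apply K. intros j Hj. apply in_seq in Hj. apply H. lia.
Qed.

(** Picard iteration; the strip is closed, so the limit stays in it. *)
Lemma banach_substrip (lo hi c : R) (Phi : Cpx -> Cpx) : lo <= hi -> 0 <= c < 1 ->
  (forall u, lo <= fst u <= hi -> lo <= fst (Phi u) <= hi) ->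
  (forall u v, lo <= fst u <= hi -> lo <= fst v <= hi ->
     Cnorm (Csub (Phi u) (Phi v)) <= c * Cnorm (Csub u v)) ->
  exists u, lo <= fst u <= hi /\ Phi u = u.
Proof.
  intros Hlh Hc Hmap Hcon. set (x := fun k => Nat.iter k Phi (lo, 0)).
  assert (Hin : forall k, lo <= fst (x k) <= hi).
  { induction k as [|k IH]; simpl; [lra|]. apply Hmap. apply IH. }
  set (C := Cnorm (Csub (x 1%nat) (x O)) / (1 - c)).
  assert (HC : Cnorm (Csub (x 1%nat) (x O)) = (1 - c) * C) by (unfold C; field; lra).
  assert (HC0 : 0 <= C).
  { unfold C. apply Rmult_le_pos; [apply Cnorm_ge0|]. apply Rlt_le, Rinv_0_lt_compat. lra. }
  assert (H0 : forall j, Cnorm (Csub (x j) (x O)) <= C).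
  { induction j as [|j IH]; [rewrite Csub_diag; auto|].
    eapply Rle_trans; [apply (Cdist_triangle _ (x 1%nat))|]. rewrite HC.
    assert (Cnorm (Csub (x (S j)) (x 1%nat)) <= c * C).
    { eapply Rle_trans; [apply (Hcon (x j) (x O)); auto|]. apply Rmult_le_compat_l; lra. }
    lra. }
  assert (Hx : forall k j, Cnorm (Csub (x (k + j)%nat) (x k)) <= C * c ^ k).
  { induction k as [|k IH]; intro j.
    - simpl plus. rewrite pow_O, Rmult_1_r. apply H0.
    - eapply Rle_trans; [apply (Hcon (x (k + j)%nat) (x k)); auto|]. simpl.
      replace (C * (c * c ^ k)) with (c * (C * c ^ k)) by ring. apply Rmult_le_compat_l; [lra|auto]. }
  destruct (cauchy_geom (fun k => fst (x k)) C c Hc) as [l1 H1].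
  { intros k j. eapply Rle_trans; [apply (Cnorm_fst (Csub _ _))|apply Hx]. }
  destruct (cauchy_geom (fun k => snd (x k)) C c Hc) as [l2 H2].
  { intros k j. eapply Rle_trans; [apply (Cnorm_snd (Csub _ _))|apply Hx]. }
  set (l := (l1, l2)).
  assert (Hl : lo <= fst l <= hi).
  { simpl. split; apply Rminus_le; apply (le_geom_0 _ C c Hc); intro k;
      specialize (H1 k); specialize (Hin k); cbv beta in H1; apply Rabs_le_between in H1; lra. }
  assert (Hlx : forall k, Cnorm (Csub l (x k)) <= 2 * C * c ^ k).
  { intro k. eapply Rle_trans; [apply Cnorm_le_abs|]. unfold Csub, l; simpl fst; simpl snd.
    specialize (H1 k). specialize (H2 k). cbv beta in H1, H2. lra. }
  exists l. split; auto. apply Csub_eq0. apply Rle_antisym; [|apply Cnorm_ge0].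
  apply (le_geom_0 _ (4 * C) c Hc). intro k.
  eapply Rle_trans; [apply (Cdist_triangle _ (x (S k)))|].
  assert (Ha : Cnorm (Csub (Phi l) (x (S k))) <= c * (2 * C * c ^ k)).
  { eapply Rle_trans; [apply (Hcon l (x k)); auto|]. apply Rmult_le_compat_l; [lra|auto]. }
  pose proof (Hlx (S k)) as Hb. rewrite Cnorm_sub_sym in Hb.
  change (c ^ S k) with (c * c ^ k) in Hb.
  assert (HX : 0 <= C * c ^ k) by (apply Rmult_le_pos; [auto|apply pow_le; lra]).
  assert (c * (C * c ^ k) <= 1 * (C * c ^ k)) by (apply Rmult_le_compat_r; lra). lra.
Qed.

(** Serves at the poles of the sphere and on the critical circles, where the value of [F] is known
    only as a limit. *)
Lemma cap_closed (F : Sphere -> Sphere) (u : Sphere) (s : bool) (x : R) : sphere_continuous F ->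
  (forall delta, 0 < delta -> exists v, chordal u v < delta /\ cap s x (F v)) -> cap s x (F u).
Proof.
  intros HF H. unfold cap. apply Rnot_lt_le. intro Hc.
  destruct (HF u (chordal (F u) (pole s) - cap_radius x)) as [d [Hd Hv]]; [lra|].
  destruct (H d Hd) as [v [Huv Hcap]]. specialize (Hv v Huv). unfold cap in Hcap.
  pose proof (chordal_triangle (F u) (F v) (pole s)). lra.
Qed.

(** |1 - e^v| is at most 2. Unlike [clog1m_bound], this one-sided bound does not deteriorate at a
    zero or pole, where the logarithm tends to minus infinity. *)
Lemma clog1m_fst_le (v : Cpx) : fst v < 0 -> fst (clog1m v) <= ln 2.
Proof.
  intro Hv. unfold clog1m, clog; simpl. rewrite Cnorm_sub_sym.
  pose proof (cexp_clog1m v Hv) as E. pose proof (cexp_neq0 (clog1m v)) as Hz. rewrite E in Hz.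
  assert (Hpos : 0 < Cnorm (Csub (cexp v) C1)).
  { destruct (Cnorm_ge0 (Csub (cexp v) C1)) as [H|H]; auto. exfalso. apply Hz.
    apply Cnorm_eq0. rewrite Cnorm_sub_sym. auto. }
  apply ln_le; auto. pose proof (Cdist_triangle (cexp v) C0 C1) as T.
  assert (E1 : Cnorm (Csub (cexp v) C0) = exp (fst v)).
  { rewrite <- Cnorm_cexp. f_equal. unfold Csub, C0, cexp; simpl. f_equal; ring. }
  assert (E2 : Cnorm (Csub C0 C1) = 1).
  { rewrite Cnorm_sub_sym, <- Cnorm_C1. f_equal. unfold Csub, C0, C1; simpl. f_equal; ring. }
  assert (exp (fst v) < 1) by (rewrite <- exp_0; now apply exp_increasing). lra.
Qed.

(** The constant of both [clog1m_bound] and [clog1m_lip]. *)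
Definition ratio (q : R) : R := q / (1 - q).

Lemma ratio_ge0 (q : R) : 0 <= q < 1 -> 0 <= ratio q.
Proof. intro H. unfold ratio. apply Rmult_le_pos; [lra|]. apply Rlt_le, Rinv_0_lt_compat. lra. Qed.

Definition sgn (s : bool) : R := if s then 1 else -1.

Lemma sgn_sq (s : bool) : sgn s * sgn s = 1.
Proof. destruct s; simpl; ring. Qed.

Lemma sgn_negb (s : bool) : sgn (negb s) = - sgn s.
Proof. destruct s; simpl; ring. Qed.

Lemma Rabs_sgn (s : bool) : Rabs (sgn s) = 1.
Proof. destruct s; cbn [sgn]; [apply Rabs_R1|rewrite Rabs_left; lra]. Qed.

(** * The rational map in logarithmic coordinates *)

Lemma cexp_sub_outer (v w : Cpx) : fst w < fst v ->
  Csub (cexp v) (cexp w) = cexp (Cadd v (clog1m (Csub w v))).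
Proof.
  intro H. rewrite cexp_add, cexp_clog1m by (simpl; lra).
  assert (E : cexp w = Cmul (cexp v) (cexp (Csub w v))).
  { rewrite <- cexp_add. f_equal. destruct v, w; unfold Cadd, Csub; simpl. f_equal; ring. }
  rewrite E. destruct (cexp v) as [x y], (cexp (Csub w v)) as [x' y'].
  unfold Csub, Cmul, C1; simpl. f_equal; ring.
Qed.

(** The added [PI] accounts for the sign of the dominant term - e^w. *)
Lemma cexp_sub_inner (v w : Cpx) : fst v < fst w ->
  Csub (cexp v) (cexp w) = cexp (Cadd (fst w, snd w + PI) (clog1m (Csub v w))).
Proof.
  intro H. rewrite cexp_add, cexp_clog1m by (simpl; lra).
  assert (E : cexp v = Cmul (cexp w) (cexp (Csub v w))).
  { rewrite <- cexp_add. f_equal. destruct v, w; unfold Cadd, Csub; simpl. f_equal; ring. }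
  assert (E2 : cexp (fst w, snd w + PI) = Csub C0 (cexp w)).
  { unfold cexp, Csub, C0; simpl. rewrite neg_cos, neg_sin. f_equal; ring. }
  rewrite E, E2. destruct (cexp w) as [x y], (cexp (Csub v w)) as [x' y'].
  unfold Csub, Cmul, C1, C0; simpl. f_equal; ring.
Qed.

Section RationalMap.
Context (n p : nat) (d : nat -> nat) (a : nat -> Cpx) (ell theta : nat -> R).

(** [ty j] is [true] if the critical circle [|z| = |a_j|] carries poles, [false] if zeros. *)
Definition ty (j : nat) : bool := negb (Nat.even (n - j - p)).
Definition DD (j : nat) : R := INR (d j + d (S j)).
Definition slope (i : nat) : R := - sgn (ty i) * INR (d (S i)).
Definition node (j : nat) : Cpx := (ell j, theta j).
(** Logarithm of what remains beside 1 in factor [j]: (a_j / z)^D outside the circle of a_j, (z /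
    a_j)^D inside it. *)
Definition factor_arg (i j : nat) (u : Cpx) : Cpx :=
  if (j <=? i)%nat then Csub (Cscal (DD j) (node j)) (Cscal (DD j) u)
  else Csub (Cscal (DD j) u) (Cscal (DD j) (node j)).
Definition factor_const (i j : nat) : Cpx :=
  if (j <=? i)%nat then C0 else (DD j * ell j, DD j * theta j + PI).
Definition offset (i : nat) : Cpx := Csum (fun j => Cscal (- sgn (ty j)) (factor_const i j)) (n - 1).
Definition error (i : nat) (u : Cpx) : Cpx :=
  Csum (fun j => Cscal (- sgn (ty j)) (clog1m (factor_arg i j u))) (n - 1).

(** The lift of the rational map to logarithmic coordinates on the [i]-th annulus,
    [ell i < Re u < ell (i+1)], obtained by factoring the dominant monomial out of each factor. *)
Definition lift (i : nat) (u : Cpx) : Cpx :=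
  Cadd (Cadd (Cscal (slope i) u) (offset i)) (error i u).

Context (Hn : (2 <= n)%nat) (Hp : (p <= 1)%nat)
  (Ha : forall j, (1 <= j <= n - 1)%nat -> a j = cexp (node j))
  (Hd2 : forall i, (1 <= i <= n)%nat -> 2 <= INR (d i)).

Lemma ty_S (j : nat) : (S j <= n - 1)%nat -> ty (S j) = negb (ty j).
Proof.
  intro H. unfold ty. replace (n - j - p)%nat with (S (n - S j - p)) by lia.
  rewrite Nat.even_succ, Bool.negb_involutive. apply Nat.negb_even.
Qed.

Lemma DD_eq (j : nat) : DD j = INR (d j) + INR (d (S j)).
Proof. apply plus_INR. Qed.

(** Crossing circle [j] changes the exponent by d_j + d_(j+1) with alternating sign, so all degrees
    cancel except d_(i+1) and the initial d_1. *)
Lemma slope_telescope (i m : nat) : (m <= n - 1)%nat ->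
  bsum (fun j => - sgn (ty j) * (if (j <=? i)%nat then DD j else 0)) m = slope (Nat.min i m) - slope 0.
Proof.
  induction m as [|m IH]; intro Hm.
  - rewrite bsum_0, Nat.min_0_r. ring.
  - rewrite bsum_S, IH by lia. destruct (Nat.leb_spec (S m) i).
    + rewrite !Nat.min_r by lia. unfold slope. rewrite DD_eq, (ty_S m) by lia.
      rewrite sgn_negb. ring.
    + rewrite !Nat.min_l by lia. ring.
Qed.

Lemma lift_factors (i : nat) (u : Cpx) : (i <= n - 1)%nat ->
  lift i u = Cadd (Cscal (slope 0) u) (Csum (fun j => Cscal (- sgn (ty j))
    (Cadd (if (j <=? i)%nat then Cscal (DD j) u else factor_const i j) (clog1m (factor_arg i j u)))) (n - 1)).
Proof.
  intro Hi.
  (* The regrouping for one real coordinate, applied to both. *)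
  assert (K : forall x (y z : nat -> R),
    slope i * x + bsum (fun j => - sgn (ty j) * (if (j <=? i)%nat then 0 else y j)) (n - 1)
    + bsum (fun j => - sgn (ty j) * z j) (n - 1)
    = slope 0 * x + bsum (fun j => - sgn (ty j) * ((if (j <=? i)%nat then DD j * x else y j) + z j)) (n - 1)).
  { intros x y z.
    rewrite (bsum_ext (fun j => - sgn (ty j) * ((if (j <=? i)%nat then DD j * x else y j) + z j))
      (fun j => (x * (- sgn (ty j) * (if (j <=? i)%nat then DD j else 0))
         + - sgn (ty j) * (if (j <=? i)%nat then 0 else y j)) + - sgn (ty j) * z j)).
    - rewrite bsum_plus, bsum_plus, bsum_scal, slope_telescope by lia.
      rewrite Nat.min_l by lia. ring.
    - intros j _. destruct (j <=? i)%nat; ring. }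
  unfold lift, offset, error, Csum, Cadd, Cscal; simpl. f_equal.
  - transitivity (slope i * fst u
      + bsum (fun j => - sgn (ty j) * (if (j <=? i)%nat then 0 else DD j * ell j)) (n - 1)
      + bsum (fun j => - sgn (ty j) * fst (clog1m (factor_arg i j u))) (n - 1)).
    + f_equal. f_equal. apply bsum_ext. intros j _. unfold factor_const. destruct (j <=? i)%nat; reflexivity.
    + rewrite K. f_equal. apply bsum_ext. intros j _. unfold factor_const. destruct (j <=? i)%nat; reflexivity.
  - transitivity (slope i * snd u
      + bsum (fun j => - sgn (ty j) * (if (j <=? i)%nat then 0 else DD j * theta j + PI)) (n - 1)
      + bsum (fun j => - sgn (ty j) * snd (clog1m (factor_arg i j u))) (n - 1)).
    + f_equal. f_equal. apply bsum_ext. intros j _. unfold factor_const. destruct (j <=? i)%nat; reflexivity.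
    + rewrite K. f_equal. apply bsum_ext. intros j _. unfold factor_const. destruct (j <=? i)%nat; reflexivity.
Qed.

Definition in_piece (i : nat) (x : R) : Prop := forall j, (1 <= j <= n - 1)%nat ->
  ((j <= i)%nat -> ell j < x) /\ ((i < j)%nat -> x < ell j).

Lemma DD_pos (j : nat) : (1 <= j <= n - 1)%nat -> 0 < DD j.
Proof.
  intro H. rewrite DD_eq. pose proof (Hd2 j ltac:(lia)). pose proof (Hd2 (S j) ltac:(lia)). lra.
Qed.

Lemma sgnpow_cexp (j : nat) (v : Cpx) :
  sgnpow (n - j - p) (cexp v) = cexp (Cscal (- sgn (ty j)) v).
Proof.
  unfold sgnpow, ty. destruct (Nat.even (n - j - p)); cbn [sgn negb].
  - f_equal. destruct v; unfold Cscal; simpl. f_equal; ring.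
  - rewrite cexp_opp. f_equal.
Qed.

Lemma formula_lift (i : nat) (u : Cpx) : (i <= n - 1)%nat -> in_piece i (fst u) ->
  f_formula p n d a (cexp u) = cexp (lift i u).
Proof.
  intros Hi Hx. rewrite lift_factors, cexp_add by auto. unfold f_formula. f_equal.
  - rewrite cexp_pow. replace (n - p)%nat with (n - 0 - p)%nat by lia. rewrite sgnpow_cexp. f_equal.
    unfold slope, Cscal; simpl. f_equal; ring.
  - apply prod_cexp. intros j Hj. rewrite <- sgnpow_cexp. f_equal.
    rewrite Ha by auto. rewrite !cexp_pow. fold (DD j).
    pose proof (DD_pos j Hj) as HD. destruct (Hx j Hj) as [H1 H2].
    unfold factor_arg, factor_const. destruct (Nat.leb_spec j i) as [L|L].
    + apply cexp_sub_outer. simpl. apply Rmult_lt_compat_l; auto.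
    + rewrite cexp_sub_inner; [reflexivity|]. simpl. apply Rmult_lt_compat_l; auto.
Qed.

Lemma regular_in_piece (i : nat) (u : Cpx) : in_piece i (fst u) -> regular_point n d a (cexp u).
Proof.
  intro Hx. split; [apply cexp_neq0|]. intros j Hj E. rewrite Ha, !cexp_pow in E by auto.
  fold (DD j) in E. apply (f_equal Cnorm) in E. rewrite !Cnorm_cexp in E. apply exp_inv in E.
  simpl in E. pose proof (DD_pos j Hj). apply Rmult_eq_reg_l in E; [|lra].
  destruct (Hx j Hj) as [H1 H2]. destruct (le_lt_dec j i) as [L|L].
  - specialize (H1 L). lra.
  - specialize (H2 L). lra.
Qed.

Lemma arg_shift (i j : nat) (u : Cpx) (m : Z) :
  clog1m (factor_arg i j (shift u m)) = clog1m (factor_arg i j u).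
Proof.
  unfold factor_arg. destruct (j <=? i)%nat.
  - rewrite <- (clog1m_shift (Csub _ (Cscal (DD j) (shift u m))) (Z.of_nat (d j + d (S j)) * m)). f_equal.
    unfold shift, Csub, Cscal, DD; simpl. f_equal.
    rewrite mult_IZR, <- INR_IZR_INZ. ring.
  - rewrite <- (clog1m_shift (Csub (Cscal (DD j) u) _) (Z.of_nat (d j + d (S j)) * m)). f_equal.
    unfold shift, Csub, Cscal, DD; simpl. f_equal.
    rewrite mult_IZR, <- INR_IZR_INZ. ring.
Qed.

Definition lift_degree (i : nat) : Z := (if ty i then - Z.of_nat (d (S i)) else Z.of_nat (d (S i)))%Z.

Lemma mult_slope (i : nat) : IZR (lift_degree i) = slope i.
Proof.
  unfold lift_degree, slope. destruct (ty i); simpl; [rewrite opp_IZR|]; rewrite <- INR_IZR_INZ; ring.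
Qed.

Lemma lift_shift (i : nat) (u : Cpx) (m : Z) : lift i (shift u m) = shift (lift i u) (lift_degree i * m).
Proof.
  unfold lift, error, Csum.
  rewrite (bsum_ext (fun j => fst (Cscal (- sgn (ty j)) (clog1m (factor_arg i j (shift u m)))))
    (fun j => fst (Cscal (- sgn (ty j)) (clog1m (factor_arg i j u)))))
    by (intros; now rewrite arg_shift).
  rewrite (bsum_ext (fun j => snd (Cscal (- sgn (ty j)) (clog1m (factor_arg i j (shift u m)))))
    (fun j => snd (Cscal (- sgn (ty j)) (clog1m (factor_arg i j u)))))
    by (intros; now rewrite arg_shift).
  unfold shift, Cadd, Cscal; simpl. rewrite mult_IZR, mult_slope. f_equal. ring.
Qed.

(** [top s] is the height towards pole [s] that the piecewise linear model of log |f| attains at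
    circles of type [s], so [G] is its total oscillation. [mar s] is the descent from such a peak
    after which the error is controlled by [dl]. *)
Context (K alpha beta c0 dl : R) (top mar : bool -> R) (F : Sphere -> Sphere).
Let edge (s : bool) : R := if s then beta else - alpha.
Let G := top true + top false.

(** [Hlast] reflects that f is asymptotic to z^(+-d_n) with coefficient 1. [Hfirst] and [Houter]
    make the two extreme branches reach past the annulus. [Htop] places the value beyond the edge by
    [c0] even after losing the margin, [ln 2] for the degenerating factor and [dl] for the
    others. *)
Context (HF : is_rational_map p n d a F)
  (HdK : forall i, (1 <= i <= n)%nat -> INR (d i) <= K)
  (Hc0 : 0 < c0) (Hab : alpha < beta)
  (Hmar : forall s, 0 < mar s) (Hmm : mar true + mar false <= G)
  (Hstep : forall j, (1 <= j <= n - 2)%nat -> INR (d (S j)) * (ell (S j) - ell j) = G)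
  (Hlast : INR (d n) * ell (n - 1)%nat = - top (ty (n - 1)))
  (Hfirst : G <= INR (d 1%nat) * (ell 1%nat - alpha))
  (Houter : edge (negb (ty (n - 1))) + dl + c0 <= INR (d n) * beta)
  (Htop : forall s, edge s + ln 2 + dl + c0 <= top s - mar s)
  (Hdl : ratio (exp (- mar true)) + INR n * ratio (exp (- mar false)) <= dl)
  (HKdl : 2 * K * dl <= 4 / 5).

Lemma mar_le_G (s : bool) : mar s <= G.
Proof. pose proof (Hmar true). pose proof (Hmar false). destruct s; lra. Qed.

Lemma gap_pos : 0 < G.
Proof. pose proof (Hmar true). pose proof (mar_le_G true). lra. Qed.

Lemma top_negb (s : bool) : top (negb s) = G - top s.
Proof. unfold G. destruct s; simpl; ring. Qed.

Lemma ell_step (j : nat) : (1 <= j <= n - 2)%nat -> ell j < ell (S j).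
Proof.
  intro H. pose proof (Hstep j H) as E. pose proof gap_pos. pose proof (Hd2 (S j) ltac:(lia)). nra.
Qed.

Lemma ell_mono (j k : nat) : (1 <= j)%nat -> (j <= k)%nat -> (k <= n - 1)%nat -> ell j <= ell k.
Proof.
  intros Hj Hjk. induction Hjk as [|k Hjk IH]; intro Hk; [lra|].
  specialize (IH ltac:(lia)). pose proof (ell_step k ltac:(lia)). lra.
Qed.

(** Piecewise linear approximation of [log |f|] in terms of [x = log |z|]. *)
Definition tropical (i : nat) (x : R) : R := slope i * x + fst (offset i).

Lemma offset_S (i : nat) : (S i <= n - 1)%nat ->
  fst (offset i) = fst (offset (S i)) - sgn (ty (S i)) * (DD (S i) * ell (S i)).
Proof.
  intro Hi. unfold offset, Csum; simpl.
  rewrite (bsum_ext (fun j => - sgn (ty j) * fst (factor_const i j))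
    (fun j => - sgn (ty j) * fst (factor_const (S i) j) +
      if (j =? S i)%nat then - sgn (ty (S i)) * (DD (S i) * ell (S i)) else 0)).
  - rewrite bsum_plus, bsum_single by lia. replace (S i <=? n - 1)%nat with true; [ring|].
    symmetry. apply Nat.leb_le. lia.
  - intros j Hj. unfold factor_const.
    destruct (Nat.leb_spec j i), (Nat.leb_spec j (S i)), (Nat.eqb_spec j (S i));
      try lia; simpl; try ring. subst. ring.
Qed.

Lemma tropical_node_eq (i : nat) : (S i <= n - 1)%nat ->
  tropical i (ell (S i)) = tropical (S i) (ell (S i)).
Proof.
  intro Hi. unfold tropical. rewrite (offset_S i Hi). unfold slope.
  rewrite DD_eq, (ty_S i Hi), sgn_negb. ring.
Qed.

Lemma tropical_last (x : R) : tropical (n - 1) x = slope (n - 1) * x.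
Proof.
  unfold tropical, offset, Csum; simpl. rewrite (bsum_ext _ (fun _ => 0)).
  - rewrite bsum_const. ring.
  - intros j Hj. unfold factor_const. replace (j <=? n - 1)%nat with true; [simpl; ring|].
    symmetry. apply Nat.leb_le. lia.
Qed.

(** Induction inwards from the last circle, where the model is linear without constant; by [Hstep]
    each piece crosses the whole oscillation and so ends at the opposite level. *)
Lemma tropical_node (j : nat) : (1 <= j <= n - 1)%nat ->
  sgn (ty j) * tropical j (ell j) = top (ty j).
Proof.
  intro Hj. remember (n - 1 - j)%nat as k eqn:Ek. revert j Hj Ek.
  induction k as [|k IH]; intros j Hj Ek.
  - replace j with (n - 1)%nat by lia. rewrite tropical_last. unfold slope.
    replace (S (n - 1)) with n by lia.
    replace (sgn (ty (n - 1)) * (- sgn (ty (n - 1)) * INR (d n) * ell (n - 1)%nat))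
      with (- (sgn (ty (n - 1)) * sgn (ty (n - 1)) * (INR (d n) * ell (n - 1)%nat))) by ring.
    rewrite sgn_sq, Hlast. ring.
  - specialize (IH (S j) ltac:(lia) ltac:(lia)). rewrite <- tropical_node_eq in IH by lia.
    rewrite ty_S, sgn_negb, top_negb in IH by lia.
    assert (E : tropical j (ell (S j)) = tropical j (ell j) - sgn (ty j) * G).
    { rewrite <- (Hstep j) by lia. unfold tropical, slope. ring. }
    rewrite E in IH. destruct (ty j); cbn [sgn] in *; lra.
Qed.

Lemma tropical_left (i : nat) (x : R) : (1 <= i <= n - 1)%nat ->
  sgn (ty i) * tropical i x = top (ty i) - INR (d (S i)) * (x - ell i).
Proof.
  intro Hi. rewrite <- (tropical_node i Hi). unfold tropical, slope.
  replace (INR (d (S i)) * (x - ell i))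
    with (sgn (ty i) * sgn (ty i) * (INR (d (S i)) * (x - ell i))) by (rewrite sgn_sq; ring).
  ring.
Qed.

Lemma tropical_right (i : nat) (x : R) : (S i <= n - 1)%nat ->
  sgn (ty (S i)) * tropical i x = top (ty (S i)) - INR (d (S i)) * (ell (S i) - x).
Proof.
  intro Hi. rewrite <- (tropical_node (S i)), <- tropical_node_eq by lia.
  unfold tropical, slope. rewrite (ty_S i Hi), sgn_negb.
  replace (INR (d (S i)) * (ell (S i) - x))
    with (sgn (ty i) * sgn (ty i) * (INR (d (S i)) * (ell (S i) - x))) by (rewrite sgn_sq; ring).
  ring.
Qed.

(** * Size of the error away from the critical circles *)

Definition clear_left (i : nat) (x : R) : Prop := mar (ty i) <= INR (d (S i)) * (x - ell i).
Definition clear_right (i : nat) (x : R) : Prop :=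
  mar (ty (S i)) <= INR (d (S i)) * (ell (S i) - x).
Definition clear (i : nat) (x : R) : Prop :=
  ((1 <= i)%nat -> clear_left i x) /\ ((S i <= n - 1)%nat -> clear_right i x).

Lemma between_in_piece (i : nat) (x : R) : (i <= n - 1)%nat ->
  ((1 <= i)%nat -> ell i < x) -> ((S i <= n - 1)%nat -> x < ell (S i)) -> in_piece i x.
Proof.
  intros Hi H1 H2 j Hj. split; intro Hji.
  - pose proof (ell_mono j i ltac:(lia) ltac:(lia) ltac:(lia)). specialize (H1 ltac:(lia)). lra.
  - pose proof (ell_mono (S i) j ltac:(lia) ltac:(lia) ltac:(lia)). specialize (H2 ltac:(lia)). lra.
Qed.

Lemma clear_in_piece (i : nat) (x : R) : (i <= n - 1)%nat -> clear i x -> in_piece i x.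
Proof.
  intros Hi [H1 H2]. pose proof (Hd2 (S i) ltac:(lia)). apply between_in_piece; auto; intro H0.
  - specialize (H1 H0). unfold clear_left in H1. pose proof (Hmar (ty i)). nra.
  - specialize (H2 H0). unfold clear_right in H2. pose proof (Hmar (ty (S i))). nra.
Qed.

(** Circles not adjacent to the piece are a full oscillation [G] away, which exceeds both margins.
    The one of type [false] is taken for them, as it is the one that [Hdl] allows to be counted [n]
    times. *)
Definition qbound (i j : nat) : R :=
  exp (- mar (if (j =? i)%nat then ty i else if (j =? S i)%nat then ty (S i) else false)).

Lemma exp_mar (s : bool) : 0 <= exp (- mar s) < 1.
Proof.
  split; [left; apply exp_pos|]. rewrite <- exp_0. apply exp_increasing.
  pose proof (Hmar s). lra.
Qed.

(** Clearance is demanded only from circle [j] itself, so the bound remains available when [u] is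
    close to another circle. *)
Lemma arg_bound (i j : nat) (u : Cpx) : (i <= n - 1)%nat -> (1 <= j <= n - 1)%nat ->
  in_piece i (fst u) -> (j = i -> clear_left i (fst u)) -> (j = S i -> clear_right i (fst u)) ->
  exp (fst (factor_arg i j u)) <= qbound i j.
Proof.
  intros Hi Hj Hpc H1 H2. apply exp_le. unfold factor_arg, node.
  pose proof (Hd2 (S i) ltac:(lia)) as Hdi. pose proof (Hd2 j ltac:(lia)) as Hdj.
  pose proof (Hd2 (S j) ltac:(lia)) as HdSj. pose proof (mar_le_G false).
  pose proof (DD_eq j) as HD. destruct (Hpc j Hj) as [P1' P2'].
  destruct (Nat.leb_spec j i) as [L|L]; unfold Csub, Cscal; simpl.
  - specialize (P1' L). destruct (Nat.eqb_spec j i) as [E|E].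
    + subst j. specialize (H1 eq_refl). unfold clear_left in H1. nra.
    + replace (j =? S i)%nat with false by (symmetry; apply Nat.eqb_neq; lia).
      pose proof (Hstep j ltac:(lia)) as Hs.
      pose proof (ell_mono (S j) i ltac:(lia) ltac:(lia) ltac:(lia)).
      destruct (Hpc i ltac:(lia)) as [P3 _]. specialize (P3 ltac:(lia)).
      pose proof (ell_step j ltac:(lia)).
      assert (INR (d (S j)) * (ell (S j) - ell j) <= DD j * (fst u - ell j)).
      { apply Rmult_le_compat; lra. }
      lra.
  - specialize (P2' L). replace (j =? i)%nat with false by (symmetry; apply Nat.eqb_neq; lia).
    destruct (Nat.eqb_spec j (S i)) as [E|E].
    + subst j. specialize (H2 eq_refl). unfold clear_right in H2. nra.
    + destruct j as [|j]; [lia|]. pose proof (Hstep j ltac:(lia)) as Hs.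
      pose proof (ell_mono (S i) j ltac:(lia) ltac:(lia) ltac:(lia)).
      destruct (Hpc (S i) ltac:(lia)) as [_ P3]. specialize (P3 ltac:(lia)).
      pose proof (ell_step j ltac:(lia)).
      assert (INR (d (S j)) * (ell (S j) - ell j) <= DD (S j) * (ell (S j) - fst u)).
      { apply Rmult_le_compat; lra. }
      lra.
Qed.

Lemma sum_qbound (i : nat) : (i <= n - 1)%nat ->
  bsum (fun j => ratio (qbound i j)) (n - 1) <= dl.
Proof.
  intro Hi. pose proof (ratio_ge0 _ (exp_mar true)). pose proof (ratio_ge0 _ (exp_mar false)).
  (* Consecutive nodes have opposite types, so only one neighbour [k] is a pole circle. *)
  set (k := if ty i then i else S i).
  eapply Rle_trans; [apply (bsum_le _ (fun j => (if (j =? k)%nat then ratio (exp (- mar true)) else 0)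
    + ratio (exp (- mar false))))|].
  - intros j Hj. unfold qbound, k.
    destruct (ty i) eqn:E1, (Nat.eqb_spec j i), (Nat.eqb_spec j (S i)); try lia; try lra.
    + rewrite ty_S, E1 by lia. simpl. lra.
    + rewrite ty_S, E1 by lia. simpl. lra.
  - rewrite bsum_plus, bsum_const. pose proof (bsum_indicator k (n - 1) _ H).
    assert (INR (n - 1) * ratio (exp (- mar false)) <= INR n * ratio (exp (- mar false))).
    { apply Rmult_le_compat_r; auto. apply le_INR. lia. }
    lra.
Qed.

Lemma dl_ge0 : 0 <= dl.
Proof.
  pose proof (ratio_ge0 _ (exp_mar true)). pose proof (ratio_ge0 _ (exp_mar false)).
  pose proof (pos_INR n). nra.
Qed.

Lemma Cnorm_sign (s : bool) (v : Cpx) : Cnorm (Cscal (- sgn s) v) = Cnorm v.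
Proof. rewrite Cnorm_scal, Rabs_Ropp, Rabs_sgn. ring. Qed.

Lemma qbound_lt1 (i j : nat) : 0 <= qbound i j < 1.
Proof. apply exp_mar. Qed.

Lemma error_norm (i : nat) (u : Cpx) : (i <= n - 1)%nat -> clear i (fst u) ->
  Cnorm (error i u) <= dl.
Proof.
  intros Hi Hc. pose proof (clear_in_piece i _ Hi Hc) as Hpc. destruct Hc as [H1 H2].
  eapply Rle_trans; [apply Csum_norm|]. eapply Rle_trans; [|apply (sum_qbound i Hi)].
  apply bsum_le. intros j Hj. rewrite Cnorm_sign. apply clog1m_bound; [apply qbound_lt1|].
  apply arg_bound; auto; intro; subst j; [apply H1|apply H2]; lia.
Qed.

(** The argument of factor [j] is Lipschitz with constant [DD j <= 2 * K], which leads to the factor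
    [2 * K * dl] of [HKdl]. *)
Lemma error_lip (i : nat) (u v : Cpx) : (i <= n - 1)%nat -> clear i (fst u) -> clear i (fst v) ->
  Cnorm (Csub (error i u) (error i v)) <= 4 / 5 * Cnorm (Csub u v).
Proof.
  intros Hi Hu Hv. pose proof (clear_in_piece i _ Hi Hu) as Hpu.
  pose proof (clear_in_piece i _ Hi Hv) as Hpv.
  destruct Hu as [H1 H2], Hv as [H3 H4]. pose proof (Cnorm_ge0 (Csub u v)) as HX.
  unfold error. rewrite Csum_sub. eapply Rle_trans; [apply Csum_norm|].
  apply Rle_trans with (2 * K * Cnorm (Csub u v) * bsum (fun j => ratio (qbound i j)) (n - 1)).
  - rewrite <- bsum_scal. apply bsum_le. intros j Hj.
    assert (Hq1 : exp (fst (factor_arg i j u)) <= qbound i j).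
    { apply arg_bound; auto; intro; subst j; [apply H1|apply H2]; lia. }
    assert (Hq2 : exp (fst (factor_arg i j v)) <= qbound i j).
    { apply arg_bound; auto; intro; subst j; [apply H3|apply H4]; lia. }
    replace (Csub (Cscal (- sgn (ty j)) (clog1m (factor_arg i j u))) (Cscal (- sgn (ty j)) (clog1m (factor_arg i j v))))
      with (Cscal (- sgn (ty j)) (Csub (clog1m (factor_arg i j u)) (clog1m (factor_arg i j v))))
      by (unfold Cscal, Csub; cbn [fst snd]; f_equal; ring).
    rewrite Cnorm_sign. eapply Rle_trans; [apply (clog1m_lip _ _ (qbound i j)); auto; apply qbound_lt1|].
    rewrite (Rmult_comm (2 * K * _)). fold (ratio (qbound i j)).
    apply Rmult_le_compat_l; [apply ratio_ge0, qbound_lt1|].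
    assert (E : Cnorm (Csub (factor_arg i j u) (factor_arg i j v)) = DD j * Cnorm (Csub u v)).
    { pose proof (DD_pos j Hj) as HD. rewrite <- (Rabs_pos_eq (DD j)) by lra.
      unfold factor_arg. destruct (j <=? i)%nat.
      - rewrite (Cnorm_sub_sym u v), <- Cnorm_scal. f_equal. unfold Csub, Cscal; simpl. f_equal; ring.
      - rewrite <- Cnorm_scal. f_equal. unfold Csub, Cscal; simpl. f_equal; ring. }
    rewrite E. apply Rmult_le_compat_r; auto. rewrite DD_eq.
    pose proof (HdK j ltac:(lia)). pose proof (HdK (S j) ltac:(lia)). lra.
  - assert (HK : 0 <= 2 * K).
    { pose proof (Hd2 1%nat ltac:(lia)). pose proof (HdK 1%nat ltac:(lia)). lra. }
    apply Rle_trans with (2 * K * Cnorm (Csub u v) * dl).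
    + apply Rmult_le_compat_l; [now apply Rmult_le_pos|]. now apply sum_qbound.
    + replace (2 * K * Cnorm (Csub u v) * dl) with (2 * K * dl * Cnorm (Csub u v)) by ring.
      now apply Rmult_le_compat_r.
Qed.

(** One-sided estimate near the node [k], where a factor may degenerate. *)
Lemma error_near_node (i k : nat) (u : Cpx) : (i <= n - 1)%nat -> in_piece i (fst u) ->
  (i <> k -> (1 <= i)%nat -> clear_left i (fst u)) ->
  (S i <> k -> (S i <= n - 1)%nat -> clear_right i (fst u)) ->
  - (ln 2 + dl) <= sgn (ty k) * fst (error i u).
Proof.
  intros Hi Hpc H1 H2. unfold error, Csum; cbn [fst].
  assert (Hln2 : 0 <= ln 2) by (pose proof (ln_le 1 2 ltac:(lra) ltac:(lra)); rewrite ln_1 in *; lra).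
  rewrite <- bsum_scal.
  apply Rle_trans with (bsum (fun j => -1 * ((if (j =? k)%nat then ln 2 else 0) + ratio (qbound i j))) (n - 1)).
  - rewrite bsum_scal, bsum_plus. pose proof (bsum_indicator k (n - 1) (ln 2) Hln2).
    pose proof (sum_qbound i Hi). lra.
  - apply bsum_le. intros j Hj. unfold Cscal; cbn [fst].
    pose proof (ratio_ge0 _ (qbound_lt1 i j)) as Hr. destruct (Nat.eqb_spec j k) as [E|E].
    + subst j. replace (sgn (ty k) * (- sgn (ty k) * fst (clog1m (factor_arg i k u))))
        with (- (sgn (ty k) * sgn (ty k) * fst (clog1m (factor_arg i k u)))) by ring.
      rewrite sgn_sq. assert (Hneg : fst (factor_arg i k u) < 0).
      { destruct (Hpc k Hj) as [A1 A2]. pose proof (DD_pos k Hj). unfold factor_arg, node.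
        destruct (Nat.leb_spec k i) as [L|L]; unfold Csub, Cscal; simpl.
        - specialize (A1 L). nra.
        - specialize (A2 L). nra. }
      pose proof (clog1m_fst_le _ Hneg). lra.
    + assert (Hq : Cnorm (clog1m (factor_arg i j u)) <= ratio (qbound i j)).
      { apply clog1m_bound; [apply qbound_lt1|].
        apply arg_bound; auto; intro; subst j; [apply H1|apply H2]; lia. }
      pose proof (Cnorm_fst (clog1m (factor_arg i j u))) as Hf. set (X := fst (clog1m (factor_arg i j u))) in *.
      assert (HX : Rabs X <= ratio (qbound i j)) by lra. apply Rabs_le_between in HX.
      destruct (ty k), (ty j); simpl; lra.
Qed.

Lemma F_lift (i : nat) (u : Cpx) : (i <= n - 1)%nat -> in_piece i (fst u) ->
  F (Some (cexp u)) = Some (cexp (lift i u)).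
Proof.
  intros Hi Hpc. destruct HF as [_ H]. rewrite H by now apply (regular_in_piece i).
  f_equal. now apply formula_lift.
Qed.

Lemma fst_lift (i : nat) (u : Cpx) : fst (lift i u) = tropical i (fst u) + fst (error i u).
Proof. reflexivity. Qed.

Lemma cap_sgn (s : bool) (x : R) (u : Cpx) : x <= sgn s * fst u -> cap s x (Some (cexp u)).
Proof.
  intro H. apply (cap_log s _ x (fst u) (Cnorm_cexp u)). destruct s; simpl in *; lra.
Qed.

Lemma near_node_cap (i k : nat) (u : Cpx) : (i <= n - 1)%nat -> in_piece i (fst u) ->
  (k = i /\ (1 <= i)%nat /\ ~ clear_left i (fst u)) \/
  (k = S i /\ (S i <= n - 1)%nat /\ ~ clear_right i (fst u)) ->
  cap (ty k) (edge (ty k) + c0) (F (Some (cexp u))).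
Proof.
  intros Hi Hpc Hk. rewrite (F_lift i) by auto. apply cap_sgn. rewrite fst_lift.
  pose proof (Htop (ty k)) as HT.
  (* A point within the margin of one end of the piece is clear of the other end, because the two
     margins add up to at most [G]. *)
  assert (HE : - (ln 2 + dl) <= sgn (ty k) * fst (error i u)).
  { apply error_near_node; auto.
    - intros H1 H2. destruct Hk as [[-> _]|[-> [H3 H4]]]; [lia|].
      unfold clear_left, clear_right in *. pose proof (Hstep i ltac:(lia)).
      rewrite ty_S in H4 by lia. apply Rnot_le_lt in H4. destruct (ty i); simpl in *; lra.
    - intros H1 H2. destruct Hk as [[-> [H3 H4]]|[-> _]]; [|lia].
      unfold clear_left, clear_right in *. pose proof (Hstep i ltac:(lia)).
      rewrite ty_S by lia. apply Rnot_le_lt in H4. destruct (ty i); simpl in *; lra. }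
  assert (HL : top (ty k) - mar (ty k) <= sgn (ty k) * tropical i (fst u)).
  { destruct Hk as [[-> [H3 H4]]|[-> [H3 H4]]].
    - rewrite tropical_left by lia. unfold clear_left in H4. lra.
    - rewrite tropical_right by lia. unfold clear_right in H4. lra. }
  lra.
Qed.

(** * Clear subannuli and their inverse branches *)

Definition lower (i : nat) : R :=
  if (i =? 0)%nat then alpha else ell i + mar (ty i) / INR (d (S i)).
Definition upper (i : nat) : R :=
  if (i =? n - 1)%nat then beta else ell (S i) - mar (ty (S i)) / INR (d (S i)).

Lemma div_mul_le (m q x : R) : 0 < q -> (m / q <= x <-> m <= q * x).
Proof.
  intro Hq. assert (E : q * (m / q) = m) by (field; lra). split; intro H.
  - rewrite <- E. apply Rmult_le_compat_l; lra.
  - apply (Rmult_le_reg_l q); auto. lra.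
Qed.

Lemma clear_iff (i : nat) (x : R) : (i <= n - 1)%nat -> alpha <= x <= beta ->
  (clear i x <-> lower i <= x <= upper i).
Proof.
  intros Hi Hx. pose proof (Hd2 (S i) ltac:(lia)) as Hd.
  unfold clear, clear_left, clear_right, lower, upper.
  pose proof (div_mul_le (mar (ty i)) (INR (d (S i))) (x - ell i) ltac:(lra)) as D1.
  pose proof (div_mul_le (mar (ty (S i))) (INR (d (S i))) (ell (S i) - x) ltac:(lra)) as D2.
  destruct (Nat.eqb_spec i 0), (Nat.eqb_spec i (n - 1)); try lia; split.
  - intros [H1 H2]. specialize (H2 ltac:(lia)). apply D2 in H2. lra.
  - intro H. split; intro; [lia|]. apply D2. lra.
  - intros [H1 H2]. specialize (H1 ltac:(lia)). apply D1 in H1. lra.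
  - intro H. split; intro; [|lia]. apply D1. lra.
  - intros [H1 H2]. specialize (H1 ltac:(lia)). specialize (H2 ltac:(lia)).
    apply D1 in H1. apply D2 in H2. lra.
  - intro H. split; intro; [apply D1|apply D2]; lra.
Qed.

Lemma beta_clear : mar (ty (n - 1)) <= INR (d n) * (beta - ell (n - 1)%nat).
Proof.
  pose proof (Htop (ty (n - 1))) as H. pose proof dl_ge0.
  assert (0 <= ln 2) by (pose proof (ln_le 1 2 ltac:(lra) ltac:(lra)); rewrite ln_1 in *; lra).
  rewrite Rmult_minus_distr_l, Hlast. unfold edge in *. destruct (ty (n - 1)); simpl in *; lra.
Qed.

Lemma lower_le_upper (i : nat) : (i <= n - 1)%nat -> lower i <= upper i.
Proof.
  intro Hi. pose proof (Hd2 (S i) ltac:(lia)) as Hd. unfold lower, upper.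
  pose proof (div_mul_le (mar (ty i)) (INR (d (S i))) (beta - ell i) ltac:(lra)) as D1.
  pose proof (div_mul_le (mar (ty (S i))) (INR (d (S i))) (ell (S i) - alpha) ltac:(lra)) as D2.
  pose proof (div_mul_le (mar (ty i) + mar (ty (S i))) (INR (d (S i))) (ell (S i) - ell i) ltac:(lra)) as D3.
  destruct (Nat.eqb_spec i 0), (Nat.eqb_spec i (n - 1)); try lia.
  - subst i. assert (mar (ty 1) / INR (d 1%nat) <= ell 1%nat - alpha); [|lra].
    apply D2. pose proof (mar_le_G (ty 1)). lra.
  - assert (mar (ty i) / INR (d (S i)) <= beta - ell i); [|lra]. apply D1. subst i.
    replace (S (n - 1)) with n by lia. apply beta_clear.
  - assert ((mar (ty i) + mar (ty (S i))) / INR (d (S i)) <= ell (S i) - ell i).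
    { apply D3. rewrite Hstep by lia. rewrite ty_S by lia. destruct (ty i); simpl; lra. }
    lra.
Qed.

(** A lower bound for every [mar / d], the distance from a critical circle to a neighbouring
    subannulus. *)
Let g := Rmin (mar true) (mar false) / K.

Lemma K_ge : 2 <= K.
Proof. pose proof (Hd2 1%nat ltac:(lia)). pose proof (HdK 1%nat ltac:(lia)). lra. Qed.

Lemma g_pos : 0 < g.
Proof. pose proof K_ge. apply Rdiv_lt_0_compat; [|lra]. apply Rmin_pos; apply Hmar. Qed.

Lemma g_le (s : bool) (i : nat) : (1 <= i <= n)%nat -> g <= mar s / INR (d i).
Proof.
  intro Hi. pose proof (Hd2 i Hi). pose proof (HdK i Hi). pose proof (Hmar s).
  unfold g. apply Rmult_le_compat.
  - left. apply Rmin_pos; apply Hmar.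
  - left. apply Rinv_0_lt_compat. lra.
  - destruct s; [apply Rmin_l|apply Rmin_r].
  - apply Rinv_le_contravar; lra.
Qed.

Lemma upper_lt_lower (i j : nat) : (i < j)%nat -> (j <= n - 1)%nat -> upper i + g <= lower j.
Proof.
  intro Hij. pose proof g_pos as Hg.
  assert (K1 : forall k, (S k <= n - 1)%nat -> upper k + g <= lower (S k)).
  { intros k Hk. unfold lower, upper. destruct (Nat.eqb_spec (S k) 0), (Nat.eqb_spec k (n - 1)); try lia.
    pose proof (g_le (ty (S k)) (S k) ltac:(lia)). pose proof (g_le (ty (S k)) (S (S k)) ltac:(lia)). lra. }
  induction Hij as [|j Hij IH]; intro Hj; [now apply K1|].
  specialize (IH ltac:(lia)). pose proof (K1 j Hj). pose proof (lower_le_upper j ltac:(lia)). lra.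
Qed.

Lemma substrip_strip (i : nat) : (i <= n - 1)%nat -> alpha <= lower i /\ upper i <= beta.
Proof.
  intro Hi. pose proof g_pos. split.
  - destruct (Nat.eq_dec i 0) as [->|]; [unfold lower; simpl; lra|].
    pose proof (upper_lt_lower 0 i ltac:(lia) Hi). pose proof (lower_le_upper 0 ltac:(lia)).
    change (lower 0) with alpha in *. lra.
  - assert (E : upper (n - 1) = beta) by (unfold upper; now rewrite Nat.eqb_refl).
    destruct (Nat.eq_dec i (n - 1)) as [->|]; [lra|].
    pose proof (upper_lt_lower i (n - 1) ltac:(lia) ltac:(lia)).
    pose proof (lower_le_upper (n - 1) ltac:(lia)). lra.
Qed.

Lemma substrip_clear (i : nat) (u : Cpx) : (i <= n - 1)%nat ->
  substrip lower upper i u -> clear i (fst u).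
Proof.
  intros Hi Hu. unfold substrip in Hu. pose proof (substrip_strip i Hi). apply clear_iff; auto; lra.
Qed.

Lemma slope_abs (i : nat) : (i <= n - 1)%nat -> 2 <= Rabs (slope i) <= K.
Proof.
  intro Hi. pose proof (Hd2 (S i) ltac:(lia)). pose proof (HdK (S i) ltac:(lia)).
  assert (E : Rabs (slope i) = INR (d (S i))).
  { unfold slope. rewrite Rabs_mult, Rabs_Ropp, Rabs_sgn, Rabs_pos_eq; lra. }
  rewrite E. lra.
Qed.

(** Outside the substrip the model value overshoots an edge by more than [dl]: by [Htop] next to a
    circle, by [Hfirst] and [Houter] beyond the ends. This keeps the iteration in [lift_onto] inside
    the substrip. *)
Lemma tropical_range (i : nat) (x : R) : (i <= n - 1)%nat ->
  alpha - dl <= tropical i x <= beta + dl -> lower i <= x <= upper i.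
Proof.
  intros Hi Hy. pose proof (Hd2 (S i) ltac:(lia)) as Hd.
  assert (HT : forall s, sgn s * tropical i x <= edge s + dl) by (unfold edge; intros []; simpl; lra).
  assert (Hln2 : 0 <= ln 2) by (pose proof (ln_le 1 2 ltac:(lra) ltac:(lra)); rewrite ln_1 in *; lra).
  unfold lower, upper. split.
  - destruct (Nat.eqb_spec i 0) as [->|Hi0].
    + specialize (HT (ty 0)). pose proof (tropical_right 0 x ltac:(lia)) as HR.
      rewrite ty_S, sgn_negb, top_negb in HR by lia. pose proof (Htop (ty 0)).
      pose proof (Hmar (ty 0)). apply Rnot_lt_le. intro Hx.
      assert (INR (d 1%nat) * (ell 1%nat - alpha) <= INR (d 1%nat) * (ell 1%nat - x))
        by (apply Rmult_le_compat_l; lra). lra.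
    + specialize (HT (ty i)). rewrite tropical_left in HT by lia. pose proof (Htop (ty i)).
      assert (mar (ty i) / INR (d (S i)) <= x - ell i); [|lra]. apply div_mul_le; lra.
  - destruct (Nat.eqb_spec i (n - 1)) as [->|Hi1].
    + specialize (HT (negb (ty (n - 1)))). rewrite tropical_last in HT. unfold slope in HT.
      rewrite sgn_negb in HT. replace (S (n - 1)) with n in * by lia.
      replace (- sgn (ty (n - 1)) * (- sgn (ty (n - 1)) * INR (d n) * x))
        with (sgn (ty (n - 1)) * sgn (ty (n - 1)) * (INR (d n) * x)) in HT by ring.
      rewrite sgn_sq in HT. nra.
    + specialize (HT (ty (S i))). rewrite tropical_right in HT by lia. pose proof (Htop (ty (S i))).
      assert (mar (ty (S i)) / INR (d (S i)) <= ell (S i) - x); [|lra]. apply div_mul_le; lra.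
Qed.

Lemma lift_sub (i : nat) (u v : Cpx) : Csub (lift i u) (lift i v) =
  Cadd (Cscal (slope i) (Csub u v)) (Csub (error i u) (error i v)).
Proof. unfold lift, Cadd, Csub, Cscal; cbn [fst snd]. f_equal; ring. Qed.

Lemma lift_expands (i : nat) (u v : Cpx) : (i <= n - 1)%nat ->
  substrip lower upper i u -> substrip lower upper i v ->
  6 / 5 * Cnorm (Csub u v) <= Cnorm (Csub (lift i u) (lift i v)) <= (K + 1) * Cnorm (Csub u v).
Proof.
  intros Hi Hu Hv. pose proof (error_lip i u v Hi (substrip_clear i u Hi Hu) (substrip_clear i v Hi Hv)) as HE.
  pose proof (slope_abs i Hi) as Hs. pose proof (Cnorm_ge0 (Csub u v)) as HX.
  rewrite lift_sub. set (E := Csub (error i u) (error i v)) in *.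
  set (W := Cscal (slope i) (Csub u v)).
  assert (HW : Cnorm W = Rabs (slope i) * Cnorm (Csub u v)) by apply Cnorm_scal.
  split.
  - assert (T : Cnorm W <= Cnorm (Cadd W E) + Cnorm E).
    { rewrite <- (Cnorm_sign true E).
      replace W with (Cadd (Cadd W E) (Cscal (- sgn true) E)) at 1; [apply Cnorm_add|].
      destruct W, E; unfold Cadd, Cscal; simpl. f_equal; ring. }
    nra.
  - eapply Rle_trans; [apply Cnorm_add|]. rewrite HW. nra.
Qed.

(** The equation is solved for its linear part, u = (w - offset - error u) / slope, a contraction
    since the slope is at least 2 in absolute value and the error has Lipschitz constant below 1. *)
Lemma lift_onto (i : nat) (w : Cpx) : (i <= n - 1)%nat -> strip alpha beta w ->
  exists u, substrip lower upper i u /\ lift i u = w.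
Proof.
  intros Hi Hw. pose proof (slope_abs i Hi) as Hs.
  assert (Hs0 : slope i <> 0) by (intro E; rewrite E, Rabs_R0 in Hs; lra).
  assert (Hs1 : / Rabs (slope i) <= / 2) by (apply Rinv_le_contravar; lra).
  set (Phi := fun u => Cscal (/ slope i) (Csub (Csub w (offset i)) (error i u))).
  destruct (banach_substrip (lower i) (upper i) (/ 2) Phi) as [u [Hu E]].
  - now apply lower_le_upper.
  - lra.
  - intros u Hu. apply tropical_range; auto.
    pose proof (error_norm i u Hi (substrip_clear i u Hi Hu)) as HE.
    pose proof (Cnorm_fst (error i u)) as Hf.
    assert (Hf' : Rabs (fst (error i u)) <= dl) by lra. apply Rabs_le_between in Hf'.
    assert (ET : tropical i (fst (Phi u)) = fst w - fst (error i u)).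
    { unfold tropical, Phi, Cscal, Csub; cbn [fst snd]. field. auto. }
    rewrite ET. unfold strip in Hw. lra.
  - intros u v Hu Hv.
    pose proof (error_lip i u v Hi (substrip_clear i u Hi Hu) (substrip_clear i v Hi Hv)) as HE.
    assert (EP : Csub (Phi u) (Phi v) = Cscal (/ slope i) (Csub (error i v) (error i u))).
    { unfold Phi, Cscal, Csub; cbn [fst snd]. f_equal; ring. }
    rewrite EP, Cnorm_scal, Rabs_inv, (Cnorm_sub_sym (error i v)).
    pose proof (Cnorm_ge0 (Csub u v)). pose proof (Cnorm_ge0 (Csub (error i u) (error i v))).
    apply Rmult_le_compat; try lra. left. apply Rinv_0_lt_compat. lra.
  - exists u. split; auto. unfold lift. rewrite <- E at 1. unfold Phi, Cadd, Cscal, Csub; cbn [fst snd].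
    destruct w as [x y]; cbn [fst snd]. f_equal; field; auto.
Qed.

(** The pieces are half-open, so only the left end of a piece can be a critical circle. *)
Lemma locate_piece (x : R) : exists i, (i <= n - 1)%nat /\
  ((1 <= i)%nat -> ell i <= x) /\ ((S i <= n - 1)%nat -> x < ell (S i)).
Proof.
  assert (H : forall m, (m <= n - 1)%nat -> exists i, (i <= m)%nat /\
    ((1 <= i)%nat -> ell i <= x) /\ ((S i <= m)%nat -> x < ell (S i))).
  { induction m as [|m IH]; intro Hm.
    - exists O. repeat split; lia.
    - destruct (Rle_dec (ell (S m)) x) as [L|L].
      + exists (S m). repeat split; auto; lia.
      + destruct (IH ltac:(lia)) as [i [H1 [H2 H3]]]. exists i. repeat split; auto. intro Hi.
        destruct (Nat.eq_dec i m) as [->|]; [lra|apply H3; lia]. }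
  apply (H (n - 1)%nat). lia.
Qed.

Lemma annulus_dichotomy (w : Cpx) : strip alpha beta w ->
  (exists i, (i < n)%nat /\ substrip lower upper i w) \/
  (exists s, cap s (edge s + c0) (F (Some (cexp w)))).
Proof.
  intro Hw. unfold strip in Hw. destruct (locate_piece (fst w)) as [i [Hi [H1 H2]]].
  destruct (excluded_middle_informative (clear i (fst w))) as [Hc|Hc].
  - left. exists i. split; [lia|]. unfold substrip. now apply clear_iff.
  - right.
    destruct (excluded_middle_informative ((1 <= i)%nat -> clear_left i (fst w))) as [Hl|Hl].
    + assert (Hr : (S i <= n - 1)%nat /\ ~ clear_right i (fst w)).
      { split; [|intro; apply Hc; split; auto].
        destruct (le_dec (S i) (n - 1)); auto. exfalso. apply Hc. split; auto. intro; lia. }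
      exists (ty (S i)). apply (near_node_cap i); auto.
      apply between_in_piece; auto. intro Hi1. specialize (Hl Hi1). unfold clear_left in Hl.
      pose proof (Hmar (ty i)). pose proof (Hd2 (S i) ltac:(lia)). nra.
    + assert (Hi1 : (1 <= i)%nat) by (destruct (le_dec 1 i); auto; exfalso; apply Hl; intro; lia).
      assert (Hnc : ~ clear_left i (fst w)) by (intro; apply Hl; auto). clear Hl Hc.
      specialize (H1 Hi1). exists (ty i). apply cap_closed; [apply HF|]. intros delta Hdelta.
      pose proof (Hd2 (S i) ltac:(lia)) as Hd. unfold clear_left in Hnc. apply Rnot_le_lt in Hnc.
      (* The lift is only available off the circle [|z| = |a_i|], which is reached by continuity. *)
      set (r1 := (mar (ty i) - INR (d (S i)) * (fst w - ell i)) / (2 * INR (d (S i)))).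
      assert (Hr1 : 0 < r1) by (apply Rdiv_lt_0_compat; lra).
      assert (Er1 : INR (d (S i)) * r1 = (mar (ty i) - INR (d (S i)) * (fst w - ell i)) / 2)
        by (unfold r1; field; lra).
      set (r2 := if le_dec (S i) (n - 1) then (ell (S i) - fst w) / 2 else 1).
      assert (Hr2 : 0 < r2) by (unfold r2; destruct (le_dec (S i) (n - 1)) as [L|L]; [specialize (H2 L)|]; lra).
      pose proof (exp_pos (fst w + 1)) as Hex.
      set (r3 := delta / (4 * exp (fst w + 1))).
      assert (Hr3 : 0 < r3) by (apply Rdiv_lt_0_compat; lra).
      (* The bounds keep [v] within the margin of circle [i], below the next circle, within [delta]
         of [w] on the sphere, and at height at most [fst w + 1] for [cexp_lip]. *)
      set (t := Rmin (Rmin r1 r2) (Rmin r3 1)).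
      assert (Ht : 0 < t) by (apply Rmin_pos; apply Rmin_pos; lra).
      assert (Ht1 : t <= r1) by (eapply Rle_trans; apply Rmin_l).
      assert (Ht2 : t <= r2) by (eapply Rle_trans; [apply Rmin_l|apply Rmin_r]).
      assert (Ht3 : t <= r3) by (eapply Rle_trans; [apply Rmin_r|apply Rmin_l]).
      assert (Ht4 : t <= 1) by (eapply Rle_trans; [apply Rmin_r|apply Rmin_r]).
      set (v := (fst w + t, snd w)). exists (Some (cexp v)). split.
      * eapply Rle_lt_trans; [apply chordal_le_dist|].
        assert (Hv : Cnorm (Csub (cexp w) (cexp v)) <= exp (fst w + 1) * t).
        { eapply Rle_trans; [apply (cexp_lip _ _ (fst w + 1)); simpl; lra|].
          apply Rmult_le_compat_l; [lra|]. eapply Rle_trans; [apply Cnorm_le_abs|].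
          unfold Csub, v; simpl. rewrite Rminus_diag, Rabs_R0.
          replace (fst w - (fst w + t)) with (- t) by ring. rewrite Rabs_Ropp, Rabs_pos_eq; lra. }
        assert (exp (fst w + 1) * t <= delta / 4).
        { replace (delta / 4) with (exp (fst w + 1) * r3) by (unfold r3; field; lra).
          apply Rmult_le_compat_l; lra. }
        lra.
      * apply (near_node_cap i); auto.
        -- apply between_in_piece; auto.
           ++ intros _. simpl. lra.
           ++ intro L. simpl. specialize (H2 L). unfold r2 in Ht2.
              destruct (le_dec (S i) (n - 1)); [lra|lia].
        -- left. split; auto. split; auto. unfold clear_left. simpl fst.
           assert (INR (d (S i)) * t <= INR (d (S i)) * r1) by (apply Rmult_le_compat_l; lra).
           lra.
Qed.

(** Near infinity f behaves like z^(+-d_n), near 0 like a multiple of z^(+-d_1), which determines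
    the image pole. As the degrees are at least 1, the depth [x] is not lost, and the hypotheses on
    the ends add [c0]. *)
Lemma cap_step_cexp (s : bool) : exists s', forall x u, 0 <= x -> edge s + x <= sgn s * fst u ->
  cap s' (edge s' + x + c0) (F (Some (cexp u))).
Proof.
  destruct s.
  - exists (negb (ty (n - 1))). intros x u Hx Hu. cbn [sgn edge] in Hu.
    pose proof (Hd2 n ltac:(lia)) as Hdn. pose proof beta_clear as Hb.
    assert (Hc : clear (n - 1) (fst u)).
    { split; intro; [|lia]. unfold clear_left. replace (S (n - 1)) with n by lia.
      assert (INR (d n) * (beta - ell (n - 1)%nat) <= INR (d n) * (fst u - ell (n - 1)%nat))
        by (apply Rmult_le_compat_l; unfold edge in Hu; lra). lra. }
    rewrite (F_lift (n - 1)) by (lia || (apply clear_in_piece; [lia|exact Hc])).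
    apply cap_sgn. rewrite fst_lift, tropical_last. unfold slope. rewrite sgn_negb.
    replace (S (n - 1)) with n by lia.
    pose proof (error_norm (n - 1) u ltac:(lia) Hc) as HE.
    pose proof (Cnorm_fst (error (n - 1) u)) as Hf.
    assert (Hf' : Rabs (fst (error (n - 1) u)) <= dl) by lra. apply Rabs_le_between in Hf'.
    replace (- sgn (ty (n - 1)) * (- sgn (ty (n - 1)) * INR (d n) * fst u + fst (error (n - 1) u)))
      with (sgn (ty (n - 1)) * sgn (ty (n - 1)) * (INR (d n) * fst u)
            - sgn (ty (n - 1)) * fst (error (n - 1) u)) by ring.
    rewrite sgn_sq.
    assert (INR (d n) * (beta + x) <= INR (d n) * fst u) by (apply Rmult_le_compat_l; unfold edge in Hu; lra).
    assert (1 * x <= INR (d n) * x) by (apply Rmult_le_compat_r; lra).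
    destruct (ty (n - 1)); simpl in *; lra.
  - exists (ty 0). intros x u Hx Hu.
    pose proof (Hd2 1%nat ltac:(lia)) as Hd1.
    assert (Hu' : fst u <= alpha - x) by (unfold edge in Hu; simpl in Hu; lra).
    assert (HR : INR (d 1%nat) * (ell 1%nat - alpha) + INR (d 1%nat) * x <= INR (d 1%nat) * (ell 1%nat - fst u)).
    { rewrite <- Rmult_plus_distr_l. apply Rmult_le_compat_l; lra. }
    assert (1 * x <= INR (d 1%nat) * x) by (apply Rmult_le_compat_r; lra).
    assert (Hc : clear 0 (fst u)).
    { split; intro; [lia|]. unfold clear_right. pose proof (mar_le_G (ty 1)). lra. }
    rewrite (F_lift 0) by (lia || (apply clear_in_piece; [lia|exact Hc])).
    apply cap_sgn. rewrite fst_lift.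
    pose proof (error_norm 0 u ltac:(lia) Hc) as HE.
    pose proof (Cnorm_fst (error 0 u)) as Hf.
    assert (Hf' : Rabs (fst (error 0 u)) <= dl) by lra. apply Rabs_le_between in Hf'.
    pose proof (tropical_right 0 (fst u) ltac:(lia)) as HT.
    rewrite ty_S, sgn_negb, top_negb in HT by lia. pose proof (Htop (ty 0)). pose proof (Hmar (ty 0)).
    assert (Hln2 : 0 <= ln 2) by (pose proof (ln_le 1 2 ltac:(lra) ltac:(lra)); rewrite ln_1 in *; lra).
    rewrite Rmult_plus_distr_l.
    assert (- dl <= sgn (ty 0) * fst (error 0 u)) by (destruct (ty 0); cbn [sgn]; lra).
    lra.
Qed.

Lemma cap_step (s : bool) : exists s', forall x u, 0 <= x -> cap s (edge s + x) u ->
  cap s' (edge s' + x + c0) (F u).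
Proof.
  destruct (cap_step_cexp s) as [s' H]. exists s'. intros x u Hx Hu.
  assert (Hfin : forall z, z <> C0 -> cap s (edge s + x) (Some z) -> cap s' (edge s' + x + c0) (F (Some z))).
  { intros z Hz Hcz. destruct (cexp_surj z Hz) as [w [<- _]]. apply H; auto.
    apply (cap_log s _ _ (fst w) (Cnorm_cexp w)) in Hcz. destruct s; simpl in *; lra. }
  assert (Hpole : cap s' (edge s' + x + c0) (F (pole s))).
  { apply cap_closed; [apply HF|]. intros delta Hdelta.
    (* Deep enough to lie in the given cap and, by [cap_radius_small], within [delta] of the
       pole. *)
    set (N := Rabs (edge s) + x + 2 / delta).
    assert (HN : 0 < 2 / delta) by (apply Rdiv_lt_0_compat; lra).
    pose proof (Rabs_pos (edge s)). pose proof (Rle_abs (edge s)).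
    exists (Some (cexp (sgn s * N, 0))).
    assert (EN : Cnorm (cexp (sgn s * N, 0)) = exp (if s then N else - N)).
    { rewrite Cnorm_cexp. f_equal. destruct s; simpl; ring. }
    split.
    - rewrite chordal_sym, (chordal_pole s _ N EN).
      assert (HN2 : 2 / delta <= N) by (unfold N; lra).
      eapply Rlt_le_trans; [apply cap_radius_small; lra|].
      apply (Rmult_le_reg_r N); [lra|]. unfold Rdiv at 1. rewrite Rmult_assoc, Rinv_l by lra.
      apply (Rmult_le_compat_l delta) in HN2; [|lra].
      replace (delta * (2 / delta)) with 2 in HN2 by (field; lra). lra.
    - apply H; auto. simpl. rewrite <- Rmult_assoc, sgn_sq. unfold N. lra. }
  (* The opposite pole is at distance 2, more than the radius of any cap, and is thereby
     excluded. *)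
  assert (Hpp : chordal (Some C0) None = 2).
  { simpl. assert (E : Cnorm C0 = 0) by (unfold Cnorm, C0; simpl; rewrite Rmult_0_l, Rplus_0_r; apply sqrt_0).
    rewrite E, Rmult_0_l, Rplus_0_r, sqrt_1. field. }
  assert (Hr2 : cap_radius (edge s + x) < 2).
  { unfold cap_radius. pose proof (exp_pos (edge s + x)).
    assert (1 < sqrt (1 + exp (edge s + x) * exp (edge s + x))).
    { rewrite <- sqrt_1 at 1. apply sqrt_lt_1_alt. nra. }
    apply (Rmult_lt_reg_r (sqrt (1 + exp (edge s + x) * exp (edge s + x)))); [lra|].
    unfold Rdiv. rewrite Rmult_assoc, Rinv_l; lra. }
  destruct u as [z|].
  - destruct (excluded_middle_informative (z = C0)) as [->|Hz]; [|now apply Hfin].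
    destruct s; [|apply Hpole]. unfold cap, pole in Hu. lra.
  - destruct s; [apply Hpole|]. unfold cap, pole in Hu. rewrite chordal_sym in Hu. lra.
Qed.

Lemma finite_bound (f : nat -> R) (m : nat) : exists B, 0 <= B /\ forall i, (i < m)%nat -> Rabs (f i) <= B.
Proof.
  induction m as [|m [B [HB IH]]].
  - exists 0. split; [lra|]. intros; lia.
  - exists (B + Rabs (f m)). pose proof (Rabs_pos (f m)). split; [lra|]. intros i Hi.
    destruct (Nat.eq_dec i m) as [->|]; [lra|]. specialize (IH i ltac:(lia)). lra.
Qed.

Lemma rational_map_cantor_circles : cantor_set_of_circles (julia_set F).
Proof.
  destruct (finite_bound (fun i => snd (offset i)) n) as [B [HB HBi]]. pose proof dl_ge0 as Hdl0.
  apply (julia_cantor_circles n lift_degree lower upper lift alpha beta (6 / 5) (K + 1) (B + dl) g)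
    with (c0 := c0); try lra; auto.
  - apply g_pos.
  - intros i Hi. rewrite mult_slope. pose proof (slope_abs i ltac:(lia)). lra.
  - intros i u Hi Hu. unfold substrip in Hu. pose proof (substrip_strip i ltac:(lia)). unfold strip. lra.
  - intros i u v Hi Hu Hv. now apply lift_expands; [lia| |].
  - intros i u v Hi Hu Hv. now apply lift_expands; [lia| |].
  - intros i u m Hi Hu. apply lift_shift.
  - intros i u Hi Hu. rewrite mult_slope. specialize (HBi i Hi). cbv beta in HBi.
    pose proof (error_norm i u ltac:(lia) (substrip_clear i u ltac:(lia) Hu)) as HE.
    pose proof (Cnorm_snd (error i u)) as Hs. unfold lift, Cadd, Cscal; cbn [fst snd].
    replace (slope i * snd u + snd (offset i) + snd (error i u) - slope i * snd u)
      with (snd (offset i) + snd (error i u)) by ring.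
    eapply Rle_trans; [apply Rabs_triang|]. lra.
  - intros i w Hi Hw. apply lift_onto; auto. lia.
  - intros i j u v Hi Hj Hij Hu Hv. unfold substrip in *.
    destruct (lt_dec i j) as [L|L].
    + pose proof (upper_lt_lower i j L ltac:(lia)). rewrite Rabs_minus_sym.
      eapply Rle_trans; [|apply Rle_abs]. lra.
    + pose proof (upper_lt_lower j i ltac:(lia) ltac:(lia)).
      eapply Rle_trans; [|apply Rle_abs]. lra.
  - apply HF.
  - intros i u Hi Hu. apply F_lift; [lia|]. apply clear_in_piece; [lia|]. apply substrip_clear; [lia|auto].
  - apply annulus_dichotomy.
  - apply cap_step.
Qed.

End RationalMap.

(** * Choice of the parameters *)

Lemma bsum_term (f : nat -> R) (m k : nat) : (forall j, (1 <= j <= m)%nat -> 0 <= f j) ->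
  (1 <= k <= m)%nat -> f k <= bsum f m.
Proof.
  intros H Hk. pose proof (bsum_single k m (f k) ltac:(lia)) as E.
  replace (k <=? m)%nat with true in E by (symmetry; apply Nat.leb_le; lia).
  rewrite <- E. apply bsum_le. intros j Hj.
  destruct (Nat.eqb_spec j k) as [->|]; [lra|auto].
Qed.

Lemma degree_ge2 (n : nat) (d : nat -> nat) : (forall i, (1 <= i <= n)%nat -> (0 < d i)%nat) ->
  xi n d < 1 -> forall i, (1 <= i <= n)%nat -> 2 <= INR (d i).
Proof.
  intros Hd Hxi i Hi. change (xi n d) with (bsum (fun i => / INR (d i)) n) in Hxi.
  assert (H : / INR (d i) <= bsum (fun i => / INR (d i)) n).
  { apply (bsum_term (fun i => / INR (d i))); auto. intros j Hj. left.
    apply Rinv_0_lt_compat, lt_0_INR. auto. }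
  assert (d i <> 1%nat) by (intro E; rewrite E in H; simpl in H; rewrite Rinv_1 in H; lra).
  specialize (Hd i Hi). replace 2 with (INR 2) by (simpl; ring). apply le_INR. lia.
Qed.

Lemma Kmax_ge (n : nat) (d : nat -> nat) (i : nat) : (1 <= i <= n)%nat ->
  INR (d i) <= INR (Kmax n d).
Proof.
  intro Hi. apply le_INR. unfold Kmax.
  assert (H : In i (seq 1 n)) by (apply in_seq; lia). revert H. generalize (seq 1 n).
  induction l as [|j l IH]; simpl; [tauto|]. intros [->|H]; [lia|]. specialize (IH H). lia.
Qed.

(** If every degree were at most 2, the sum would be at least n / 2, hence at least 1. *)
Lemma Kmax_ge3 (n : nat) (d : nat -> nat) : (2 <= n)%nat ->
  (forall i, (1 <= i <= n)%nat -> (0 < d i)%nat) -> xi n d < 1 -> 3 <= INR (Kmax n d).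
Proof.
  intros Hn Hd Hxi. destruct (le_lt_dec 3 (Kmax n d)) as [L|L].
  - apply le_INR in L. simpl in L. lra.
  - exfalso. change (xi n d) with (bsum (fun i => / INR (d i)) n) in Hxi.
    assert (H : bsum (fun _ => / 2) n <= bsum (fun i => / INR (d i)) n).
    { apply bsum_le. intros j Hj. pose proof (degree_ge2 n d Hd Hxi j Hj).
      apply Rinv_le_contravar; [lra|]. pose proof (Kmax_ge n d j Hj).
      assert (Hk : (Kmax n d <= 2)%nat) by lia. apply le_INR in Hk. simpl in Hk. lra. }
    rewrite bsum_const in H. apply le_INR in Hn. simpl in Hn. lra.
Qed.

(** The left side equals 1 / (e^m - 1). *)
Lemma ratio_exp_le (m : R) : 0 < m -> ratio (exp (- m)) <= / m.
Proof.
  intro Hm. unfold ratio. pose proof (exp_ineq1 m ltac:(lra)) as H. rewrite exp_Ropp.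
  replace (/ exp m / (1 - / exp m)) with (/ (exp m - 1)) by (field; lra).
  apply Rinv_le_contravar; lra.
Qed.

Lemma ln2_bounds : 0 < ln 2 < 1.
Proof.
  split.
  - rewrite <- ln_1. apply ln_increasing; lra.
  - rewrite <- (ln_exp 1). apply ln_increasing; [lra|]. pose proof (exp_ineq1 1 ltac:(lra)). lra.
Qed.

(** The budget of the case p = 1: 2/15 is the bound on [dl] obtained from K >= 3, and 1/25 is the
    value of [c0]. *)
Lemma ln_6_5 : 2 / 15 + 1 / 25 <= ln (6 / 5).
Proof.
  rewrite <- (ln_exp (2 / 15 + 1 / 25)). apply ln_le; [apply exp_pos|].
  (* The inequality e^y <= 1 / (1 - y) for the whole exponent would give 75/62, more than 6/5; for
     half of it, squaring gives less. *)
  set (y := (2 / 15 + 1 / 25) / 2). replace (2 / 15 + 1 / 25) with (y + y) by (unfold y; field).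
  rewrite exp_plus. pose proof (exp_ineq1_le (- y)) as H. rewrite exp_Ropp in H.
  pose proof (exp_pos y) as Hy. set (E := exp y) in *.
  assert (HE : (1 - y) * E <= 1).
  { apply (Rmult_le_compat_r E) in H; [|lra]. rewrite Rinv_l in H by lra. lra. }
  unfold y in HE. assert (E <= 150 / 137) by lra. nra.
Qed.

Section ParameterChoice.
Context (n p : nat) (d : nat -> nat) (a : nat -> Cpx) (K alpha beta c0 dl : R) (top mar : bool -> R).
Let G := top true + top false.
Context (F : Sphere -> Sphere) (Hn : (2 <= n)%nat) (Hp : (p <= 1)%nat)
  (Hd2 : forall i, (1 <= i <= n)%nat -> 2 <= INR (d i))
  (HdK : forall i, (1 <= i <= n)%nat -> INR (d i) <= K)
  (Hlast : Cnorm (a (n - 1)%nat) = exp (- top (ty n p (n - 1)) / INR (d n)))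
  (Hstep : forall j, (1 <= j <= n - 2)%nat ->
     Cnorm (a j) = exp (- G / INR (d (S j))) * Cnorm (a (S j)))
  (HF : is_rational_map p n d a F)
  (Hc0 : 0 < c0) (Hab : alpha < beta)
  (Hmar : forall s, 0 < mar s) (Hmm : mar true + mar false <= G)
  (Hfirst : alpha <= - top (ty n p (n - 1)) / INR (d n) - G * (xi n d - / INR (d n)))
  (Houter : (if negb (ty n p (n - 1)) then beta else - alpha) + dl + c0 <= INR (d n) * beta)
  (Htop : forall s : bool, (if s then beta else - alpha) + ln 2 + dl + c0 <= top s - mar s)
  (Hdl : ratio (exp (- mar true)) + INR n * ratio (exp (- mar false)) <= dl)
  (HKdl : 2 * K * dl <= 4 / 5).

Lemma critical_radius_pos (j : nat) : (1 <= j <= n - 1)%nat -> 0 < Cnorm (a j).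
Proof.
  intro Hj. remember (n - 1 - j)%nat as k eqn:Ek. revert j Hj Ek.
  induction k as [|k IH]; intros j Hj Ek.
  - replace j with (n - 1)%nat by lia. rewrite Hlast. apply exp_pos.
  - rewrite Hstep by lia. apply Rmult_lt_0_compat; [apply exp_pos|]. apply IH; lia.
Qed.

Let ell (j : nat) : R := ln (Cnorm (a j)).

Lemma ell_diff (j : nat) : (1 <= j <= n - 2)%nat -> ell (S j) - ell j = G * / INR (d (S j)).
Proof.
  intro Hj. unfold ell. rewrite (Hstep j Hj), ln_mult, ln_exp.
  - unfold Rdiv. ring.
  - apply exp_pos.
  - apply critical_radius_pos. lia.
Qed.

Lemma ell_first (m : nat) : (S m <= n - 1)%nat ->
  ell (S m) = ell 1%nat + G * (bsum (fun i => / INR (d i)) (S m) - / INR (d 1%nat)).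
Proof.
  induction m as [|m IH]; intro Hm.
  - rewrite bsum_S, bsum_0. ring.
  - rewrite bsum_S. specialize (IH ltac:(lia)). pose proof (ell_diff (S m) ltac:(lia)) as E. lra.
Qed.

(** Summing the widths [G / d] of the gaps gives [ell 1 - G / d_1 = ell (n - 1) - G * (xi - 1 /
    d_n)], so the present [Hfirst] yields the one of the previous section. *)
Lemma parameters_cantor_circles : cantor_set_of_circles (julia_set F).
Proof.
  set (theta := fun j => snd (epsilon (inhabits C0) (fun u => cexp u = a j /\ fst u = ln (Cnorm (a j))))).
  assert (Ha : forall j, (1 <= j <= n - 1)%nat -> a j = cexp (node ell theta j)).
  { intros j Hj. pose proof (critical_radius_pos j Hj) as Hpos.
    assert (Hz : a j <> C0).
    { intro E. rewrite E in Hpos. unfold Cnorm, C0 in Hpos; simpl in Hpos.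
      rewrite Rmult_0_l, Rplus_0_r, sqrt_0 in Hpos. lra. }
    pose proof (epsilon_spec (inhabits C0) _ (cexp_surj (a j) Hz)) as [E1 E2].
    rewrite <- E1 at 1. f_equal. unfold node, theta, ell. rewrite <- E2 at 1.
    apply surjective_pairing. }
  pose proof (Hd2 n ltac:(lia)) as Hdn. pose proof (Hd2 1%nat ltac:(lia)) as Hd1.
  assert (Hel : ell (n - 1)%nat = - top (ty n p (n - 1)) / INR (d n)).
  { unfold ell. now rewrite Hlast, ln_exp. }
  apply (rational_map_cantor_circles n p d a ell theta Hn Hp Ha Hd2 K alpha beta c0 dl top mar);
    auto.
  - intros j Hj. rewrite ell_diff by auto. pose proof (Hd2 (S j) ltac:(lia)). fold G. field. lra.
  - rewrite Hel. field. lra.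
  - pose proof (ell_first (n - 2) ltac:(lia)) as E. replace (S (n - 2)) with (n - 1)%nat in E by lia.
    change (xi n d) with (bsum (fun i => / INR (d i)) n) in Hfirst.
    replace n with (S (n - 1)) in Hfirst at 4 by lia. rewrite bsum_S in Hfirst.
    replace (S (n - 1)) with n in Hfirst by lia. rewrite <- Hel in Hfirst.
    fold G. assert (Hx : G * / INR (d 1%nat) <= ell 1%nat - alpha) by lra.
    apply (Rmult_le_compat_l (INR (d 1%nat))) in Hx; [|lra].
    replace (INR (d 1%nat) * (G * / INR (d 1%nat))) with G in Hx by (field; lra). exact Hx.
Qed.

End ParameterChoice.

Lemma neg_ln_gt (s X : R) : 0 < s < exp (- X) -> X < - ln s.
Proof. intros [H0 H]. apply ln_increasing in H; auto. rewrite ln_exp in H. lra. Qed.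

(** For p = 1 the last circle carries zeros and infinity is fixed, so [beta] can be a constant. With
    S = - ln s the moduli mean [top false = S + 2 ln K] and [G = S + 5 ln K], hence
    [top true = 3 ln K]. *)
Lemma case_p1 (n : nat) (d : nat -> nat) : (2 <= n)%nat ->
  (forall i, (1 <= i <= n)%nat -> (0 < d i)%nat) -> xi n d < 1 ->
  exists sstar, 0 < sstar /\
    forall s1, 0 < s1 < sstar ->
    forall a : nat -> Cpx,
      Cnorm (a (n - 1)%nat) = Rpower (s1 * / INR (Kmax n d) ^ 2) (/ INR (d n)) ->
      (forall i, (1 <= i <= n - 2)%nat ->
        Cnorm (a i) = Rpower (s1 * / INR (Kmax n d) ^ 5) (/ INR (d (S i))) * Cnorm (a (S i))) ->
      forall F, is_rational_map 1 n d a F -> cantor_set_of_circles (julia_set F).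
Proof.
  intros Hn Hd Hxi. pose proof (degree_ge2 n d Hd Hxi) as Hd2. pose proof (Kmax_ge n d) as HdK.
  pose proof (Kmax_ge3 n d Hn Hd Hxi) as HK. set (K := INR (Kmax n d)) in *.
  (* [alpha] will be halfway between - xi * S and - S, which leaves room [2 * e * S] on either
     side. *)
  set (e := (1 - xi n d) / 4). assert (He : 0 < e) by (unfold e; lra).
  assert (Hxn : / INR (d n) <= xi n d).
  { apply (bsum_term (fun i => / INR (d i))); [|lia]. intros j Hj. left.
    apply Rinv_0_lt_compat, lt_0_INR. auto. }
  pose proof (Hd2 n ltac:(lia)) as Hdn.
  assert (Hyn : 0 < / INR (d n)) by (apply Rinv_0_lt_compat; lra).
  assert (HlnK : ln 3 <= ln K) by (apply ln_le; lra).
  assert (Hln3 : 0 < ln 3) by (rewrite <- ln_1; apply ln_increasing; lra).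
  pose proof (le_INR _ _ Hn) as HnR. simpl in HnR. set (k := ln K) in *.
  (* Makes [e * S] exceed 80 K n, for the [n] small error terms, plus 2 for [ln 2 + dl + c0], plus 5
     ln K for the powers of K in the moduli. *)
  exists (exp (- ((80 * K * INR n + 2 + 5 * k) / e))). split; [apply exp_pos|].
  intros s Hs a Hlast Hstep F HF. apply neg_ln_gt in Hs as HS. destruct Hs as [Hs0 _].
  set (S := - ln s) in *.
  apply (Rmult_lt_compat_l e) in HS; auto.
  replace (e * ((80 * K * INR n + 2 + 5 * k) / e)) with (80 * K * INR n + 2 + 5 * k) in HS
    by (field; lra).
  assert (HKn : 0 < K * INR n) by (apply Rmult_lt_0_compat; lra).
  assert (HSpos : 0 < S) by nra.
  assert (Hpow : forall m, ln (s * / K ^ m) = - (S + INR m * k)).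
  { intro m. assert (0 < K ^ m) by (apply pow_lt; lra).
    rewrite ln_mult, ln_Rinv, ln_pow; auto; try lra; [|now apply Rinv_0_lt_compat].
    unfold S, k. ring. }
  set (mf := e * S). assert (Hmf : 80 * K * INR n + 2 + 5 * k < mf) by exact HS.
  assert (Hmf0 : 0 < mf) by lra.
  (* Then [exp (- mt) = 3 / K^3], and the bound 2 K * 3 / (K^3 - 3) <= 3/4 below is an equality at K
     = 3. *)
  set (mt := 3 * k - ln 3). assert (Hmt : 0 < mt) by (unfold mt; lra).
  set (top := fun b : bool => if b then 3 * k else S + 2 * k).
  set (mar := fun b : bool => if b then mt else mf).
  set (dl := ratio (exp (- mt)) + INR n * ratio (exp (- mf))).
  assert (Hdl : 2 * K * dl <= 4 / 5).
  { assert (R1 : ratio (exp (- mt)) = 3 / (K * K * K - 3)).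
    { unfold mt, ratio. replace (- (3 * k - ln 3)) with (ln 3 + - (k + k + k)) by ring.
      rewrite exp_plus, exp_ln, exp_Ropp, !exp_plus by lra. unfold k. rewrite exp_ln by lra.
      assert (27 <= K * K * K) by nra. field. repeat split; nra. }
    assert (R2 : ratio (exp (- mf)) <= / (80 * K * INR n)).
    { eapply Rle_trans; [now apply ratio_exp_le|]. apply Rinv_le_contravar; lra. }
    assert (R3 : INR n * ratio (exp (- mf)) <= / (80 * K)).
    { replace (/ (80 * K)) with (INR n * / (80 * K * INR n)) by (field; lra).
      apply Rmult_le_compat_l; lra. }
    assert (HK3 : 8 * K <= K * K * K - 3) by nra.
    assert (R4 : 2 * K * (3 / (K * K * K - 3)) <= 3 / 4).
    { replace (2 * K * (3 / (K * K * K - 3))) with (6 * K / (K * K * K - 3)) by (field; nra).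
      apply (Rmult_le_reg_r (K * K * K - 3)); [lra|]. unfold Rdiv. rewrite Rmult_assoc, Rinv_l by lra.
      lra. }
    assert (R5 : 2 * K * / (80 * K) = 1 / 40) by (field; lra).
    unfold dl. rewrite R1, Rmult_plus_distr_l.
    assert (2 * K * (INR n * ratio (exp (- mf))) <= 2 * K * / (80 * K)) by (apply Rmult_le_compat_l; lra).
    lra. }
  assert (Hdl0 : 0 <= dl).
  { unfold dl. assert (forall m, 0 < m -> 0 <= ratio (exp (- m))).
    { intros m Hm. apply ratio_ge0. split; [left; apply exp_pos|]. rewrite <- exp_0.
      apply exp_increasing. lra. }
    apply Rplus_le_le_0_compat; [auto|]. apply Rmult_le_pos; [lra|auto]. }
  assert (Hdl1 : dl <= 2 / 15) by nra.
  pose proof ln_6_5 as H65. pose proof ln2_bounds as H2.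
  assert (H54 : ln (6 / 5) <= ln (5 / 4)) by (apply ln_le; lra).
  (* At a pole circle [top - mar = ln 3] has to pay for [beta = ln (5/4)], for [ln 2] and for
     [dl + c0], which leaves [ln (6/5)] for the last. *)
  assert (H3 : ln 3 = ln (6 / 5) + ln (5 / 4) + ln 2).
  { rewrite <- !ln_mult by lra. f_equal. field. }
  set (alpha := - ((1 + xi n d) / 2 * S)).
  assert (Hal : alpha = - (xi n d * S + 2 * mf)) by (unfold alpha, mf, e; field).
  assert (Hal2 : alpha = - (S - 2 * mf)) by (unfold alpha, mf, e; field).
  assert (Hty : ty n 1 (n - 1) = false).
  { unfold ty. replace (n - (n - 1) - 1)%nat with 0%nat by lia. reflexivity. }
  assert (HxS : 0 < xi n d * S) by (apply Rmult_lt_0_compat; lra).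
  apply (parameters_cantor_circles n 1 d a K alpha (ln (5 / 4)) (1 / 25) dl top mar F); auto.
  - rewrite Hty, Hlast. unfold Rpower. rewrite Hpow. f_equal. unfold top. simpl. field. lra.
  - intros j Hj. rewrite (Hstep j Hj). f_equal. unfold Rpower. rewrite Hpow. f_equal.
    pose proof (Hd2 (Datatypes.S j) ltac:(lia)). unfold top. simpl. field. lra.
  - lra.
  - lra.
  - intros []; auto.
  - unfold mar, top, mt. assert (mf <= S) by (unfold mf, e; nra). lra.
  - rewrite Hty. unfold top. unfold Rdiv.
    assert (E1 : k * / INR (d n) <= k * xi n d) by (apply Rmult_le_compat_l; lra).
    assert (E2 : k * xi n d <= k * 1) by (apply Rmult_le_compat_l; lra).
    assert (E3 : 0 < k * / INR (d n)) by (apply Rmult_lt_0_compat; lra).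
    rewrite Hal. lra.
  - rewrite Hty. simpl negb. cbv iota. nra.
  - intros []; unfold top, mar, mt; lra.
  - unfold mar, dl. lra.
Qed.

(** For p = 0 the last circle carries poles and infinity is sent to 0, so by [Houter] [beta] must
    exceed - alpha / d_n and grows with S = - ln s. Levels, edges and margins are all taken
    proportional to S. *)
Lemma case_p0 (n : nat) (d : nat -> nat) : (2 <= n)%nat ->
  (forall i, (1 <= i <= n)%nat -> (0 < d i)%nat) -> xi n d < 1 ->
  exists sstar, 0 < sstar /\
    forall s0, 0 < s0 < sstar ->
    forall a : nat -> Cpx,
      Cnorm (a (n - 1)%nat) =
        Rpower (Rpower s0 (/ INR (d n) + (1 - xi n d) / 3)) (/ INR (d n)) ->
      (forall i, (1 <= i <= n - 2)%nat ->
        Cnorm (a i) =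
          Rpower (Rpower s0 (1 + / INR (d n) + 2 * (1 - xi n d) / 3))
                 (/ INR (d (S i))) * Cnorm (a (S i))) ->
      forall F, is_rational_map 0 n d a F -> cantor_set_of_circles (julia_set F).
Proof.
  intros Hn Hd Hxi. pose proof (degree_ge2 n d Hd Hxi) as Hd2. pose proof (Kmax_ge n d) as HdK.
  pose proof (Kmax_ge3 n d Hn Hd Hxi) as HK. set (K := INR (Kmax n d)) in *.
  (* The levels exceed the edges by [h * S / 2]; half of this is the margin, the other half absorbs
     the bounded errors. *)
  set (h := (1 - xi n d) / 3). assert (Hh : 0 < h) by (unfold h; lra).
  assert (Hxh : xi n d = 1 - 3 * h) by (unfold h; field).
  pose proof (Hd2 n ltac:(lia)) as Hdn. set (y := / INR (d n)).
  assert (Hy : 0 < y) by (apply Rinv_0_lt_compat; lra).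
  assert (Hyd : INR (d n) * y = 1) by (unfold y; field; lra).
  pose proof (le_INR _ _ Hn) as HnR. simpl in HnR.
  (* Makes the margin [h * S / 4] exceed 10 K (n + 1), so that the n + 1 error terms give
     [2 * K * dl <= 1 / 5]. *)
  exists (exp (- (40 * K * (INR n + 1) / h))). split; [apply exp_pos|].
  intros s Hs a Hlast Hstep F HF. apply neg_ln_gt in Hs as HS. set (S := - ln s) in *.
  apply (Rmult_lt_compat_l h) in HS; auto.
  replace (h * (40 * K * (INR n + 1) / h)) with (40 * K * (INR n + 1)) in HS by (field; lra).
  assert (HKn : 9 <= K * (INR n + 1)) by nra.
  assert (HhS : 360 <= h * S) by lra. assert (HSpos : 0 < S) by nra.
  set (m := h * S / 4). assert (Hm : 0 < m) by (unfold m; lra).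
  set (top := fun b : bool => if b then (y + h) * S else (1 + h) * S).
  set (dl := (INR n + 1) * ratio (exp (- m))).
  assert (Hr0 : 0 <= ratio (exp (- m))).
  { apply ratio_ge0. split; [left; apply exp_pos|]. rewrite <- exp_0. apply exp_increasing. lra. }
  assert (Hdl0 : 0 <= dl) by (unfold dl; apply Rmult_le_pos; lra).
  assert (Hdl : 2 * K * dl <= 1 / 5).
  { assert (R2 : ratio (exp (- m)) <= / (10 * K * (INR n + 1))).
    { eapply Rle_trans; [now apply ratio_exp_le|]. apply Rinv_le_contravar; unfold m; lra. }
    unfold dl. replace (1 / 5) with (2 * K * ((INR n + 1) * / (10 * K * (INR n + 1)))) by (field; lra).
    apply Rmult_le_compat_l; [lra|]. apply Rmult_le_compat_l; lra. }
  assert (Hdl1 : dl <= 1) by nra.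
  pose proof ln2_bounds as H2.
  set (alpha := - ((1 + h / 2) * S)). set (beta := (y + h / 2) * S).
  assert (Hty : ty n 0 (n - 1) = true).
  { unfold ty. replace (n - (n - 1) - 0)%nat with 1%nat by lia. reflexivity. }
  assert (HyS : 0 < y * S) by (apply Rmult_lt_0_compat; lra).
  apply (parameters_cantor_circles n 0 d a K alpha beta (1 / 25) dl top (fun _ => m) F); auto.
  - rewrite Hty, Hlast. unfold Rpower. rewrite ln_exp. f_equal. unfold top. fold y h.
    replace (ln s) with (- S) by (unfold S; ring). unfold Rdiv. fold y. ring.
  - intros j Hj. rewrite (Hstep j Hj). f_equal. unfold Rpower. rewrite ln_exp. f_equal.
    replace (ln s) with (- S) by (unfold S; ring). unfold top.
    replace (2 * (1 - xi n d) / 3) with (2 * h) by (unfold h; field). fold y. unfold Rdiv. ring.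
  - lra.
  - unfold alpha, beta. lra.
  - unfold top, m. lra.
  - rewrite Hty, Hxh. unfold top. unfold Rdiv. fold y. unfold alpha.
    (* The slack in [Hfirst], expanded with xi = 1 - 3 h. *)
    assert (E : 0 <= (h / 2 + h + 4 * h * y + 6 * h * h) * S).
    { apply Rmult_le_pos; [|lra]. assert (0 < h * y) by (apply Rmult_lt_0_compat; lra). nra. }
    lra.
  - rewrite Hty. simpl negb. cbv iota. unfold alpha, beta.
    replace (INR (d n) * ((y + h / 2) * S)) with (INR (d n) * y * S + INR (d n) * (h * S) / 2) by field.
    rewrite Hyd. nra.
  - intros []; unfold top, m, alpha, beta; lra.
  - unfold dl. lra.
  - lra.
Qed.

Lemma exists_critical_points (n : nat) (d : nat -> nat) (B1 B2 : R) : (2 <= n)%nat ->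
  (forall i, (1 <= i <= n)%nat -> (0 < d i)%nat) -> 0 < B1 < 1 -> 0 < B2 < 1 ->
  exists a : nat -> Cpx,
    Cnorm (a (n - 1)%nat) = Rpower B1 (/ INR (d n)) /\
    (forall i, (1 <= i <= n - 2)%nat ->
      Cnorm (a i) = Rpower B2 (/ INR (d (S i))) * Cnorm (a (S i))) /\
    0 < Cnorm (a 1%nat) /\
    (forall i, (1 <= i <= n - 2)%nat -> Cnorm (a i) < Cnorm (a (S i))) /\
    Cnorm (a (n - 1)%nat) < 1.
Proof.
  intros Hn Hd HB1 HB2.
  assert (Hln : forall B, 0 < B < 1 -> ln B < 0).
  { intros B HB. rewrite <- ln_1. apply ln_increasing; lra. }
  assert (Hinv : forall i, (1 <= i <= n)%nat -> 0 < / INR (d i)).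
  { intros i Hi. apply Rinv_0_lt_compat, lt_0_INR. auto. }
  assert (HP : forall B i, 0 < B < 1 -> (1 <= i <= n)%nat -> Rpower B (/ INR (d i)) < 1).
  { intros B i HB Hi. unfold Rpower. rewrite <- exp_0. apply exp_increasing.
    specialize (Hln B HB). specialize (Hinv i Hi). nra. }
  set (inv := fun i => / INR (d i)).
  (* The logarithms of the moduli, with the recursion solved from the outermost circle inwards. *)
  set (L := fun j => ln B1 * inv n + ln B2 * (bsum inv (n - 1) - bsum inv j)).
  assert (HN : forall j, Cnorm (exp (L j), 0) = exp (L j)).
  { intro j. pose proof (Cnorm_cexp (L j, 0)) as E. unfold cexp in E; simpl in E.
    rewrite cos_0, sin_0, Rmult_1_r, Rmult_0_r in E. exact E. }
  assert (HS : forall i, exp (L i) = Rpower B2 (/ INR (d (S i))) * exp (L (S i))).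
  { intro i. unfold Rpower. rewrite <- exp_plus. f_equal. unfold L. rewrite bsum_S. fold (inv (S i)). ring. }
  assert (HT : exp (L (n - 1)%nat) = Rpower B1 (/ INR (d n))).
  { unfold Rpower, L. f_equal. fold (inv n). ring. }
  exists (fun j => (exp (L j), 0)).
  split; [now rewrite HN|]. split; [|split; [|split]].
  - intros i Hi. rewrite !HN. apply HS.
  - rewrite HN. apply exp_pos.
  - intros i Hi. rewrite !HN, HS. pose proof (exp_pos (L (S i))).
    specialize (HP B2 (S i) HB2 ltac:(lia)). nra.
  - rewrite HN, HT. apply HP; auto. lia.
Qed.

Lemma mul_inv_pow_lt1 (s K : R) (m : nat) : 0 < s < 1 -> 1 <= K -> 0 < s * / K ^ m < 1.
Proof.
  intros Hs HK. pose proof (pow_R1_Rle K m HK) as H. assert (0 < / K ^ m) by (apply Rinv_0_lt_compat; lra).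
  split; [apply Rmult_lt_0_compat; lra|].
  assert (/ K ^ m <= 1) by (rewrite <- Rinv_1; apply Rinv_le_contravar; lra). nra.
Qed.

Lemma Rpower_lt1 (s x : R) : 0 < s < 1 -> 0 < x -> 0 < Rpower s x < 1.
Proof.
  intros Hs Hx. unfold Rpower. split; [apply exp_pos|]. rewrite <- exp_0. apply exp_increasing.
  assert (ln s < 0) by (rewrite <- ln_1; apply ln_increasing; lra). nra.
Qed.

Theorem theorem2p5 :
  (* (a) case p = 1 *)
  (forall (n : nat) (d : nat -> nat),
    (2 <= n)%nat ->
    (forall i, (1 <= i <= n)%nat -> (0 < d i)%nat) ->
    xi n d < 1 ->
    exists sstar, 0 < sstar /\
      forall s1, 0 < s1 < sstar ->
      forall a : nat -> Cpx,
        Cnorm (a (n - 1)%nat) =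
          Rpower (s1 * / INR (Kmax n d) ^ 2) (/ INR (d n)) ->
        (forall i, (1 <= i <= n - 2)%nat ->
          Cnorm (a i) =
            Rpower (s1 * / INR (Kmax n d) ^ 5) (/ INR (d (S i))) * Cnorm (a (S i))) ->
        forall F, is_rational_map 1 n d a F ->
          cantor_set_of_circles (julia_set F)) /\
  (* (b) case p = 0 *)
  (forall (n : nat) (d : nat -> nat),
    (2 <= n)%nat ->
    (forall i, (1 <= i <= n)%nat -> (0 < d i)%nat) ->
    xi n d < 1 ->
    exists sstar, 0 < sstar /\
      forall s0, 0 < s0 < sstar ->
      forall a : nat -> Cpx,
        Cnorm (a (n - 1)%nat) =
          Rpower (Rpower s0 (/ INR (d n) + (1 - xi n d) / 3)) (/ INR (d n)) ->
        (forall i, (1 <= i <= n - 2)%nat ->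
          Cnorm (a i) =
            Rpower (Rpower s0 (1 + / INR (d n) + 2 * (1 - xi n d) / 3))
                   (/ INR (d (S i))) * Cnorm (a (S i))) ->
        forall F, is_rational_map 0 n d a F ->
          cantor_set_of_circles (julia_set F)) /\
  (* in particular: existence of parameters *)
  (forall (p n : nat) (d : nat -> nat),
    (p <= 1)%nat -> (2 <= n)%nat ->
    (forall i, (1 <= i <= n)%nat -> (0 < d i)%nat) ->
    xi n d < 1 ->
    exists a : nat -> Cpx,
      0 < Cnorm (a 1%nat) /\
      (forall i, (1 <= i <= n - 2)%nat -> Cnorm (a i) < Cnorm (a (S i))) /\
      Cnorm (a (n - 1)%nat) < 1 /\
      forall F, is_rational_map p n d a F ->
        cantor_set_of_circles (julia_set F)).
Proof.
  split; [exact case_p1|]. split; [exact case_p0|].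
  intros p n d Hp Hn Hd Hxi.
  assert (H : (p = 0 \/ p = 1)%nat) by lia. destruct H as [-> | ->].
  (* The bound 1/2 keeps s below 1, so that all moduli are below 1 and increase with the index. *)
  - destruct (case_p0 n d Hn Hd Hxi) as [st [Hst H]]. set (s := Rmin (st / 2) (/ 2)).
    assert (Hs : 0 < s) by (apply Rmin_pos; lra).
    assert (Hs1 : s <= st / 2) by apply Rmin_l. assert (Hs2 : s <= / 2) by apply Rmin_r.
    assert (Hy : 0 < / INR (d n)) by (apply Rinv_0_lt_compat, lt_0_INR, Hd; lia).
    destruct (exists_critical_points n d (Rpower s (/ INR (d n) + (1 - xi n d) / 3))
      (Rpower s (1 + / INR (d n) + 2 * (1 - xi n d) / 3))) as [a [A1 [A2 [A3 [A4 A5]]]]]; auto.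
    + apply Rpower_lt1; lra.
    + apply Rpower_lt1; lra.
    + exists a. repeat split; auto. intros F HF. apply (H s ltac:(lra) a A1 A2 F HF).
  - destruct (case_p1 n d Hn Hd Hxi) as [st [Hst H]]. set (s := Rmin (st / 2) (/ 2)).
    assert (Hs : 0 < s) by (apply Rmin_pos; lra).
    assert (Hs1 : s <= st / 2) by apply Rmin_l. assert (Hs2 : s <= / 2) by apply Rmin_r.
    pose proof (Kmax_ge3 n d Hn Hd Hxi) as HK.
    destruct (exists_critical_points n d (s * / INR (Kmax n d) ^ 2)
      (s * / INR (Kmax n d) ^ 5)) as [a [A1 [A2 [A3 [A4 A5]]]]]; auto.
    + apply mul_inv_pow_lt1; lra.
    + apply mul_inv_pow_lt1; lra.
    + exists a. repeat split; auto. intros F HF. apply (H s ltac:(lra) a A1 A2 F HF).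
Qed.
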